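(* Let $X(\mathbb{R})$ be a separable Banach function space such that the Hardy-Littlewood maximal operator $M$ is bounded on $X(\mathbb{R})$ and on its associate space $X'(\mathbb{R})$. Suppose that $\psi$ is an orthonormal differentiable wavelet such that $\psi$ and $\psi'$ have a common radial decreasing $L^1$-majorant $W$ satisfying $\int_0^\infty sW(s)\,ds<\infty$, and such that $\psi_{j,k}\in X'(\mathbb{R})$ for all $j,k\in\mathbb{Z}$. Then the sublinear operator \[ (Vf)(x)=\Big(\sum_{j\in\mathbb{Z}}\sum_{k\in\mathbb{Z}}|\langle f,\psi_{j,k}\rangle\psi_{j,k}(x)|^2\Big)^{1/2},\quad x\in\mathbb{R}, \] is bounded on $X(\mathbb{R})$, i.e. there is $C>0$ with $\|Vf\|_{X(\mathbb{R})}\le C\|f\|_{X(\mathbb{R})}$ for all $f\in X(\mathbb{R})$.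
   Context: A Banach function norm is a map $\rho$ from nonnegative measurable functions on $\mathbb{R}$ to $[0,\infty]$ that is a norm-like functional ($\rho(f)=0\iff f=0$ a.e., positive homogeneous, subadditive), has the lattice property, the Fatou property ($0\le f_n\uparrow f$ a.e. implies $\rho(f_n)\uparrow\rho(f)$), satisfies $\rho(\chi_E)<\infty$ and $\int_E f\,dx\le C_E\rho(f)$ for every measurable $E$ with $|E|<\infty$. $X(\mathbb{R})$ is the set of measurable $f$ with $\|f\|_{X(\mathbb{R})}:=\rho(|f|)<\infty$; the associate space $X'(\mathbb{R})$ is given by $\rho'(g)=\sup\{\int fg: f\ge0,\ \rho(f)\le1\}$. $M$ is the Hardy-Littlewood maximal operator $(Mf)(x)=\sup_{Q\ni x}\frac1{|Q|}\int_Q|f|$ over bounded intervals $Q\ni x$. A function $\psi\in L^2(\mathbb{R})$ is an orthonormal wavelet if $\psi_{j,k}(x)=2^{j/2}\psi(2^jx-k)$, $j,k\in\mathbb{Z}$, form an orthonormal basis of $L^2(\mathbb{R})$. $W:[0,\infty)\to(0,\infty)$ is a radial decreasing $L^1$-majorant of $g$ if $|g(x)|\le W(|x|)$ a.e., $W\in L^1([0,\infty))$, $W$ decreasing, $W(0)<\infty$. $\langle f,g\rangle=\int_\mathbb{R} f\overline g\,dx$, well defined for $f\in X(\mathbb{R})$, $g\in X'(\mathbb{R})$. *)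

(* Defs.v *)
From HB Require Import structures.
From mathcomp Require Import all_boot all_order all_algebra.
From mathcomp Require Import all_classical all_reals all_analysis measurable_realfun.
From mathcomp.real_closed Require Import complex.
Import Order.TTheory GRing.Theory Num.Theory.

Set Implicit Arguments.
Unset Strict Implicit.
Unset Printing Implicit Defensive.

Local Open Scope classical_set_scope.
Local Open Scope ring_scope.
Local Open Scope ereal_scope.
Local Open Scope complex_scope.
Local Open Scope ereal_scope.

Section Defs.
Variable R : realType.
Local Notation mu := (@lebesgue_measure R).
Local Notation C := (complex R).

Definition cabs (z : C) : R := Num.sqrt (complex.Re z ^+ 2 + complex.Im z ^+ 2)%R.

Definition nnmeas (f : R -> \bar R) : Prop :=
  measurable_fun [set: R] f /\ (forall x, 0 <= f x).

Definition cmeasurable (f : R -> C) : Prop :=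
  measurable_fun [set: R] (fun x => complex.Re (f x)) /\
  measurable_fun [set: R] (fun x => complex.Im (f x)).

Definition cabsf (f : R -> C) : R -> \bar R := fun x => (cabs (f x))%:E.

Record banach_function_norm (rho : (R -> \bar R) -> \bar R) : Prop := {
  bfn_ge0 : forall f, nnmeas f -> 0 <= rho f ;
  bfn_eq0 : forall f, nnmeas f -> (rho f = 0 <-> {ae mu, forall x, f x = 0}) ;
  bfn_homog : forall f (a : R), nnmeas f -> (0 <= a)%R ->
      rho (fun x => a%:E * f x) = a%:E * rho f ;
  bfn_subadd : forall f g, nnmeas f -> nnmeas g ->
      rho (fun x => f x + g x) <= rho f + rho g ;
  bfn_lattice : forall f g, nnmeas f -> nnmeas g ->
      {ae mu, forall x, g x <= f x} -> rho g <= rho f ;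
  bfn_fatou : forall (fs : nat -> R -> \bar R) f,
      (forall n, nnmeas (fs n)) -> nnmeas f ->
      {ae mu, forall x, nondecreasing_seq (fun n => fs n x) /\
                        fs n x @[n --> \oo] --> f x} ->
      nondecreasing_seq (fun n => rho (fs n)) /\ rho (fs n) @[n --> \oo] --> rho f ;
  bfn_indic : forall E : set R, measurable E -> mu E < +oo ->
      rho (fun x => (\1_E x)%:E) < +oo ;
  bfn_local : forall E : set R, measurable E -> mu E < +oo ->
      exists CE : R, forall f, nnmeas f ->
        \int[mu]_(x in E) f x <= CE%:E * rho f
}.

Definition inX (rho : (R -> \bar R) -> \bar R) (f : R -> C) : Prop :=
  cmeasurable f /\ rho (cabsf f) < +oo.

Definition assoc (rho : (R -> \bar R) -> \bar R) : (R -> \bar R) -> \bar R :=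
  fun g => ereal_sup [set \int[mu]_x (h x * g x) | h in [set h | nnmeas h /\ rho h <= 1]].

Definition separable_X (rho : (R -> \bar R) -> \bar R) : Prop :=
  exists D : set (R -> C), countable D /\ D `<=` inX rho /\
    forall f, inX rho f -> forall eps : R, (0 < eps)%R ->
      exists2 g, D g & rho (cabsf (fun x => (f x - g x)%R)) < eps%:E.

Definition maximal (f : R -> C) : R -> \bar R := fun x =>
  ereal_sup [set r | exists a b : R, [/\ (a < b)%R, (a <= x <= b)%R &
       r = ((b - a)^-1)%:E * \int[mu]_(y in `[a, b]) cabsf f y]].

Definition bounded_on (rho : (R -> \bar R) -> \bar R)
    (T : (R -> C) -> R -> \bar R) : Prop :=
  exists K : R, (0 < K)%R /\ forall f, inX rho f ->
    measurable_fun [set: R] (T f) /\ rho (T f) <= K%:E * rho (cabsf f).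

Definition inL2 (f : R -> C) : Prop :=
  cmeasurable f /\ \int[mu]_x ((cabs (f x)) ^+ 2)%:E < +oo.

Definition inner (f g : R -> C) : C :=
  (Rintegral mu [set: R] (fun x => complex.Re (f x * conjc (g x))%R))
  %R +i* (Rintegral mu [set: R] (fun x => complex.Im (f x * conjc (g x))%R)).

Definition wav (psi : R -> C) (j k : int) : R -> C := fun x =>
  (((Num.sqrt 2 ^ j)%:C) * psi (2 ^ j * x - k%:~R))%R.

Definition orthonormal_wavelet (psi : R -> C) : Prop :=
  inL2 psi /\
  (forall j k j' k' : int,
      inner (wav psi j k) (wav psi j' k') = if (j == j') && (k == k') then 1%R else 0%R) /\
  (forall f, inL2 f -> forall eps : R, (0 < eps)%R ->
     exists s : seq (int * int * C),
       \int[mu]_x ((cabs (f x - \sum_(t <- s) t.2 * wav psi t.1.1 t.1.2 x)%R) ^+ 2)%:E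
         < eps%:E).

Definition cdifferentiable (psi : R -> C) : Prop :=
  forall x : R, derivable (fun y => complex.Re (psi y)) x 1 /\
                derivable (fun y => complex.Im (psi y)) x 1.

Definition cderiv (psi : R -> C) : R -> C := fun x =>
  (derive1 (fun y => complex.Re (psi y)) x) %R +i* (derive1 (fun y => complex.Im (psi y)) x).

Definition radial_majorant (W : R -> R) (g : R -> C) : Prop :=
  [/\ forall s, (0 <= s)%R -> (0 < W s)%R,
      mu.-integrable [set s | (0 <= s)%R] (fun s => (W s)%:E),
      forall s t, (0 <= s)%R -> (s <= t)%R -> (W t <= W s)%R &
      {ae mu, forall x, (cabs (g x) <= W `|x|)%R}].

Definition Vop (psi : R -> C) (f : R -> C) : R -> \bar R := fun x =>
  sqrte (esum [set: int * int] (fun jk =>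
     ((cabs (inner f (wav psi jk.1 jk.2) * wav psi jk.1 jk.2 x)%R) ^+ 2)%:E)).

End Defs.

(* Main.v *)
Require Import Defs.
From HB Require Import structures.
From mathcomp Require Import all_boot all_order all_algebra.
From mathcomp Require Import all_classical all_reals all_analysis measurable_realfun.
From mathcomp.real_closed Require Import complex.
From mathcomp Require Import ring lra.
Import Order.TTheory GRing.Theory Num.Theory.
Import numFieldNormedType.Exports.
Local Open Scope classical_set_scope.
Local Open Scope ring_scope.

(** For a finite set of indices the square function is continuous, is dominated
    by the Bessel inequality on L^2, and has an l^1-valued standard kernel: the
    sums over [k] are controlled by W(s) = O((1+s)^-2), and the sum over the
    scales [j] by the integral of s W(s).  A Calderon-Zygmund decomposition then
    gives a weak (1,1) bound, hence on every interval [Q] the function [Vf]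
    differs from the constant c_Q by at most A inf_Q Mf outside a subset of
    measure |Q|/8.  A stopping time argument on the scales of [Q] turns this
    into the bilinear estimate
      int (Vf) g <= C int (Mf)(Mg) <= C' |f|_X |g|_X'.
    Since [M] is bounded on [X], averaging over a grid is too, so that a
    norming functional on step functions (finite dimensional Hahn-Banach)
    is a step function of bounded norm in [X'], which gives the norm of [Vf] by
    duality.  The Fatou property removes the restriction to finitely many
    indices. *)

(** * Norming step functions *)

(** A Calderon-Zygmund decomposition and a stopping time usually descend to points by Lebesgue
    differentiation. Here a finite index set makes the kernels and the square function Lipschitz,
    with constants that may be arbitrarily large, and both constructions stop at a finite scale [h]
    chosen after these constants. The resulting estimates depend only on the kernel constant [wkap],
    which does not see the index set, so nothing is lost when the set grows to all indices. The
    Lipschitz bound also lets duality be tested on step functions: a functional on finitely many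
    cells is automatically given by a function, and the bound of [M] on X places this function in
    X'. Everything is real-valued in between. The coefficients use the real and imaginary parts of
    both f and psi, whereas the second factor of each term enters only through its modulus; hence
    the two families [phi] and [theta], and the boolean in the indices. *)

Section sublinear.
Set Implicit Arguments.
Unset Strict Implicit.
Context {R : realType} {V : lmodType R}.

Definition sublinear (p : V -> R) :=
  (forall x y, p (x + y) <= p x + p y) /\
  (forall (a : R) x, 0 <= a -> p (a *: x) = a * p x).

Lemma sublinear0 p : sublinear p -> p 0 = 0.
Proof. by move=> [_ h]; rewrite -(scale0r 0) h // mul0r. Qed.

Lemma sublinear_addN p : sublinear p -> forall x, 0 <= p x + p (- x).
Proof. by move=> hp x; rewrite -(sublinear0 hp) -(subrr x); exact: hp.1. Qed.

(** One Hahn-Banach step performed from above: [q x] is the infimum over t >= 0 of p (x + t e) - t p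
    e. Subadditivity keeps these numbers above - p (- x), so the infimum is finite, and t = 1 at - e
    gives the value - p e, which makes [q] odd along [e]. *)
Lemma sublinear_flatten p e : sublinear p ->
  exists q, [/\ sublinear q, (forall x, q x <= p x) & q (- e) = - p e].
Proof.
move=> hp; have [hD hZ] := hp.
pose S x := [set y | exists2 t : R, 0 <= t & y = p (x + t *: e) - t * p e].
have lbS x : lbound (S x) (- p (- x)).
  move=> _ [t t0 ->].
  have := hD (x + t *: e) (- x); rewrite [X in p X]addrAC subrr add0r hZ //; lra.
have S0 x : S x !=set0 by exists (p (x + 0 *: e) - 0 * p e); exists 0.
have hlb x : has_lbound (S x) by exists (- p (- x)).
have iS x t : 0 <= t -> inf (S x) <= p (x + t *: e) - t * p e.
  by move=> t0; apply: ge_inf; [exact: hlb|exists t].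
have qD x y : inf (S (x + y)) <= inf (S x) + inf (S y).
  rewrite -lerBlDr; apply: lb_le_inf; first exact: S0.
  move=> _ [t t0 ->]; rewrite lerBlDl -lerBlDr; apply: lb_le_inf; first exact: S0.
  move=> _ [s s0 ->]; rewrite lerBlDr.
  apply: (le_trans (iS _ (s + t) _)); first exact: addr_ge0.
  have := hD (y + s *: e) (x + t *: e).
  rewrite addrACA [y + x]addrC -scalerDl mulrDl; lra.
have qN : inf (S (- e)) <= - p e.
  by have := iS (- e) 1 ler01; rewrite scale1r addNr sublinear0// mul1r sub0r.
have qle x : inf (S x) <= p x.
  by have := iS x 0 (lexx 0); rewrite scale0r addr0 mul0r subr0.
have qZ a x : 0 <= a -> inf (S (a *: x)) = a * inf (S x).
  rewrite le_eqVlt => /predU1P[<-|a0].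
    rewrite scale0r mul0r; apply/eqP; rewrite eq_le; apply/andP; split.
      by rewrite -(sublinear0 hp).
    apply: lb_le_inf; first exact: S0.
    by have := lbS 0; rewrite oppr0 sublinear0// oppr0.
  have key b y : 0 < b -> inf (S (b *: y)) <= b * inf (S y).
    move=> b0; rewrite mulrC -ler_pdivrMr//; apply: lb_le_inf; first exact: S0.
    move=> _ [t t0 ->]; rewrite ler_pdivrMr//.
    apply: (le_trans (iS _ (b * t) _)); first by rewrite mulr_ge0// ltW.
    rewrite -scalerA -scalerDr hZ; last exact: ltW. rewrite le_eqVlt; apply/orP; left; apply/eqP; ring.
  apply/eqP; rewrite eq_le key//=.
  have := key a^-1 (a *: x); rewrite invr_gt0 => /(_ a0).
  by rewrite scalerA mulVf ?gt_eqF// scale1r ler_pdivlMl.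
exists (fun x => inf (S x)); split => //.
apply/eqP; rewrite eq_le qN /=; apply: lb_le_inf; first exact: S0.
by have := lbS (- e); rewrite opprK.
Qed.

(** Oddness survives any further lowering: q x >= - q (- x) >= - p (- x) = p x leaves no room. *)
Lemma sublinear_odd_le p q x : sublinear q -> (forall y, q y <= p y) ->
  p (- x) = - p x -> q x = p x /\ q (- x) = - q x.
Proof.
move=> hq qp px; have := sublinear_addN hq x.
by have := qp x; have := qp (- x); rewrite px => *; split; lra.
Qed.

Lemma sublinear_flatten_seq p (s : seq V) : sublinear p ->
  exists q, [/\ sublinear q, (forall x, q x <= p x) &
    (forall x, x \in s -> q (- x) = - q x)].
Proof.
elim: s p => [|x s IH] p hp; first by exists p.
have [q [hq qp qe]] := sublinear_flatten x hp.
have [r [hr rq rs]] := IH _ hq.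
exists r; split => // [y|y]; first exact: le_trans (rq y) (qp y).
rewrite inE => /orP[/eqP->|/rs//].
apply: (sublinear_odd_le hr rq _).2.
have := sublinear_addN hq x; have := qp x; rewrite qe => *; lra.
Qed.

(** Flattening along [v] first pins the value [p v], and flattening along [s] afterwards cannot move
    it. Oddness on [s] is what makes [q] linear on the span of [s]. *)
Lemma finite_hahn_banach p v (s : seq V) : sublinear p ->
  exists q, [/\ sublinear q, (forall x, q x <= p x), q v = p v &
    (forall x, x \in s -> q (- x) = - q x)].
Proof.
move=> hp; have [r [hr rp re]] := sublinear_flatten v hp.
have rv : r v = p v.
  have := sublinear_addN hr v; have := rp v; rewrite re => *; lra.
have [q [hq qr qs]] := sublinear_flatten_seq s hr.
exists q; split => // [x|]; first exact: le_trans (qr x) (rp x).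
by rewrite -rv; apply: (sublinear_odd_le hq qr _).1; rewrite re rv.
Qed.
End sublinear.

Section function_norm.
Set Implicit Arguments.
Unset Strict Implicit.
Context {R : realType} {rho : (R -> \bar R) -> \bar R}.
Hypothesis Hrho : banach_function_norm rho.
Local Notation mu := (@lebesgue_measure R).

Lemma nnmeas_EFin (u : R -> R) : measurable_fun setT u -> (forall x, 0 <= u x) ->
  nnmeas (fun x => (u x)%:E).
Proof. by move=> mu0 u0; split; [exact/measurable_EFinP|move=> x; rewrite lee_fin]. Qed.

Lemma rho_le f g : nnmeas f -> nnmeas g -> (forall x, f x <= g x)%E -> (rho f <= rho g)%E.
Proof. by move=> mf mg fg; apply: (bfn_lattice Hrho) => //; exact: aeW. Qed.

Lemma measurable_step N (A : 'I_N -> set R) (x : 'I_N -> R) : (forall k, measurable (A k)) ->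
  measurable_fun setT (fun t => \sum_k x k * \1_(A k) t).
Proof.
move=> mA; apply: measurable_sum => k; apply: measurable_funM => //.
Qed.

Lemma nnmeas_step N (A : 'I_N -> set R) (x : 'I_N -> R) : (forall k, measurable (A k)) ->
  (forall k, 0 <= x k) -> nnmeas (fun t => (\sum_k x k * \1_(A k) t)%:E).
Proof.
move=> mA x0; apply: nnmeas_EFin; first exact: measurable_step.
by move=> t; apply: sumr_ge0 => k _; rewrite mulr_ge0.
Qed.

Lemma rho0 : rho (fun=> 0%E) = 0%E.
Proof. by apply/(bfn_eq0 Hrho) => //; exact: aeW. Qed.

Lemma rho_step_lty N (A : 'I_N -> set R) (x : 'I_N -> R) : (forall k, measurable (A k)) ->
  (forall k, mu (A k) < +oo)%E -> (forall k, 0 <= x k) ->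
  (rho (fun t => (\sum_k x k * \1_(A k) t)%:E) < +oo)%E.
Proof.
move=> mA fA x0.
elim: N => [|N IH] in A x mA fA x0 *.
  by under eq_fun do rewrite big_ord0; rewrite rho0.
pose A' k := A (lift ord0 k); pose x' k := x (lift ord0 k).
rewrite (_ : (fun t => _) = (fun t => ((x ord0)%:E * (\1_(A ord0) t)%:E +
     (\sum_k x' k * \1_(A' k) t)%:E)%E)); last first.
  by apply/funext => t; rewrite big_ord_recl EFinD EFinM.
have m1 : nnmeas (fun t => (\1_(A ord0) t)%:E : \bar R).
  by apply: nnmeas_EFin => //; exact: measurable_indic.
apply: le_lt_trans (bfn_subadd Hrho _ _) _.
- split; first exact: measurable_funeM m1.1.
  by move=> t; apply: mule_ge0; rewrite lee_fin.
- by apply: nnmeas_step => k; [exact: mA|exact: x0].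
rewrite (bfn_homog Hrho)//; apply: lte_add_pinfty.
  rewrite lte_mul_pinfty//; first by rewrite lee_fin.
  exact: (bfn_indic Hrho).
by apply: IH => k; [exact: mA|exact: fA|exact: x0].
Qed.

(** [rho] of the step function with coefficients [|x k|] is sublinear in the row vector [x]; a
    linear functional below it that touches it at [v] is given by one weight per set. Since this
    sublinear functional ignores signs, the weights may be replaced by their absolute values. *)
Lemma norming_weights N (A : 'I_N -> set R) (v : 'I_N -> R) :
  (forall k, measurable (A k)) -> (forall k, mu (A k) < +oo)%E -> (forall k, 0 <= v k) ->
  exists w : 'I_N -> R, [/\ (forall k, 0 <= w k),
    (forall x : 'I_N -> R, (forall k, 0 <= x k) ->
      ((\sum_k w k * x k)%:E <= rho (fun t => (\sum_k x k * \1_(A k) t)%:E))%E) &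
    (rho (fun t => (\sum_k v k * \1_(A k) t)%:E) <= (\sum_k w k * v k)%:E)%E].
Proof.
move=> mA fA v0.
pose r (x : 'rV[R]_N) := rho (fun t => (\sum_k `|x 0 k| * \1_(A k) t)%:E).
have nnr (x : 'rV[R]_N) : nnmeas (fun t => (\sum_k `|x 0 k| * \1_(A k) t)%:E).
  exact: nnmeas_step.
have rf x : r x \is a fin_num.
  by rewrite ge0_fin_numE; [apply: rho_step_lty|apply: (bfn_ge0 Hrho)].
have hp : sublinear (fun x => fine (r x)).
  split=> [x y|a x a0].
    rewrite -fineD// fine_le//; first by rewrite fin_numD !rf.
    apply: le_trans (bfn_subadd Hrho _ _) => //.
    apply: rho_le => //; first by split=> [|t]; [apply: emeasurable_funD; apply (nnr _).1| apply: adde_ge0; apply (nnr _).2].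
    move=> t; rewrite -EFinD lee_fin -big_split/=; apply: ler_sum => k _.
    by rewrite mxE -mulrDl ler_wpM2r// ler_normD.
  rewrite -[a in RHS]/(fine a%:E) -fineM//; congr fine.
  rewrite /r -(bfn_homog Hrho)//; congr rho; apply/funext => t.
  rewrite -EFinM mulr_sumr; congr EFin; apply: eq_bigr => k _.
  by rewrite mxE normrM ger0_norm// mulrA.
pose vv : 'rV[R]_N := \row_k v k.
have [q [hq qp qv qe]] := finite_hahn_banach vv [seq delta_mx 0 k | k <- enum 'I_N] hp.
pose w k := q (delta_mx 0 k : 'rV_N).
have qN k : q (- (delta_mx 0 k : 'rV_N)) = - w k.
  by apply: qe; apply/mapP; exists k => //; rewrite mem_enum.
have qZ (a : R) k : q (a *: (delta_mx 0 k : 'rV_N)) = a * w k.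
  have [a0|a0] := leP 0 a; first exact: hq.2.
  by rewrite -(opprK a) scaleNr -scalerN hq.2 ?qN ?mulrN ?mulNr// oppr_ge0 ltW.
have qle (x : 'rV[R]_N) : q x <= \sum_k x 0 k * w k.
  rewrite {1}(row_sum_delta x).
  under [X in _ <= X]eq_bigr do rewrite -qZ.
  elim/big_ind2: _ => //; first by rewrite sublinear0.
  by move=> a b c d ab cd; apply: le_trans (hq.1 _ _) _; exact: lerD.
(* The upper bound [qle] at x and at - x, together with q x + q (- x) >= 0, forces equality. *)
have qE (x : 'rV[R]_N) : q x = \sum_k x 0 k * w k.
  apply/eqP; rewrite eq_le qle/=.
  have : q (- x) <= - \sum_k x 0 k * w k.
    rewrite -sumrN; apply: le_trans (qle _) _.
    by apply: ler_sum => k _; rewrite mxE mulNr.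
  have := sublinear_addN hq x => *; lra.
exists (fun k => `|w k|); split => //.
(* The signs turn the value of [q] at [y] into the sum of the [|w k| * x k], while
   [|y k| <= x k]. *)
- move=> x x0; pose y : 'rV[R]_N := \row_k (Num.sg (w k) * x k).
  apply: (@le_trans _ _ (r y)).
    rewrite -(fineK (rf y)) lee_fin; apply: le_trans (qp y); rewrite qE.
    by apply: ler_sum => k _; rewrite mxE normrEsg mulrAC.
  apply: rho_le => //; first exact: nnmeas_step.
  move=> t; rewrite lee_fin; apply: ler_sum => k _.
  rewrite mxE normrM normr_sg ler_wpM2r// (ger0_norm (x0 k)).
  by rewrite ler_piMl//; case: (w k != 0).
- rewrite (_ : rho _ = r vv); last first.
    congr rho; apply/funext => t; congr EFin; apply: eq_bigr => k _.
    by rewrite mxE ger0_norm.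
  rewrite -(fineK (rf vv)) -qv qE lee_fin; apply: ler_sum => k _.
  by rewrite mxE mulrC ler_wpM2r// ler_norm.
Qed.

End function_norm.

(** * Averages over a grid and the associate norm of step functions *)

Section lorentz_luxemburg.
Set Implicit Arguments.
Unset Strict Implicit.
Context {R : realType} {rho : (R -> \bar R) -> \bar R}.
Hypothesis Hrho : banach_function_norm rho.
Local Notation mu := (@lebesgue_measure R).

Lemma cabs_real (x : R) : cabs (x%:C)%C = `|x|.
Proof. by rewrite /cabs /= expr0n addr0 sqrtr_sqr. Qed.

Lemma cabs_ge0 (z : complex R) : 0 <= cabs z.
Proof. exact: sqrtr_ge0. Qed.

Lemma measurable_sqrt : measurable_fun setT (@Num.sqrt R).
Proof. by apply: continuous_measurable_fun; exact: sqrt_continuous. Qed.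

Lemma measurable_cabs (f : R -> complex R) : cmeasurable f ->
  measurable_fun setT (fun x => cabs (f x)).
Proof.
move=> [mr mi]; apply: (measurableT_comp measurable_sqrt).
by apply: measurable_funD; exact: measurable_funX.
Qed.

Lemma nnmeas_cabsf (f : R -> complex R) : cmeasurable f -> nnmeas (cabsf f).
Proof.
by move=> mf; apply: nnmeas_EFin; [exact: measurable_cabs|move=> x; exact: cabs_ge0].
Qed.

Lemma average_le_maximal (f : R -> complex R) (a b x : R) : a < b -> a <= x <= b ->
  (((b - a)^-1)%:E * \int[mu]_(y in `[a, b]) cabsf f y <= maximal f x)%E.
Proof. by move=> ab axb; apply: ereal_sup_ubound; exists a, b. Qed.

Lemma maximal_ge0 (f : R -> complex R) x : (0 <= maximal f x)%E.
Proof.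
have xx1 : x < x + 1 by rewrite ltrDl.
have xxx : x <= x <= x + 1 by rewrite lexx lerDl ler01.
apply: le_trans (average_le_maximal f xx1 xxx); apply: mule_ge0; first by rewrite lee_fin invr_ge0 addrAC subrr add0r.
by apply: integral_ge0 => y _; rewrite lee_fin cabs_ge0.
Qed.

Lemma rho_lty_integrable h E : nnmeas h -> (rho h < +oo)%E -> measurable E ->
  (mu E < +oo)%E -> mu.-integrable E h.
Proof.
move=> hh rh mE fE; have [C hC] := bfn_local Hrho mE fE.
apply/integrableP; split; first exact: measurable_funTS hh.1.
under eq_integral do rewrite gee0_abs ?hh.2//.
apply: le_lt_trans (hC _ hh) _.
have : (rho h \is a fin_num)%E by rewrite ge0_fin_numE ?(bfn_ge0 Hrho).
by move=> /fineK <-; rewrite -EFinM ltry.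
Qed.

(** [maximal] acts on complex functions, whereas the test functions of [assoc] take values in
    [0, +oo]. The value +oo becomes the default 0 of [fine]; for [h] of finite norm this happens
    only on a null set. *)
Definition cfine (h : R -> \bar R) : R -> complex R := fun x => ((fine (h x))%:C)%C.

Lemma cmeasurable_cfine h : nnmeas h -> cmeasurable (cfine h).
Proof.
by move=> hh; split => /=; [apply: (measurableT_comp _ hh.1)|exact: measurable_cst].
Qed.

Lemma cabsf_cfine_le h x : nnmeas h -> (cabsf (cfine h) x <= h x)%E.
Proof.
move=> hh; rewrite /cabsf /cfine cabs_real; have := hh.2 x.
by case: (h x) => [r| |]//= r0; rewrite ?leey// lee_fin ger0_norm.
Qed.

Lemma inX_cfine h : nnmeas h -> (rho h < +oo)%E -> inX rho (cfine h).
Proof.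
move=> hh rh; have ch := cmeasurable_cfine hh; split => //.
apply: le_lt_trans rh; apply: (rho_le Hrho) => //; first exact: nnmeas_cabsf.
by move=> x; exact: cabsf_cfine_le.
Qed.

Lemma integral_cfine h E : nnmeas h -> (rho h < +oo)%E -> measurable E ->
  (mu E < +oo)%E -> (\int[mu]_(x in E) cabsf (cfine h) x = \int[mu]_(x in E) h x)%E.
Proof.
move=> hh rh mE fE; apply: ge0_ae_eq_integral => //.
- by apply: measurable_funTS; apply: (nnmeas_cabsf _).1; exact: cmeasurable_cfine.
- exact: measurable_funTS hh.1.
- by move=> x _; rewrite lee_fin cabs_ge0.
- by move=> x _; exact: hh.2.
have := integrable_ae mE (rho_lty_integrable hh rh mE fE).
apply: filterS => x hx Ex; have := hx Ex; have := hh.2 x; rewrite /cabsf /cfine cabs_real.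
by case: (h x) => //= r r0 _; rewrite ger0_norm.
Qed.


Definition cell (a h : R) (k : nat) : set R := `[a + k%:R * h, a + k.+1%:R * h[%classic.

Lemma measurable_cell a h k : measurable (cell a h k).
Proof. exact: measurable_itv. Qed.

Lemma cell_width (a h : R) k : a + k.+1%:R * h - (a + k%:R * h) = h.
Proof. rewrite -natr1; ring. Qed.

Lemma cell_lt (a h : R) k : 0 < h -> a + k%:R * h < a + k.+1%:R * h.
Proof. by move=> h0; rewrite -subr_gt0 cell_width. Qed.

Lemma mu_cell a h k : 0 < h -> mu (cell a h k) = h%:E.
Proof.
move=> h0; rewrite /cell lebesgue_measure_itv/= lte_fin cell_lt//.
by rewrite -EFinD cell_width.
Qed.

Lemma cell_inj a h j k t : 0 < h -> cell a h j t -> cell a h k t -> j = k.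
Proof.
move=> h0; wlog jk : j k / (j <= k)%N => [W hj hk|].
  by have [/W|/ltnW/W] := leqP j k; [exact|move=> e; apply/esym/e].
rewrite /cell /= !in_itv /= => /andP[_ tj] /andP[kt _].
apply/eqP; rewrite eqn_leq jk/= -ltnS -(ltr_nat R) -(ltr_pM2r h0).
by rewrite -(ltrD2l a); exact: le_lt_trans tj.
Qed.

Lemma step_sum_le N (A : 'I_N -> set R) (x : 'I_N -> R) t (M : \bar R) :
  (forall j k, A j t -> A k t -> j = k) -> (0 <= M)%E ->
  (forall k, A k t -> ((x k)%:E <= M)%E) ->
  ((\sum_k x k * \1_(A k) t)%:E <= M)%E.
Proof.
move=> tA M0 xM; have [[k Ak]|nA] := pselect (exists k, A k t).
  rewrite (bigD1 k)//= big1 ?addr0 => [|j jk].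
    by rewrite indicE mem_set// mulr1 xM.
  rewrite indicE memNset ?mulr0// => Aj.
  by move: jk; rewrite (tA _ _ Aj Ak) eqxx.
rewrite big1// => k _; rewrite indicE memNset ?mulr0// => Ak.
by apply: nA; exists k.
Qed.

Lemma integral_cell_average_le_maximal h0 a h k t : 0 < h -> nnmeas h0 ->
  (rho h0 < +oo)%E -> cell a h k t ->
  ((h^-1)%:E * \int[mu]_(y in cell a h k) h0 y <= maximal (cfine h0) t)%E.
Proof.
move=> hp hh rh kt; have lt := cell_lt a k hp.
have kt' : a + k%:R * h <= t <= a + k.+1%:R * h.
  by move: kt; rewrite /cell /= in_itv /= => /andP[-> /ltW ->].
rewrite -integral_cfine//; last 2 first.
- exact: measurable_cell.
- by rewrite mu_cell// ltry.
apply: le_trans (average_le_maximal _ lt kt'); rewrite cell_width.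
apply: lee_wpmul2l; first by rewrite lee_fin invr_ge0 ltW.
apply: ge0_subset_integral => //.
- exact: measurable_cell.
- by apply: measurable_funTS; apply: (nnmeas_cabsf _).1; exact: cmeasurable_cfine.
- by move=> y _; rewrite lee_fin cabs_ge0.
- by apply: subset_itvl; rewrite bnd_simp.
Qed.

(** Against a test function [h0] of norm at most 1, the step function integrates to the sum of the
    [w k * x k], where [x k] is the average of [h0] over the k-th cell. By the property of the
    weights this is at most the norm of the averaged function, which lies below the maximal function
    of [h0]. *)
Lemma assoc_step_le K N a h (w : 'I_N -> R) : 0 < K -> 0 < h ->
  (forall f, inX rho f -> measurable_fun [set: R] (maximal f) /\
     (rho (maximal f) <= K%:E * rho (cabsf f))%E) ->
  (forall k, 0 <= w k) ->
  (forall x : 'I_N -> R, (forall k, 0 <= x k) ->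
      ((\sum_k w k * x k)%:E <= rho (fun t => (\sum_k x k * \1_(cell a h k) t)%:E))%E) ->
  (assoc rho (fun t => (\sum_(k < N) (w k / h) * \1_(cell a h k) t)%:E) <= K%:E)%E.
Proof.
move=> K0 hp HM w0 wx; apply: ge_ereal_sup => _ [h0 [hh rh1] <-].
have rh : (rho h0 < +oo)%E by rewrite (le_lt_trans rh1)// ltry.
have fk (k : 'I_N) : (\int[mu]_(y in cell a h k) h0 y \is a fin_num)%E.
  apply: integrable_fin_num; first exact: measurable_cell.
  by apply: rho_lty_integrable => //; [exact: measurable_cell|rewrite mu_cell// ltry].
pose x (k : 'I_N) := h^-1 * fine (\int[mu]_(y in cell a h k) h0 y).
have x0 k : 0 <= x k.
  apply: mulr_ge0; first by rewrite invr_ge0 ltW.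
  by apply/fine_ge0/integral_ge0 => y _; exact: hh.2.
rewrite (_ : (\int[mu]_x _)%E = (\sum_k w k * x k)%:E); last first.
  under eq_integral => t _.
    rewrite -sumEFin ge0_sume_distrr; last first.
      by move=> k _; rewrite lee_fin mulr_ge0// divr_ge0// ltW.
    over.
  rewrite ge0_integral_sum//; last 2 first.
  - move=> k; apply: emeasurable_funM; first exact: hh.1.
    by apply/measurable_EFinP; apply: measurable_funM => //; apply: measurable_indic; exact: measurable_cell.
  - by move=> k t _; rewrite mule_ge0 ?hh.2// lee_fin mulr_ge0// divr_ge0// ltW.
  rewrite -sumEFin; apply: eq_bigr => k _.
  under eq_integral do rewrite EFinM muleCA.
  rewrite ge0_integralZl//; last 3 first.
  - apply: emeasurable_funM; first exact: hh.1.
    by apply/measurable_EFinP; apply: measurable_indic; exact: measurable_cell.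
  - by move=> t _; rewrite mule_ge0 ?hh.2.
  - by rewrite lee_fin divr_ge0// ltW.
  by rewrite [in RHS]/x mulrA [in RHS]EFinM fineK// [in RHS]integral_mkcond epatch_indic.
apply: le_trans (wx x x0) _.
apply: (@le_trans _ _ (rho (maximal (cfine h0)))).
  apply: (rho_le Hrho).
  - by apply: nnmeas_step => // k; exact: measurable_cell.
  - by split; [apply: (HM _ _).1; exact: inX_cfine|move=> y; exact: maximal_ge0].
  - move=> t; apply: step_sum_le => [j k jt kt||k kt].
    + by apply: val_inj; exact: (cell_inj hp jt kt).
    + exact: maximal_ge0.
    + rewrite /x EFinM fineK//; exact: integral_cell_average_le_maximal.
apply: le_trans (HM _ (inX_cfine hh rh)).2 _.
rewrite -[leRHS]mule1; apply: lee_wpmul2l; first by rewrite lee_fin ltW.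
apply: le_trans rh1; apply: (rho_le Hrho) => //.
  exact/nnmeas_cabsf/cmeasurable_cfine.
by move=> y; exact: cabsf_cfine_le.
Qed.

End lorentz_luxemburg.

(** * Norms of Lipschitz functions by duality *)

Section lorentz_luxemburg.
Set Implicit Arguments.
Unset Strict Implicit.
Context {R : realType} {rho : (R -> \bar R) -> \bar R}.
Hypothesis Hrho : banach_function_norm rho.
Local Notation mu := (@lebesgue_measure R).

Lemma mem_cell (h : R) (N : nat) a t : 0 < h -> a <= t < a + N%:R * h ->
  exists k : 'I_N, cell a h k t.
Proof.
move=> h0; elim: N => [|N IH]; first by rewrite mul0r addr0 => /andP[/le_lt_trans/[apply]]; rewrite ltxx.
move=> /andP[aT tN]; have [tl|tg] := ltP t (a + N%:R * h).
  have [|k ck] := IH; first by rewrite aT tl.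
  by exists (widen_ord (leqnSn N) k).
by exists ord_max; rewrite /cell /= in_itv/= tg.
Qed.

Lemma lipschitz_measurable (F : R -> R) L : (forall x y, `|F x - F y| <= L * `|x - y|) ->
  measurable_fun setT F.
Proof.
move=> FL; apply: continuous_measurable_fun => x.
apply/cvgrPdist_le => /= e e0.
have L0 : 0 < `|L| + 1 by rewrite ltr_wpDl.
exists (e / (`|L| + 1)); first exact: divr_gt0.
move=> y /= xy; apply: le_trans (FL _ _) _.
apply: (@le_trans _ _ ((`|L| + 1) * `|x - y|)).
  by rewrite ler_wpM2r// (le_trans (ler_norm _))// lerDl.
by rewrite mulrC -ler_pdivlMr// ltW.
Qed.

(** This takes the place of the identity X'' = X. On [-r, r) a step function lies below [F] within 2
    L h; the weights that norm it give a [g] of associate norm at most [K], so the norm of the step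
    function is at most the integral of [F g]. The error tends to 0 with the mesh, and the Fatou
    property lets r grow. *)
Lemma rho_lipschitz_le_of_dual K (F : R -> R) L B : 0 < K ->
  (forall f, inX rho f -> measurable_fun [set: R] (maximal f) /\
     (rho (maximal f) <= K%:E * rho (cabsf f))%E) ->
  0 <= L -> (forall x, 0 <= F x) -> (forall x y, `|F x - F y| <= L * `|x - y|) ->
  (forall g : R -> R, measurable_fun setT g -> (forall x, 0 <= g x) ->
     (assoc rho (fun t => (g t)%:E) <= K%:E)%E -> (\int[mu]_x (F x * g x)%:E <= B%:E)%E) ->
  (rho (fun t => (F t)%:E) <= B%:E)%E.
Proof.
move=> K0 HM L0 F0 FL FB.
have mF := lipschitz_measurable FL.
pose J (r : nat) : set R := `[- r%:R, r%:R[%classic.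
have mJ r : measurable (J r) by exact: measurable_itv.
have fJ r : (mu (J r) < +oo)%E.
  by rewrite /J lebesgue_measure_itv/=; case: ifP => _; rewrite ?ltry// -EFinD ltry.
have nnJ r : nnmeas (fun t => (\1_(J r) t)%:E : \bar R) by apply: nnmeas_EFin.
have nnFJ r : nnmeas (fun t => (F t * \1_(J r) t)%:E).
  by apply: nnmeas_EFin => [|x]; [exact: measurable_funM|rewrite mulr_ge0].
have step (r m : nat) : (rho (fun t => (F t * \1_(J r) t)%:E) <=
   B%:E + (2 * L / m.+1%:R)%:E * rho (fun t => (\1_(J r) t)%:E))%E.
  pose h : R := m.+1%:R^-1; pose N := (2 * r * m.+1)%N; pose a : R := - r%:R.
  have h0 : 0 < h by rewrite invr_gt0.
  have aN : a + N%:R * h = r%:R.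
    by rewrite /a /N /h !natrM mulfK// mulr_natl mulr2n addrA addNr add0r.
  (* Subtracting [L * h] from the value at the left endpoint puts [v k] below [F] on the whole cell;
     the maximum with 0 keeps it nonnegative and, as [F >= 0], still below [F]. *)
  pose v (k : 'I_N) := Num.max (F (a + k%:R * h) - L * h) 0.
  have v0 k : 0 <= v k by rewrite le_max lexx orbT.
  have cellF (k : 'I_N) t : cell a h k t -> v k <= F t <= v k + 2 * L * h.
    move=> ct; have : `|F (a + k%:R * h) - F t| <= L * h.
      apply: le_trans (FL _ _) _; rewrite ler_wpM2l//.
      move: ct; rewrite /cell/= in_itv/= -natr1 mulrDl mul1r => /andP[t1 t2].
      rewrite ler_norml; apply/andP; split; lra.
    rewrite ler_norml => /andP[F1 F2]; have Ft := F0 t; have : 0 <= L * h by rewrite mulr_ge0// ltW.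
    by rewrite /v; case: (leP (F (a + k%:R * h) - L * h) 0) => *; apply/andP; split; lra.
  have [||w [w0 wx wv]] := @norming_weights _ _ Hrho N (cell a h) v _ _ v0.
  - by move=> k; exact: measurable_cell.
  - by move=> k; rewrite mu_cell// ltry.
  have ag := assoc_step_le Hrho K0 h0 HM w0 wx.
  have wh k : 0 <= w k / h by rewrite divr_ge0// ltW.
  have wv0 k : 0 <= w k / h * v k by rewrite mulr_ge0.
  have mg : measurable_fun setT (fun t => \sum_(k < N) (w k / h) * \1_(cell a h k) t).
    by apply: measurable_step => k; exact: measurable_cell.
  have g0 t : 0 <= \sum_(k < N) (w k / h) * \1_(cell a h k) t.
    by apply: sumr_ge0 => k _; rewrite mulr_ge0.
  have FB' := FB _ mg g0 ag.
  have rv : (rho (fun t => (\sum_k v k * \1_(cell a h k) t)%:E) <= B%:E)%E.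
    apply: le_trans wv _; apply: le_trans FB'.
    rewrite (_ : (_)%:E = (\int[mu]_x (\sum_(k < N) (w k / h * v k) * \1_(cell a h k) x)%:E)%E).
      apply: ge0_le_integral => //.
      - by move=> t _; rewrite lee_fin; apply: sumr_ge0 => k _; exact: mulr_ge0 (wv0 k) _.
      - by apply/measurable_EFinP; apply: measurable_step => k; exact: measurable_cell.
      - by apply/measurable_EFinP; exact: measurable_funM.
      - move=> t _; rewrite lee_fin mulr_sumr; apply: ler_sum => k _.
        rewrite -mulrA [leRHS]mulrCA ler_wpM2l//.
        have [ct|ct] := pselect (cell a h k t); last by rewrite indicE memNset// !mulr0.
        by rewrite ler_wpM2r//; have /andP[] := cellF _ _ ct.
    under [RHS]eq_integral do rewrite -sumEFin.
    rewrite ge0_integral_sum//; last 2 first.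
    - move=> k; apply/measurable_EFinP; apply: measurable_funM => //.
      by apply: measurable_indic; exact: measurable_cell.
    - by move=> k t _; rewrite lee_fin; exact: mulr_ge0 (wv0 k) _.
    rewrite -sumEFin; apply: eq_bigr => k _.
    under eq_integral do rewrite EFinM.
    rewrite ge0_integralZl//; last 2 first.
    - by apply/measurable_EFinP; apply: measurable_indic; exact: measurable_cell.
    - by rewrite lee_fin.
    rewrite integral_indic//; last exact: measurable_cell.
    have E := mu_cell a k h0; rewrite setIT; transitivity ((w k / h * v k)%:E * h%:E)%E.
      by rewrite -EFinM mulrAC divfK// gt_eqF.
    by congr (_ * _)%E; exact: esym E.
  have nns : nnmeas (fun t => (\sum_k v k * \1_(cell a h k) t)%:E).
    by apply: nnmeas_step => // k; exact: measurable_cell.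
  have nnL : nnmeas (fun t => (2 * L / m.+1%:R)%:E * (\1_(J r) t)%:E)%E.
    split; first exact: measurable_funeM (nnJ r).1.
    by move=> t; rewrite mule_ge0// lee_fin// mulr_ge0// ?mulr_ge0.
  apply: (@le_trans _ _ (rho (fun t => (\sum_k v k * \1_(cell a h k) t)%:E +
     (2 * L / m.+1%:R)%:E * (\1_(J r) t)%:E)%E)).
    apply: (rho_le Hrho) => //.
      split; first by apply: emeasurable_funD; [exact: nns.1|exact: nnL.1].
      by move=> t; rewrite adde_ge0 ?nns.2 ?nnL.2.
    move=> t; rewrite -EFinM -EFinD lee_fin.
    have [Jt|Jt] := pselect (J r t); last first.
      by rewrite indicE memNset// !mulr0 addr0 sumr_ge0// => k _; rewrite mulr_ge0.
    have [|k ct] := @mem_cell h N a t h0.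
      by move: Jt; rewrite aN /J/= in_itv.
    have /andP[_ Ft] := cellF _ _ ct.
    rewrite [\1_(J r) t]indicE mem_set// !mulr1; apply: le_trans Ft _.
    rewrite lerD2r (bigD1 k)//= indicE mem_set// mulr1 lerDl.
    by apply: sumr_ge0 => j _; rewrite mulr_ge0.
  apply: le_trans (bfn_subadd Hrho nns nnL) _; apply: leeD => //.
  by rewrite (bfn_homog Hrho)// mulr_ge0// mulr_ge0.
have bound r : (rho (fun t => (F t * \1_(J r) t)%:E) <= B%:E)%E.
  apply/lee_addgt0Pr => e e0.
  have rf : (rho (fun t => (\1_(J r) t)%:E) \is a fin_num)%E.
    by rewrite ge0_fin_numE; [exact: (bfn_indic Hrho)|exact: (bfn_ge0 Hrho)].
  pose c := fine (rho (fun t => (\1_(J r) t)%:E)).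
  have c0 : 0 <= c by apply/fine_ge0/(bfn_ge0 Hrho).
  pose m := Num.truncn (2 * L * c / e).
  apply: le_trans (step r m) _; rewrite leeD2l// -(fineK rf) -EFinM lee_fin -/c.
  have : 2 * L * c / e < m.+1%:R by exact: truncnS_gt.
  rewrite ltr_pdivrMr// => hm.
  by rewrite mulrAC ler_pdivrMr// mulrC [e * _]mulrC; apply: le_trans (ltW hm); rewrite mulrC.
have [] := bfn_fatou Hrho nnFJ (nnmeas_EFin mF F0) _.
  apply: aeW => x; split.
    apply/nondecreasing_seqP => n; rewrite lee_fin ler_wpM2l//.
    rewrite !indicE; have [nx|nx] := pselect (J n x); last by rewrite memNset.
    rewrite !mem_set//; move: nx; rewrite /J/= !in_itv/= -natr1 => /andP[? ?]; apply/andP; split; lra.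
  apply: cvg_near_cst.
  exists (Num.truncn `|x|).+1 => // n /= xn; rewrite indicE mem_set ?mulr1//.
  have : `|x| < n%:R by apply: lt_le_trans (truncnS_gt _) _; rewrite ler_nat.
  by rewrite ltr_norml /J/= in_itv/= => /andP[/ltW-> ->].
move=> _ cv; rewrite -(cvg_lim _ cv)//; apply: lime_le; first by apply/cvg_ex; eexists; exact: cv.
by apply: nearW => n; exact: bound.
Qed.

End lorentz_luxemburg.

(** * A mean value inequality for everywhere differentiable functions *)

Section mean_value.
Set Implicit Arguments.
Unset Strict Implicit.
Context {R : realType}.
Local Notation mu := (@lebesgue_measure R).

Lemma integral_indicT (A : set R) : measurable A -> (\int[mu]_x (\1_A x)%:E = mu A)%E.
Proof. by move=> mA; rewrite integral_indic// setIT. Qed.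

Lemma derivable_right_slope (f : R -> R) c e : derivable f c 1 -> 0 < e ->
  exists2 d, 0 < d & forall y, c < y < c + d -> f y - f c <= (derive1 f c + e) * (y - c).
Proof.
move=> df e0; have : h^-1 *: (f (h + c) - f c) @[h --> 0^'] --> derive1 f c.
  rewrite /derive1; suff <- : (fun h : R => h^-1 *: ((f \o shift c) (h *: 1) - f c)) =
          (fun h => h^-1 *: (f (h + c) - f c)) by [].
  by apply/funext => h /=; rewrite /shift /= [_ *: 1]mulr1.
move=> /cvgrPdist_le/(_ e e0)[d /= d0 hd]; exists d => //; move=> y /andP[cy yd].
have y0 : 0 < y - c by rewrite subr_gt0.
have := hd (y - c); rewrite /= sub0r normrN (ger0_norm (ltW y0)) => H.
rewrite subrK in H.
have {H} : `|derive1 f c - (y - c)^-1 *: (f y - f c)| <= e.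
  by apply: H; [rewrite ltrBlDl|rewrite gt_eqF].
rewrite ler_norml => /andP[H _].
rewrite -ler_pdivrMr//; move: H; rewrite /GRing.scale/= [_^-1 * _]mulrC => H; lra.
Qed.

(* Every point of [N] lies in all the [U n], so the primitive of the sum of
   their indicators has infinite slope there while its total variation is [e]. *)
Lemma steep_primitive (N : set R) (e : R) : mu.-negligible N -> 0 < e ->
  exists2 phi : R -> \bar R,
    [/\ measurable_fun setT phi, (forall x, 0 <= phi x)%E & (\int[mu]_x phi x <= e%:E)%E] &
    forall x (p : nat), N x ->
      exists2 d, 0 < d & forall y, `|x - y| < d -> (p%:R%:E <= phi y)%E.
Proof.
move=> [M [mM M0' NM]] e0; have M0 : mu M = 0%E := M0'.
have en n : 0 < e / (2 ^ n.+1)%:R by rewrite divr_gt0// ltr0n expn_gt0.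
have /choice[U HU] n : exists U : set R, [/\ open U, M `<=` U & (mu U <= (e / (2 ^ n.+1)%:R)%:E)%E].
  have [|U [oU MU Ue]] := @lebesgue_regularity_outer R M _ mM _ (en n).
    by apply: (@le_lt_trans _ _ 0%E); [rewrite le_eqVlt; apply/orP; left; apply/eqP; exact: M0|exact: ltry].
  exists U; split => //.
  have mU : measurable U by exact: open_measurable.
  rewrite -(setDUK MU) measureU//; last 2 first.
  - exact: measurableD.
  - by rewrite setDIK.
  by rewrite [X in (X + _)%E](_ : _ = 0%E)// add0e ltW.
have mU n : measurable (U n) by apply: open_measurable; case: (HU n).
have mI n : measurable_fun setT (fun x => (\1_(U n) x)%:E : \bar R).
  by apply/measurable_EFinP; exact: measurable_indic.
exists (fun x => \sum_(n <oo) (\1_(U n) x)%:E)%E.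
  split.
  - by apply: ge0_emeasurable_sum => // n x _ _; rewrite lee_fin.
  - by move=> x; apply: nneseries_ge0 => n _ _; rewrite lee_fin.
  - rewrite integral_nneseries//.
    apply: (@le_trans _ _ (\sum_(n <oo) (e / (2 ^ n.+1)%:R)%:E)%E).
      apply: lee_nneseries => [n _ _|n _]; first by apply: integral_ge0.
      by rewrite integral_indicT//; have [] := HU n.
    exact: epsilon_trick0 (ltW e0).
move=> x p Nx.
have Ux n : U n x by have [_ MU _] := HU n; apply/MU/NM.
have [d d0 Hd] : exists2 d, 0 < d & forall i y, (i < p)%N -> `|x - y| < d -> U i y.
  elim: p => [|p [d d0 IH]]; first by exists 1.
  have [oU _ _] := HU p; have := oU x (Ux p); move=> /nbhs_ballP[d' /= d'0 hd'].
  exists (Num.min d d'); first by rewrite lt_min d0.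
  move=> i y; rewrite lt_min ltnS leq_eqVlt => /orP[/eqP->|ip] /andP[xd xd'].
    exact: hd'.
  exact: IH.
exists d => // y xy; rewrite (nneseries_split 0 p); last by move=> k _; rewrite lee_fin.
rewrite add0n -[leLHS]adde0; apply: leeD; last by apply: nneseries_ge0 => n _ _; rewrite lee_fin.
rewrite big_nat (eq_bigr (fun=> 1%E)) => [|i /andP[_ ip]]; last first.
  by rewrite indicE mem_set//; exact: Hd xy.
rewrite -big_nat; elim: (p) => [|q IH]; first by rewrite big_nil.
by rewrite big_nat_recr//= -natr1 EFinD leeD2r.
Qed.

(** Propagation from [a]: the set of points where f x - f a <= (K + e) (x - a) + G x contains its
    supremum by continuity, and this supremum cannot lie before [b]. Outside the null set the slope
    just to the right is at most K + e. At an exceptional point the derivative may be large but is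
    finite, and there the primitive [G] of [phi] is steeper still. The existence of a derivative at
    every point is what rules out growth of Cantor type. *)
Lemma le_diff_of_ae_derive (f : R -> R) a b K : a <= b -> 0 <= K ->
  (forall x, derivable f x 1) ->
  {ae mu, forall x, a <= x <= b -> derive1 f x <= K} ->
  f b - f a <= K * (b - a).
Proof.
move=> ab K0 df [M [mM M0 NM]].
apply/ler_addgt0Pr => e1 e10.
pose e := e1 / (b - a + 1).
have ba1 : 0 < b - a + 1 by rewrite ltr_wpDl// subr_ge0.
have e0 : 0 < e by rewrite divr_gt0.
have [phi [mphi phi0 iphi] Hphi] := @steep_primitive M e (ex_intro _ M (And3 mM M0 (@subset_refl _ M))) e0.
pose G x := fine (\int[mu]_(t in `[a, x]) phi t).
have mphiD D : measurable_fun D phi by exact: measurable_funTS.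
have fG x : (\int[mu]_(t in `[a, x]) phi t \is a fin_num)%E.
  rewrite ge0_fin_numE; last exact: integral_ge0.
  apply: le_lt_trans (ltry e); apply: le_trans iphi.
  by apply: ge0_subset_integral.
have Gincr x y : a <= x -> x <= y -> ((G y - G x)%:E = \int[mu]_(t in `]x, y]) phi t)%E.
  move=> ax xy; rewrite EFinB !fineK//.
  have -> : `[a, y]%classic = `[a, x]%classic `|` `]x, y]%classic.
    by rewrite -itv_bndbnd_setU// bnd_simp.
  rewrite ge0_integral_setU//.
    by rewrite addeAC subee ?add0e.
  - exact: mphiD.
  apply/disj_setPS => z [] /=; rewrite !in_itv /= => /andP[_ zx] /andP[xz _].
  by move: xz; rewrite ltNge zx.
have Gle x y : a <= x -> x <= y -> G x <= G y.
  by move=> ax xy; rewrite -subr_ge0 -lee_fin Gincr// integral_ge0.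
have Ga : 0 <= G a by apply/fine_ge0/integral_ge0.
have Gb : G b <= e.
  rewrite -lee_fin fineK//; apply: le_trans iphi.
  by apply: ge0_subset_integral.
pose S := [set x | a <= x <= b /\ f x - f a <= (K + e) * (x - a) + G x].
have Sa : S a by split; [rewrite lexx ab|rewrite !subrr mulr0 add0r].
have hsS : has_sup S by split; [exists a|exists b => x [/andP[]]].
have Sle x : S x -> x <= sup S by move=> Sx; apply: ub_le_sup => //; exact: hsS.2.
have ac : a <= sup S by exact: Sle.
have cb : sup S <= b by apply: ge_sup; [exists a|move=> x [/andP[]]].
set c := sup S in ac cb *.
have fc : {for c, continuous f}.
  by apply/differentiable_continuous/derivable1_diffP; exact: df.
have Sc : S c.
  split; first by rewrite ac cb.
  apply/ler_addgt0Pr => r r0.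
  have r20 : 0 < r / 2 by rewrite divr_gt0.
  move/cvgrPdist_le : fc => /(_ _ r20)[d /= d0 hd].
  have [x Sx cx] := sup_adherent d0 hsS.
  have xc := Sle _ Sx.
  have := hd x; rewrite /= ger0_norm ?subr_ge0// => /(_ _)/wrap[].
    by rewrite ltrBlDl addrC -ltrBlDl.
  rewrite ler_norml => /andP[_ fx].
  case: Sx => /andP[ax xb] Sx.
  have : (K + e) * (x - a) <= (K + e) * (c - a).
    by rewrite ler_wpM2l ?lerD2r// addr_ge0// ltW.
  have := Gle _ _ ax xc; lra.
have cEb : c = b.
  apply/eqP; rewrite eq_le cb/= leNgt; apply/negP => cltb.
  suff [y /andP[cy yb] fy] : exists2 y, c < y <= b & f y - f c <= (K + e) * (y - c) + (G y - G c).
    have : y <= c; last by rewrite leNgt cy.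
    apply: Sle; split; first by rewrite yb (le_trans ac)// ltW.
    by case: Sc => _; lra.
  have [d d0 hd] := derivable_right_slope (df c) e0.
  have [Mc|Mc] := pselect (M c); last first.
    exists (Num.min b (c + d / 2)); first by rewrite lt_min cltb ltrDl divr_gt0//= ge_min lexx.
    set y := Num.min _ _.
    have cy : c < y by rewrite lt_min cltb ltrDl divr_gt0.
    have yd : y < c + d by rewrite gt_min ltrD2l ltr_pdivrMr// ltr_pMr// ltr1n orbT.
    have := hd y; rewrite cy yd => /(_ isT) H.
    have : derive1 f c <= K.
      by apply: contrapT => H'; apply/Mc/NM => /=; move=> /(_ _)/H'; apply; rewrite ac cb.
    have : 0 <= y - c by rewrite subr_ge0 ltW.
    have := Gle _ _ ac (ltW cy).
    move=> ? ? ?; apply: le_trans H _.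
    rewrite -[leLHS]addr0; apply: lerD; last by rewrite subr_ge0.
    by rewrite ler_wpM2r// lerD2r.
  (* [c] is exceptional: near it [phi >= p], so [G] alone grows faster than [f]. *)
  pose p := (Num.truncn (derive1 f c + e)).+1.
  have fp : derive1 f c + e <= p%:R by apply/ltW/truncnS_gt.
  have [d' d'0 hd'] := Hphi c p Mc.
  pose y := Num.min b (c + Num.min (d / 2) (d' / 2)).
  have cy : c < y by rewrite lt_min cltb ltrDl lt_min !divr_gt0.
  have yd : y < c + d.
    rewrite gt_min; apply/orP; right; rewrite ltrD2l gt_min ltr_pdivrMr// ltr_pMr// ltr1n //.
  have yd' : y < c + d'.
    rewrite gt_min; apply/orP; right; rewrite ltrD2l gt_min orbC ltr_pdivrMr// ltr_pMr// ltr1n //.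
  exists y; first by rewrite cy ge_min lexx.
  have := hd y; rewrite cy yd => /(_ isT) H.
  have yc0 : 0 <= y - c by rewrite subr_ge0 ltW.
  have GG : p%:R * (y - c) <= G y - G c.
    rewrite -lee_fin Gincr//; last exact: ltW.
    apply: (@le_trans _ _ (\int[mu]_(t in `]c, y]) (cst p%:R%:E) t)%E).
      by rewrite integral_cst//= lebesgue_measure_itv/= lte_fin cy -EFinD -EFinM.
    apply: ge0_le_integral => //; [by move=> t _; rewrite lee_fin|exact: mphiD|].
    move=> t /=; rewrite in_itv/= => /andP[ct ty].
    by apply: hd'; rewrite distrC ger0_norm ?subr_ge0 ?ltW// ltrBlDl (le_lt_trans ty).
  have : (derive1 f c + e) * (y - c) <= p%:R * (y - c) by rewrite ler_wpM2r.
  have : 0 <= (K + e) * (y - c) by rewrite mulr_ge0// addr_ge0// ltW.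
  lra.
have [_] := Sc; rewrite cEb.
have : e * (b - a) + e = e1 by rewrite /e -[X in _ + X]mulr1 -mulrDr divfK// gt_eqF.
by rewrite mulrDl; lra.
Qed.

End mean_value.

(** * Sums of translates and dilates of the majorant *)

Section majorant.
Set Implicit Arguments.
Unset Strict Implicit.
Context {R : realType}.
Local Notation mu := (@lebesgue_measure R).
Variable W : R -> R.
Hypothesis W0 : forall s, 0 <= s -> 0 < W s.
Hypothesis Wdec : forall s t, 0 <= s -> s <= t -> W t <= W s.

(** [P t] is the integral of s W(s) over [0, t]. On [t/2, t] the integrand is at least (t/2) W(t),
    which gives the factor 4. In this form the moment condition telescopes along dyadic scales. *)
Lemma majorant_potential :
  mu.-integrable [set s | 0 <= s] (fun s => (W s)%:E) ->
  (\int[mu]_(s in [set s : R | (0 <= s)%R]) (s * W s)%:E < +oo)%E ->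
  exists (P : R -> R) (I : R), (forall t, 0 <= P t <= I) /\
    forall t, 0 < t -> t ^+ 2 * W t <= 4 * (P t - P (t / 2)).
Proof.
move=> iW fW.
have DE : [set s : R | 0 <= s] = `[0, +oo[%classic.
  by apply/seteqP; split => x /=; rewrite in_itv/= andbT.
rewrite DE in iW fW.
pose f (s : R) : \bar R := (s * W s)%:E.
have mf : measurable_fun `[(0:R), +oo[ f.
  apply/measurable_EFinP; apply: measurable_funM => //.
  by have /measurable_EFinP := measurable_int mu iW.
have f0 (s : R) : (0 <= s)%R -> (0 <= f s)%E by move=> s0; rewrite lee_fin mulr_ge0// ltW// W0.
have sub (a b : R) b0 b1 : 0 <= a -> [set` Interval (BSide b0 a) (BSide b1 b)] `<=` `[0, +oo[.
  move=> a0 x /=; rewrite !in_itv /= andbT => /andP[ax _].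
  by apply: le_trans a0 _; move: ax; case: b0 => //= /ltW.
have mfS (a b : R) b0 b1 : 0 <= a -> measurable_fun [set` Interval (BSide b0 a) (BSide b1 b)] f.
  by move=> a0; apply: measurable_funS mf => //; exact: sub.
have f0S (a b : R) b0 b1 x : 0 <= a -> [set` Interval (BSide b0 a) (BSide b1 b)] x -> (0 <= f x)%E.
  by move=> a0 /(sub _ _ _ _ a0); rewrite /= in_itv/= andbT => /f0.
have lei (a b : R) b0 b1 : 0 <= a -> (\int[mu]_(s in [set` Interval (BSide b0 a) (BSide b1 b)]) f s
   <= \int[mu]_(s in `[0%R, +oo[) f s)%E.
  move=> a0; apply: ge0_subset_integral => //; last exact: sub.
  by move=> x /=; rewrite in_itv/= andbT => /f0.
have fin (a b : R) b0 b1 : 0 <= a ->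
   (\int[mu]_(s in [set` Interval (BSide b0 a) (BSide b1 b)]) f s \is a fin_num)%E.
  move=> a0; rewrite ge0_fin_numE; last by apply: integral_ge0 => x /f0S; exact.
  exact: le_lt_trans (lei _ _ _ _ a0) _.
pose P t := fine (\int[mu]_(s in `[0, t]) f s).
exists P, (fine (\int[mu]_(s in `[0%R, +oo[) f s)); split => [t|t t0].
  rewrite fine_ge0/=; last by apply: integral_ge0 => x /f0S; exact.
  apply: fine_le; [exact: fin| |exact: lei].
  by rewrite ge0_fin_numE//; apply: integral_ge0 => x /=; rewrite in_itv/= andbT => /f0.
have t20 : 0 < t / 2 by rewrite divr_gt0.
have t2t : t / 2 < t by rewrite ltr_pdivrMr// ltr_pMr// ltr1n.
have PE : ((P t - P (t / 2))%:E = \int[mu]_(s in `](t / 2)%R, t]) f s)%E.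
  rewrite EFinB !fineK ?fin//.
  have -> : `[0, t]%classic = `[0, t / 2]%classic `|` `]t / 2, t]%classic.
    by rewrite -itv_bndbnd_setU// bnd_simp ltW.
  rewrite ge0_integral_setU//.
  - by rewrite addeAC subee ?add0e// fin.
  - by apply: measurable_funS mf => // x [] /sub; apply; rewrite ?lexx// ltW.
  - by move=> x [] /f0S; apply; rewrite ?lexx// ltW.
  - apply/disj_setPS => z [] /=; rewrite !in_itv /= => /andP[_ zx] /andP[xz _].
    by move: xz; rewrite ltNge zx.
have : ((t / 2 * W t * (t / 2))%:E <= (P t - P (t / 2))%:E)%E.
  rewrite PE; apply: (@le_trans _ _ (\int[mu]_(s in `](t / 2)%R, t]) (cst (t / 2 * W t)%:E) s)%E).
    rewrite integral_cst//= lebesgue_measure_itv/= lte_fin t2t -EFinD -EFinM lee_fin.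
    by rewrite le_eqVlt; apply/orP; left; apply/eqP; field.
  apply: ge0_le_integral => //.
  - by move=> s _; rewrite lee_fin mulr_ge0// ltW// W0// ltW.
  - by apply: mfS; exact: ltW.
  - move=> s /=; rewrite in_itv/= => /andP[ts st]; rewrite lee_fin.
    apply: ler_pM; [exact: ltW|by apply/ltW/W0/ltW|exact: ltW|].
    by apply: Wdec => //; apply: ltW; exact: lt_trans ts.
rewrite lee_fin expr2; lra.
Qed.

(** For s <= 1 use W(s) <= W(0) and (1 + s)^2 <= 4; for s > 1 use (1 + s)^2 <= 4 s^2 and s^2 W(s) <=
    4 I. *)
Lemma quadratic_decay (P : R -> R) I : (forall t, 0 <= P t <= I) ->
  (forall t, 0 < t -> t ^+ 2 * W t <= 4 * (P t - P (t / 2))) ->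
  forall s, 0 <= s -> W s <= (16 * I + 4 * W 0) / (1 + s) ^+ 2.
Proof.
move=> PI PW s s0.
have W00 := W0 (lexx 0); have Ws := Wdec (lexx 0) s0; have Ws0 := W0 s0.
have s10 : 0 < 1 + s by rewrite ltr_wpDr.
rewrite ler_pdivlMr ?exprn_gt0//.
have /andP[P0 I0] := PI s.
have [s1|s1] := leP s 1.
  have : W s * (1 + s) ^+ 2 <= W s * 4 by rewrite ler_wpM2l ?(ltW (W0 s0))//; nra.
  lra.
have s00 : 0 < s by lra.
have := PW s s00; have /andP[P0' _] := PI (s / 2) => H.
have : W s * (1 + s) ^+ 2 <= 4 * (s ^+ 2 * W s).
  rewrite mulrA [_ * W s]mulrC ler_wpM2l ?(ltW (W0 s0))//; nra.
lra.
Qed.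

End majorant.

Section sums.
Set Implicit Arguments.
Unset Strict Implicit.
Context {R : realType}.

(** The function t / (1 + |t|) is bounded by 1 with derivative (1 + |t|)^-2, so its unit increments
    serve as a telescoping majorant; the factor 2 pays for replacing a derivative by an
    increment. *)
Lemma inv_sq_le_telescope (t : R) :
  (1 + `|t|) ^- 2 <= 2 * ((t + 1) / (1 + `|t + 1|) - t / (1 + `|t|)).
Proof.
have [t0|t0] := leP 0 t.
  rewrite !ger0_norm//; last lra.
  have d1 : 0 < 1 + t by lra.
  have d2 : 0 < 1 + (t + 1) by lra.
  rewrite (_ : 2 * _ = 2 / ((1 + t) * (1 + (t + 1)))); last by field; apply/andP; split; lra.
  rewrite -[leLHS]mul1r ler_pdivlMr ?mulr_gt0// mulrAC ler_pdivrMr ?exprn_gt0//; nra.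
have [t1|t1] := leP (- 1) t.
  rewrite (ltr0_norm t0) ger0_norm; last lra.
  have d1 : 0 < 1 - t by lra.
  have d2 : 0 < 1 + (t + 1) by lra.
  rewrite (_ : 2 * _ = 2 * ((t + 1) * (1 - t) - t * (1 + (t + 1))) / ((1 - t) * (1 + (t + 1)))); last by field; apply/andP; split; lra.
  rewrite -[leLHS]mul1r ler_pdivlMr ?mulr_gt0// mulrAC ler_pdivrMr ?exprn_gt0//.
  have A1 : 1 <= (t + 1) * (1 - t) - t * (1 + (t + 1)) by nra.
  apply: (@le_trans _ _ (2 * 1 * (1 - t) ^+ 2)).
    by rewrite expr2 mul1r; nra.
  apply: ler_wpM2r; [by apply/exprn_ge0/ltW|lra].
rewrite (ltr0_norm t0) ltr0_norm; last lra.
have d1 : 0 < 1 - t by lra.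
have d2 : 0 < 1 - (t + 1) by lra.
rewrite (_ : 2 * _ = 2 / ((1 - t) * (1 - (t + 1)))); last by field; apply/andP; split; lra.
rewrite -[leLHS]mul1r ler_pdivlMr ?mulr_gt0// mulrAC ler_pdivrMr ?exprn_gt0//; nra.
Qed.

Lemma sum_inv_sq_le (t : R) N : \sum_(i < N) (1 + `|t + i%:R|) ^- 2 <= 4.
Proof.
have H (u : R) : - 1 <= u / (1 + `|u|) <= 1.
  have d : 0 < 1 + `|u| by rewrite ltr_wpDr.
  rewrite ler_pdivlMr// ler_pdivrMr//; have := ler_norm u; have := ler_norm (- u); rewrite normrN => *.
  by apply/andP; split; lra.
have : \sum_(i < N) (1 + `|t + i%:R|) ^- 2 <=
  2 * ((t + N%:R) / (1 + `|t + N%:R|) - t / (1 + `|t|)).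
  elim: N => [|N IH]; first by rewrite big_ord0 addr0 subrr mulr0.
  rewrite big_ord_recr/=; have := inv_sq_le_telescope (t + N%:R).
  by rewrite -addrA natr1; lra.
by have := H (t + N%:R); have := H t => /andP[? ?] /andP[? ?]; lra.
Qed.

Definition zrange (n : nat) : seq int := [seq (i%:Z - n%:Z) | i <- iota 0 n.*2.+1].

Lemma sum_zrange n (F : int -> R) :
  \sum_(k <- zrange n) F k = \sum_(i < n.*2.+1) F (i%:Z - n%:Z).
Proof. by rewrite /zrange big_map -(big_mkord xpredT (fun i => F (i%:Z - n%:Z))) /index_iota subn0. Qed.

End sums.

(** * The kernel summed over translates and scales *)

Section kernel.
Set Implicit Arguments.
Unset Strict Implicit.
Context {R : realType}.
Variables (W P : R -> R) (I : R).
Hypothesis W0 : forall s, 0 <= s -> 0 < W s.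
Hypothesis Wdec : forall s t, 0 <= s -> s <= t -> W t <= W s.
Hypothesis PI : forall t, 0 <= P t <= I.
Hypothesis PW : forall t, 0 < t -> t ^+ 2 * W t <= 4 * (P t - P (t / 2)).

(** The second clause is a mean value estimate: every point between u and v has modulus at least |u|
    - |u - v|. The factor 2 leaves room for the modulus of a complex function, whose increments are
    bounded by those of both parts. *)
Definition dominated_with_slope (p : R -> R) :=
  (forall u, `|p u| <= W `|u|) /\
  (forall u v, `|p u - p v| <= 2 * `|u - v| * W (Num.max (`|u| - `|u - v|) 0)).

Let B := 16 * I + 4 * W 0.

Let B0 : 0 <= B.
Proof. by have := PI 0; have := W0 (lexx 0); rewrite /B => ? /andP[? ?]; lra. Qed.

Lemma scale_sum_le (s : R) N : 0 < s ->
  \sum_(i < N) (2 ^+ i * s) ^+ 2 * W (2 ^+ i * s) <= 4 * I.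
Proof.
move=> s0.
have : \sum_(i < N) (2 ^+ i * s) ^+ 2 * W (2 ^+ i * s) <=
    4 * (P (2 ^+ N * s / 2) - P (s / 2)).
  elim: N => [|N IH]; first by rewrite big_ord0 expr0 mul1r subrr mulr0.
  rewrite big_ord_recr/=; have := @PW (2 ^+ N * s); rewrite mulr_gt0 ?exprn_gt0// => /(_ isT).
  rewrite [in P (2 ^+ N.+1 * _ / _)]exprS (_ : 2 * _ * s / 2 = 2 ^+ N * s); last by field.
  lra.
by have := PI (2 ^+ N * s / 2); have := PI (s / 2) => /andP[? ?] /andP[? ?]; lra.
Qed.

(** The loss of 1 in the argument of [W] allows [u] to be displaced by at most 1. With t the
    distance to k and m = max(t - 1, 0) one has 1 + m >= (1 + t) / 2, which costs a factor 4; the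
    sum of inverse squares gives the other 4. *)
Lemma translate_sum_le (u : R) n :
  \sum_(k <- zrange n) W (Num.max (`|u - k%:~R| - 1) 0) <= 16 * B.
Proof.
rewrite sum_zrange.
apply: (@le_trans _ _ (\sum_(i < n.*2.+1) 4 * B * (1 + `|(- n%:R - u) + i%:R|) ^- 2)).
  apply: ler_sum => i _.
  rewrite (_ : `|u - _| = `|- n%:R - u + i%:R|); last first.
    by rewrite distrC intrB/= -!pmulrn; congr `|_|; ring.
  set t := `|_|; have t0 : 0 <= t by exact: normr_ge0.
  set m := Num.max _ _; have m0 : 0 <= m by rewrite le_max lexx orbT.
  have mt : t - 1 <= m by rewrite le_max lexx.
  apply: le_trans (quadratic_decay W0 Wdec PI PW m0) _; rewrite -/B.
  rewrite [4 * B]mulrC -mulrA; apply: ler_wpM2l => //.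
  rewrite (_ : 4 * _ = ((1 + t) / 2) ^- 2); last by rewrite expr_div_n invf_div -natrX.
  by rewrite lef_pV2 ?posrE ?exprn_gt0//; [rewrite lerXn2r ?nnegrE//|..]; lra.
rewrite -mulr_sumr; have := sum_inv_sq_le (- n%:R - u) n.*2.+1.
have := B0; nra.
Qed.

Lemma translate_sum_le' (u : R) n : \sum_(k <- zrange n) W `|u - k%:~R| <= 16 * B.
Proof.
apply: le_trans (translate_sum_le u n); apply: ler_sum => k _.
apply: Wdec; first by rewrite le_max lexx orbT.
by rewrite ge_max normr_ge0 andbT lerBlDr lerDl.
Qed.

(** An integer k cannot be close to both u and v. If |v - k| >= r/4 the factor [q] is at most
    W(r/4). Otherwise |u - k| > 3r/4, and since |u - u'| <= r/2 the increment of [p] is at most 2 |u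
    - u'| W(r/4). The remaining factor is summed over k in each case, and each of the two cases
    contributes 32 B. *)
Lemma kernel_scale_le (p q : R -> R) u u' v n :
  dominated_with_slope p -> dominated_with_slope q ->
  u != v -> `|u - u'| <= `|u - v| / 2 ->
  \sum_(k <- zrange n) `|p (u - k%:~R) - p (u' - k%:~R)| * `|q (v - k%:~R)|
   <= 64 * B * `|u - u'| * W (`|u - v| / 4).
Proof.
move=> [p1 p2] [q1 _] uv uu'.
set r := `|u - v|; have r0 : 0 < r by rewrite normr_gt0 subr_eq0.
have W4 : 0 <= W (r / 4) by apply/ltW/W0; lra.
have n0 : 0 <= `|u - u'| by [].
have subk (k : R) (x y : R) : (x - k) - (y - k) = x - y by ring.
apply: (@le_trans _ _ (\sum_(k <- zrange n)
   (W (r / 4) * `|p (u - k%:~R) - p (u' - k%:~R)| +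
    2 * `|u - u'| * W (r / 4) * `|q (v - k%:~R)|))).
  apply: ler_sum => k _.
  have [c|c] := leP (r / 4) `|v - k%:~R|.
    rewrite -[leLHS]addr0 lerD ?mulr_ge0//.
    rewrite mulrC ler_wpM2r//; apply: le_trans (q1 _) _; apply: Wdec => //; lra.
  rewrite -[leLHS]add0r lerD ?mulr_ge0//.
  rewrite ler_wpM2r//; apply: le_trans (p2 _ _) _; rewrite subk ler_wpM2l ?mulr_ge0//.
  apply: Wdec; first lra.
  rewrite le_max; apply/orP; left.
  have : r <= `|u - k%:~R| + `|v - k%:~R|.
    by rewrite /r -(subk k%:~R u v); exact: ler_normB.
  rewrite -/r in uu'; lra.
rewrite big_split/= -!mulr_sumr.
have S2 : \sum_(k <- zrange n) `|q (v - k%:~R)| <= 16 * B.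
  by apply: le_trans (translate_sum_le' v n); apply: ler_sum => k _.
(* Displacements of at most 1 use the slope, larger ones only the size of [p]. *)
have S1 : \sum_(k <- zrange n) `|p (u - k%:~R) - p (u' - k%:~R)| <= 32 * B * `|u - u'|.
  have [c|c] := leP `|u - u'| 1.
    apply: (@le_trans _ _ (2 * `|u - u'| * (16 * B))); last by rewrite le_eqVlt; apply/orP; left; apply/eqP; ring.
    apply: (@le_trans _ _ (2 * `|u - u'| * \sum_(k <- zrange n) W (Num.max (`|u - k%:~R| - 1) 0))).
      rewrite mulr_sumr; apply: ler_sum => k _; apply: le_trans (p2 _ _) _; rewrite subk.
      rewrite ler_wpM2l ?mulr_ge0//; apply: Wdec; first by rewrite le_max lexx orbT.
      by rewrite ge_max !le_max lexx orbT andbT lerD2l lerN2 c.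
    by rewrite ler_wpM2l ?mulr_ge0// translate_sum_le.
  apply: (@le_trans _ _ (16 * B + 16 * B)); last by have := B0; nra.
  apply: le_trans (lerD (translate_sum_le' u n) (translate_sum_le' u' n)).
  rewrite -big_split/=; apply: ler_sum => k _.
  by apply: le_trans (ler_normB _ _) _; exact: lerD.
apply: (@le_trans _ _ (W (r / 4) * (32 * B * `|u - u'|) + 2 * `|u - u'| * W (r / 4) * (16 * B))).
  by apply: lerD; rewrite ler_wpM2l// !mulr_ge0.
by rewrite le_eqVlt; apply/orP; left; apply/eqP; ring.
Qed.

(** At scale j the previous bound equals 1024 B |x - x'| / |x - y|^2 times t^2 W(t) with t = 2^j |x
    - y| / 4, and the sum of t^2 W(t) over all scales is at most 4 I. The weight 2^j is the product
    of the two normalizing factors of a wavelet. *)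
Lemma kernel_le (p q : R -> R) (x x' y : R) n :
  dominated_with_slope p -> dominated_with_slope q ->
  x != y -> `|x - x'| <= `|x - y| / 2 ->
  \sum_(j <- zrange n) \sum_(k <- zrange n)
    2 ^ j * (`|p (2 ^ j * x - k%:~R) - p (2 ^ j * x' - k%:~R)| * `|q (2 ^ j * y - k%:~R)|)
   <= 4096 * B * I * (`|x - x'| / (x - y) ^+ 2).
Proof.
move=> hp hq xy xx'.
have r0 : 0 < `|x - y| by rewrite normr_gt0 subr_eq0.
have e2 j : 0 < (2 : R) ^ (j : int) by rewrite exprz_gt0.
have Nd j a b : `|2 ^ j * a - 2 ^ j * b| = 2 ^ j * `|a - b| :> R.
  by rewrite -mulrBr normrM gtr0_norm.
apply: (@le_trans _ _ (\sum_(j <- zrange n)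
  (1024 * B * (`|x - x'| / `|x - y| ^+ 2)) * ((2 ^ j * (`|x - y| / 4)) ^+ 2 * W (2 ^ j * (`|x - y| / 4))))).
  apply: ler_sum => j _; rewrite -mulr_sumr.
  apply: le_trans (ler_wpM2l (ltW (e2 j)) (kernel_scale_le n hp hq _ _)) _.
  - by rewrite -subr_eq0 -mulrBr mulf_neq0 ?subr_eq0// gt_eqF.
  - by rewrite !Nd -mulrA ler_wpM2l// ltW.
  rewrite !Nd -(mulrA _ `|x - y| 4^-1); set w := W _; set e : R := 2 ^ j.
  by rewrite le_eqVlt; apply/orP; left; apply/eqP; field; rewrite gt_eqF.
rewrite -mulr_sumr [leRHS](_ : _ = 1024 * B * (`|x - x'| / `|x - y| ^+ 2) * (4 * I)); last first.
  by rewrite real_normK ?num_real//; field; rewrite subr_eq0.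
apply: ler_wpM2l.
  exact: mulr_ge0 (mulr_ge0 (ler0n _ _) B0) (divr_ge0 (normr_ge0 _) (exprn_ge0 _ (normr_ge0 _))).
rewrite sum_zrange.
have s0 : 0 < 2 ^ (- n%:Z) * (`|x - y| / 4) by rewrite mulr_gt0// divr_gt0.
apply: le_trans (scale_sum_le n.*2.+1 s0).
apply: ler_sum => i _.
by rewrite expfzDr ?pnatr_eq0// -exprnP -!mulrA.
Qed.

End kernel.

(** * Sparse domination *)

Section sparse.
Set Implicit Arguments.
Unset Strict Implicit.
Context {R : realType}.
Local Notation mu := (@lebesgue_measure R).

Section total_integrals.
Variables (D : set R) (f f' : R -> \bar R).
Hypothesis mD : measurable D.
Hypothesis mf : measurable_fun setT f.
Hypothesis mf' : measurable_fun setT f'.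
Hypothesis f0 : forall z, (0 <= f z)%E.
Hypothesis f'0 : forall z, (0 <= f' z)%E.

Lemma nnintegral_scale k : 0 <= k ->
  (\int[mu]_(z in D) (k%:E * f z) = k%:E * \int[mu]_(z in D) f z)%E.
Proof. by move=> k0; rewrite ge0_integralZl//; exact: measurable_funTS. Qed.

Lemma nnintegral_add :
  (\int[mu]_(z in D) (f z + f' z) = \int[mu]_(z in D) f z + \int[mu]_(z in D) f' z)%E.
Proof. by rewrite ge0_integralD//; exact: measurable_funTS. Qed.

Lemma nnintegral_le : (forall z, D z -> f z <= f' z)%E ->
  (\int[mu]_(z in D) f z <= \int[mu]_(z in D) f' z)%E.
Proof. by move=> ff; apply: ge0_le_integral => //; exact: measurable_funTS. Qed.

Lemma nnintegral_subset E : measurable E -> E `<=` D ->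
  (\int[mu]_(z in E) f z <= \int[mu]_(z in D) f z)%E.
Proof. by move=> mE ED; apply: ge0_subset_integral => //; exact: measurable_funTS. Qed.

Lemma nnintegral_disjU E : measurable E -> [disjoint D & E] ->
  (\int[mu]_(z in D `|` E) f z = \int[mu]_(z in D) f z + \int[mu]_(z in E) f z)%E.
Proof. by move=> mE DE; rewrite ge0_integral_setU//; exact: measurable_funTS. Qed.

End total_integrals.

Definition ival (x l : R) : set R := `[x, x + l[%classic.

Lemma measurable_ival x l : measurable (ival x l).
Proof. exact: measurable_itv. Qed.

Lemma mu_ival x l : 0 < l -> mu (ival x l) = l%:E.
Proof.
by move=> l0; rewrite /ival lebesgue_measure_itv/= lte_fin ltrDl l0 -EFinD addrAC subrr add0r.
Qed.

Lemma ival_half x l : 0 < l -> ival x l = ival x (l / 2) `|` ival (x + l / 2) (l / 2).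
Proof.
have E : x + l / 2 + l / 2 = x + l by field.
by move=> l0; rewrite /ival E -itv_bndbnd_setU // bnd_simp; lra.
Qed.

Lemma ival_half_disj x l : [disjoint ival x (l / 2) & ival (x + l / 2) (l / 2)].
Proof.
apply/disj_setPS => z []; rewrite /ival /= !in_itv /= => /andP[_ zx] /andP[xz _].
by move: xz; rewrite leNgt zx.
Qed.

Lemma ivalS x l x' l' : x <= x' -> x' + l' <= x + l -> ival x' l' `<=` ival x l.
Proof.
move=> xx xl z; rewrite /ival /= !in_itv /= => /andP[h1 h2].
by rewrite (le_trans xx)//= (lt_le_trans h2).
Qed.

Lemma integral_ival_half (f : R -> \bar R) x l : 0 < l -> measurable_fun setT f ->
  (forall z, 0 <= f z)%E ->
  (\int[mu]_(z in ival x l) f z = \int[mu]_(z in ival x (l / 2)) f z +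
     \int[mu]_(z in ival (x + l / 2)%R (l / 2)) f z)%E.
Proof.
move=> l0 mf f0; rewrite (ival_half _ l0) nnintegral_disjU//.
- exact: measurable_ival.
- exact: measurable_ival.
- exact: ival_half_disj.
Qed.

Lemma exists_off_small (Q : set R) (A B : set R) (l : R) : measurable Q -> measurable A -> measurable B ->
  mu Q = l%:E -> (mu (A `&` Q) + mu (B `&` Q) < l%:E)%E -> exists z, [/\ Q z, ~ A z & ~ B z].
Proof.
move=> mQ mA mB muQ; apply: contraPP => nz; apply/negP; rewrite -leNgt -muQ.
have sQ : Q `<=` (A `&` Q) `|` (B `&` Q).
  move=> z Qz; apply: contrapT => nAB; apply: nz; exists z; split => // zz; apply: nAB; [left|right]; by split.
apply: le_trans (measureU2 _ _ _).
- by apply: le_measure => //; rewrite inE; [|apply: measurableU]; try exact: measurableI.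
- exact: measurableI.
- exact: measurableI.
Qed.


Lemma measurable_superlevel (u : R -> R) b : measurable_fun setT u ->
  measurable [set z | b < u z].
Proof.
move=> mu'; have := mu' measurableT _ (measurable_itv `]b, +oo[).
rewrite setTI; congr measurable; apply/seteqP; split => z /=; by rewrite in_itv/= andbT.
Qed.

(** [F] plays the square function, [N] and [G] two maximal functions. On the interval [x, x + l) the
    function [F] stays within [a x l] of the constant [c x l] outside a small set, and at the finest
    scale [h] it oscillates by at most [e]. *)
Variables (F : R -> R) (g N G : R -> \bar R) (a c : R -> R -> R) (A0 B0 h e : R).
Hypothesis h0 : 0 < h.
Hypothesis mF : measurable_fun setT F.
Hypothesis mg : measurable_fun setT g.
Hypothesis mN : measurable_fun setT N.
Hypothesis mG : measurable_fun setT G.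
Hypothesis g0 : forall z, (0 <= g z)%E.
Hypothesis N0 : forall z, (0 <= N z)%E.
Hypothesis G0 : forall z, (0 <= G z)%E.
Hypothesis e0 : 0 <= e.
Hypothesis ea : forall x l, A0 <= x -> x + l <= B0 -> 0 < l -> e <= a x l.
Hypothesis amono : forall x l x' l', x <= x' -> x' + l' <= x + l -> 0 < l' -> a x l <= a x' l'.
Hypothesis aN : forall x l z, 0 < l -> ival x l z -> ((a x l)%:E <= N z)%E.
Hypothesis gG : forall x l z, 0 < l -> ival x l z -> (\int[mu]_(t in ival x l) g t <= l%:E * G z)%E.
Hypothesis Fosc : forall x z z', ival x h z -> ival x h z' -> F z <= F z' + e.
Hypothesis Fbad : forall n x, let l := 2 ^+ n * h in
  (mu (ival x l `&` [set z | a x l < `|F z - c x l|]%R) <= (l / 8)%:E)%E.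

Let pos (b : R) z := (Num.max (F z - b) 0)%:E.

Let pos0 b z : (0 <= pos b z)%E.
Proof. by rewrite lee_fin le_max lexx orbT. Qed.

Let mpos b : measurable_fun setT (pos b).
Proof.
by apply/measurable_EFinP; apply: measurable_maxr => //; exact: measurable_funB.
Qed.

Let mposg b : measurable_fun setT (fun z => pos b z * g z)%E.
Proof. exact: emeasurable_funM. Qed.

Let posg0 b z : (0 <= pos b z * g z)%E.
Proof. by rewrite mule_ge0. Qed.

Let mNG : measurable_fun setT (fun z => N z * G z)%E.
Proof. exact: emeasurable_funM. Qed.

Let NG0 z : (0 <= N z * G z)%E.
Proof. by rewrite mule_ge0. Qed.

(** The term with 2 a is what an ancestor will need: replacing the constant of a selected interval
    by that of the ancestor raises the integrand by at most 2 a g. *)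
Let claim n x := let l := 2 ^+ n * h in
  (\int[mu]_(z in ival x l) (pos (c x l) z * g z) + (2 * a x l)%:E * \int[mu]_(z in ival x l) g z
     <= 8%:E * \int[mu]_(z in ival x l) (N z * G z))%E.

Let Ebig (b : R) : set R := [set z | b < F z].

Let mEbig b : measurable (Ebig b).
Proof. exact: measurable_superlevel. Qed.

Let bad x l : set R := [set z | a x l < `|F z - c x l|].

Let mbad x l : measurable (bad x l).
Proof.
apply: measurable_superlevel; apply: measurableT_comp => //.
exact: measurable_funB.
Qed.

(** Halving goes on while the set [E] where F > c1 + a1 has density at most 1/4. A half of larger
    density is selected and put into [U]; hence U has measure at most 4 times that of [E], and the
    induction hypothesis [claim] applies to it. *)
Lemma sparse_stopping (c1 a1 : R) x1 l1 m :
  A0 <= x1 -> x1 + l1 <= B0 -> 0 < l1 -> a1 = a x1 l1 ->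
  (forall k x, (k < m)%N -> A0 <= x -> x + 2 ^+ k * h <= B0 -> claim k x) ->
  forall n x, (n <= m)%N -> let l := 2 ^+ n * h in x1 <= x -> x + l <= x1 + l1 ->
   (mu (Ebig (c1 + a1) `&` ival x l) <= (l / 4)%:E)%E ->
   exists U, [/\ measurable U, U `<=` ival x l, (mu U <= 4%:E * mu (Ebig (c1 + a1) `&` ival x l))%E &
     (\int[mu]_(z in ival x l) (pos c1 z * g z) <= (2 * a1)%:E * \int[mu]_(z in ival x l) g z +
        8%:E * \int[mu]_(z in U) (N z * G z))%E].
Proof.
move=> Ax1 xB1 l10 a1E IHm; set E := Ebig _.
have mE : measurable E by exact: mEbig.
have ea1 : e <= a1 by rewrite a1E; exact: ea.
have a00 : 0 <= a1 := le_trans e0 ea1.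
have a10 : 0 <= 2 * a1 by lra.
elim=> [|n IHn] x nm l x1x xl El.
  rewrite {}/l expr0 mul1r in xl El *.
  (* At the finest scale some point lies outside [E], and as the oscillation is at most [e <= a1]
     the bound F <= c1 + 2 a1 spreads to the whole interval. *)
  have [|z [Qz Ez _]] := @exists_off_small (ival x h) E set0 h (measurable_ival _ _) mE measurable0 (mu_ival _ h0).
    rewrite set0I measure0 adde0; apply: le_lt_trans El _; rewrite lte_fin.
    by rewrite ltr_pdivrMr// ltr_pMr// ltr1n.
  exists set0; split => //; first by rewrite measure0 mule_ge0.
  rewrite integral_set0 mule0 adde0 -nnintegral_scale//; last exact: measurable_ival.
  apply: nnintegral_le => //; [exact: measurable_ival|exact: measurable_funeM|].
  move=> t Qt; apply: lee_wpmul2r => //; rewrite lee_fin ge_max.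
  have := Fosc Qt Qz; move/negP: Ez; rewrite -leNgt => ? ?.
  by apply/andP; split; lra.
pose l' := 2 ^+ n * h.
have ll' : l / 2 = l' by rewrite /l /l' exprS; field.
have l'0 : 0 < l' by rewrite mulr_gt0// exprn_gt0.
have l0 : 0 < l by lra.
have child y : x <= y -> y + l' <= x + l -> ival y l' `<=` ival x l ->
   exists U, [/\ measurable U, U `<=` ival y l', (mu U <= 4%:E * mu (E `&` ival y l'))%E &
     (\int[mu]_(z in ival y l') (pos c1 z * g z) <= (2 * a1)%:E * \int[mu]_(z in ival y l') g z +
        8%:E * \int[mu]_(z in U) (N z * G z))%E].
  move=> xy yl sub.
  have [st|st] := leP (mu (E `&` ival y l')) (l' / 4)%:E.
    by apply: IHn => //; [exact: ltnW|exact: le_trans xy|exact: le_trans xl].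
  exists (ival y l'); split => //.
  - exact: measurable_ival.
  - rewrite mu_ival// (_ : l'%:E = 4%:E * (l' / 4)%:E)%E; first by apply: lee_wpmul2l => //; exact: ltW.
    by rewrite -EFinM; congr EFin; field.
  have a' : a1 <= a y l' by rewrite a1E; apply: amono => //; lra.
  have a1' : 0 <= a y l' := le_trans a00 a'.
  (* The parent was not selected, so [E] fills at most half of this child, and the bad set at most
     an eighth. A point outside both compares [c y l'] with [c1]. *)
  have [|z [Qz Ez bz]] := @exists_off_small (ival y l') E (bad y l') l' (measurable_ival _ _) mE (mbad _ _) (mu_ival _ l'0).
    apply: (@le_lt_trans _ _ ((l / 4)%:E + (l' / 8)%:E)%E).
      apply: leeD; last by rewrite setIC; exact: Fbad.
      apply: le_trans El; apply: le_measure; rewrite ?inE.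
      - by apply: measurableI => //; exact: measurable_ival.
      - by apply: measurableI => //; exact: measurable_ival.
      - exact: setIS.
    by rewrite -EFinD lte_fin; lra.
  have cc : c y l' - c1 <= 2 * a y l'.
    move/negP : Ez; rewrite -leNgt; move/negP : bz; rewrite -leNgt ler_norml => /andP[? ?] ?; lra.
  apply: (@le_trans _ _ (8%:E * \int[mu]_(z0 in ival y l') (N z0 * G z0))%E); last first.
    by rewrite leeDr//; apply: mule_ge0; rewrite ?lee_fin// integral_ge0.
  have Ay : A0 <= y := le_trans Ax1 (le_trans x1x xy).
  have yB : y + l' <= B0 := le_trans yl (le_trans xl xB1).
  apply: le_trans (IHm n y nm Ay yB).
  have a20 : 0 <= 2 * a y l' by lra.
  have m2 : measurable_fun setT (fun z => (2 * a y l')%:E * g z)%E by exact: measurable_funeM.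
  have p2 z1 : (0 <= (2 * a y l')%:E * g z1)%E by exact: mule_ge0.
  have mI : measurable (ival y l') by exact: measurable_ival.
  rewrite -/l' -nnintegral_scale// -nnintegral_add//.
  apply: nnintegral_le => //; first exact: emeasurable_funD.
  move=> t _; rewrite -ge0_muleDl//.
  apply: lee_wpmul2r => //; rewrite -EFinD lee_fin.
  rewrite ge_max; have := cc; case: (leP (F t - c y l') 0) => *; apply/andP; split; lra.
have [|||U1 [mU1 sU1 muU1 iU1]] := child x.
- exact: lexx.
- lra.
- by apply: ivalS => //; lra.
have [|||U2 [mU2 sU2 muU2 iU2]] := child (x + l').
- lra.
- lra.
- by apply: ivalS => //; lra.
have sub1 : ival x l' `<=` ival x l by apply: ivalS => //; lra.
have sub2 : ival (x + l') l' `<=` ival x l by apply: ivalS => //; lra.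
have dis : [disjoint ival x l' & ival (x + l') l'] by rewrite -ll'; exact: ival_half_disj.
have disU : [disjoint U1 & U2].
  move/disj_setPS : dis => d; apply/disj_setPS => z [/sU1 z1 /sU2 z2]; exact: d (conj z1 z2).
exists (U1 `|` U2); split.
- exact: measurableU.
- by move=> z [/sU1/sub1|/sU2/sub2].
- apply: (@le_trans _ _ (mu U1 + mu U2)%E); first exact: measureU2.
  apply: le_trans (leeD muU1 muU2) _.
  rewrite -ge0_muleDr//; apply: lee_wpmul2l => //.
  rewrite -measureU//.
  + rewrite -setIUr (ival_half x l0) ll' //.
  + by apply: measurableI => //; exact: measurable_ival.
  + by apply: measurableI => //; exact: measurable_ival.
  + apply/seteqP; split => // z [[_ z1] [_ z2]]; move/disj_setPS : dis; apply; split; [exact: z1|exact: z2].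
- rewrite !(@integral_ival_half _ x l)// ll' ge0_muleDr ?integral_ge0//.
  rewrite nnintegral_disjU//.
  rewrite [X in (_ <= _ + X)%E]ge0_muleDr ?integral_ge0// [leRHS]addeACA.
  exact: leeD.
Qed.

(** Stopping costs 2 a times the integral of g, and [claim] asks for as much again. The total 4 a is
    paid by 8 times the integral of N G outside [U], while [U] carries the rest. Because the two
    sets are disjoint, the constant 8 does not grow with the number of scales. *)
Lemma sparse_claim n x : A0 <= x -> x + 2 ^+ n * h <= B0 -> claim n x.
Proof.
elim/ltn_ind: n x => n IH x Ax xB; rewrite /claim; set l := 2 ^+ n * h.
have l0 : 0 < l by rewrite mulr_gt0// exprn_gt0.
have a0 : 0 <= a x l := le_trans e0 (ea Ax xB l0).
set E := Ebig (c x l + a x l).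
have mQ : measurable (ival x l) by exact: measurable_ival.
have mE : measurable (E `&` ival x l) by apply: measurableI => //; exact: mEbig.
have El8 : (mu (E `&` ival x l) <= (l / 8)%:E)%E.
  apply: le_trans (Fbad n x); apply: le_measure; rewrite ?inE//.
    by apply: measurableI => //; exact: mbad.
  move=> z [Ez Qz]; split => //=; rewrite -/l.
  by apply: lt_le_trans (ler_norm _); rewrite ltrBrDl.
have El4 : (mu (E `&` ival x l) <= (l / 4)%:E)%E.
  by apply: le_trans El8 _; rewrite lee_fin; lra.
have [U [mU sU muU iU]] := sparse_stopping Ax xB l0 erefl (fun k y kn => IH k kn y)
  (leqnn n) (lexx x) (lexx (x + l)) El4.
rewrite -/l -/E in sU muU iU.
set Ig := (\int[mu]_(z in ival x l) g z)%E in iU *.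
have Ig0 : (0 <= Ig)%E by exact: integral_ge0.
have mV : measurable (ival x l `\` U) by exact: measurableD.
have muV : ((l / 2)%:E <= mu (ival x l `\` U))%E.
  have muU2 : (mu U <= (l / 2)%:E)%E.
    apply: le_trans muU _; rewrite (_ : l / 2 = 4 * (l / 8)) ?EFinM; last by field.
    exact: lee_wpmul2l.
  rewrite leNgt; apply/negP => lt.
  have : (mu (ival x l) < l%:E)%E; last by rewrite mu_ival// ltxx.
  rewrite -(setDUK sU).
  apply: (@le_lt_trans _ _ (mu U + mu (ival x l `\` U))%E); first exact: measureU2.
  rewrite [ltRHS](_ : _ = (l / 2)%:E + (l / 2)%:E)%E; last by rewrite -EFinD; congr EFin; field.
  apply: lee_ltD => //; rewrite ge0_fin_numE; first exact: le_lt_trans muU2 (ltry _).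
  exact: measure_ge0.
(* [U] covers at most half of the interval; on the rest [N] dominates [a x l] and [G] dominates the
   average of [g]. *)
have key : ((a x l)%:E * Ig * (l / 2)%:E <= l%:E * \int[mu]_(z in ival x l `\` U) (N z * G z))%E.
  apply: (@le_trans _ _ ((a x l)%:E * Ig * mu (ival x l `\` U))%E).
    by apply: lee_wpmul2l => //; exact: mule_ge0.
  rewrite -integral_cst// -(nnintegral_scale mV mNG NG0 (ltW l0)).
  apply: ge0_le_integral => //.
  - by move=> z _; exact: mule_ge0.
  - by apply: measurable_funTS; exact: measurable_funeM.
  move=> z [Qz _] /=; rewrite muleCA; apply: lee_pmul => //.
    by exact: aN.
  by exact: gG.
have key2 : ((a x l)%:E * Ig <= 2%:E * \int[mu]_(z in ival x l `\` U) (N z * G z))%E.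
  rewrite -(@lee_pmul2r _ (l / 2)%:E)//; last by rewrite lte_fin divr_gt0.
  apply: le_trans key _; rewrite muleAC -EFinM.
  by rewrite (_ : 2 * (l / 2) = l)//; field.
rewrite -{2}(setDKU sU) (nnintegral_disjU mV mNG NG0 mU); last first.
  by apply/disj_setPS => z [] [].
rewrite [leRHS]ge0_muleDr ?integral_ge0//.
apply: (@le_trans _ _ ((4 * a x l)%:E * Ig + 8%:E * \int[mu]_(z in U) (N z * G z))%E).
  rewrite (_ : 4 * a x l = 2 * a x l + 2 * a x l); last by ring.
  rewrite EFinD ge0_muleDl ?lee_fin ?mulr_ge0// [leRHS]addeAC; exact: leeD.
apply: leeD => //.
have k0 : (0 <= 4%:E :> \bar R)%E by rewrite lee_fin.
have := lee_wpmul2l k0 key2.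
by rewrite !muleA -!EFinM (_ : 4 * 2 = 8 :> R)//; ring.
Qed.

End sparse.

(** * Square functions with a standard kernel *)

Section l2norm.
Set Implicit Arguments.
Unset Strict Implicit.
Context {R : realType} {T : Type}.
Variable s : seq T.

Definition l2 (a : T -> R) := Num.sqrt (\sum_(i <- s) a i ^+ 2).

Lemma l2_ge0 a : 0 <= l2 a. Proof. exact: sqrtr_ge0. Qed.

Lemma sum_sqr_ge0 (r : seq T) (a : T -> R) : 0 <= \sum_(i <- r) a i ^+ 2.
Proof. by apply: sumr_ge0 => i _; exact: sqr_ge0. Qed.

Lemma l2_sqr a : l2 a ^+ 2 = \sum_(i <- s) a i ^+ 2.
Proof. by rewrite sqr_sqrtr// sum_sqr_ge0. Qed.

Lemma sqrt_triangle (a b c d : R) :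
  Num.sqrt ((a + c) ^+ 2 + (b + d) ^+ 2) <= Num.sqrt (a ^+ 2 + b ^+ 2) + Num.sqrt (c ^+ 2 + d ^+ 2).
Proof.
set p := Num.sqrt (a ^+ 2 + _); set q := Num.sqrt (c ^+ 2 + _).
have p0 : 0 <= p by exact: sqrtr_ge0.
have q0 : 0 <= q by exact: sqrtr_ge0.
have p2 : p ^+ 2 = a ^+ 2 + b ^+ 2 by rewrite sqr_sqrtr// addr_ge0// sqr_ge0.
have q2 : q ^+ 2 = c ^+ 2 + d ^+ 2 by rewrite sqr_sqrtr// addr_ge0// sqr_ge0.
rewrite -(ler_pXn2r (n := 2))// ?nnegrE ?sqrtr_ge0 ?addr_ge0//.
rewrite sqr_sqrtr ?addr_ge0 ?sqr_ge0//.
have pq : a * c + b * d <= p * q.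
  apply: le_trans (ler_norm _) _.
  rewrite -(ler_pXn2r (n := 2))// ?nnegrE ?mulr_ge0// real_normK ?num_real// exprMn p2 q2.
  have := sqr_ge0 (a * d - b * c); rewrite !expr2; lra.
move: p2 q2 pq; rewrite !expr2; lra.
Qed.

(** One coordinate at a time: the plane inequality is applied to the first entry and the norm of the
    remaining ones. *)
Lemma l2D a b : l2 (fun i => a i + b i) <= l2 a + l2 b.
Proof.
rewrite /l2; elim: s => [|i r IH]; first by rewrite !big_nil sqrtr0 addr0.
rewrite !big_cons.
set A := \sum_(j <- r) a j ^+ 2; set B := \sum_(j <- r) b j ^+ 2.
have A0 : 0 <= A by exact: sum_sqr_ge0.
have B0 : 0 <= B by exact: sum_sqr_ge0.
have := sqrt_triangle (a i) (Num.sqrt A) (b i) (Num.sqrt B).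
rewrite !sqr_sqrtr//; apply: le_trans; apply: ler_wsqrtr; rewrite lerD2l.
rewrite -[leLHS]sqr_sqrtr ?sum_sqr_ge0//.
by rewrite lerXn2r ?nnegrE ?sqrtr_ge0// addr_ge0 ?sqrtr_ge0.
Qed.

Lemma l2_le_l1 a : l2 a <= \sum_(i <- s) `|a i|.
Proof.
rewrite /l2; elim: s => [|i r IH]; first by rewrite !big_nil sqrtr0.
rewrite !big_cons; have := sqrt_triangle (a i) 0 0 (Num.sqrt (\sum_(j <- r) a j ^+ 2)).
rewrite addr0 add0r sqr_sqrtr ?sum_sqr_ge0// !expr0n/= addr0 add0r !sqrtr_sqr => /le_trans; apply.
by rewrite lerD2l; exact: IH.
Qed.

Lemma l2_dist a b : `|l2 a - l2 b| <= \sum_(i <- s) `|a i - b i|.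
Proof.
have H c d : l2 c - l2 d <= \sum_(i <- s) `|c i - d i|.
  rewrite lerBlDr; apply: (@le_trans _ _ (l2 (fun i => (c i - d i) + d i))).
    by rewrite le_eqVlt; apply/orP; left; apply/eqP; congr l2; apply/funext => i; rewrite subrK.
  by apply: le_trans (l2D _ _) _; rewrite lerD2r; exact: l2_le_l1.
rewrite ler_norml H andbT lerNl opprB; apply: le_trans (H b a) _.
by apply: ler_sum => i _; rewrite distrC.
Qed.

End l2norm.

(** * Bounded test functions with bounded support *)

Section admissible.
Set Implicit Arguments.
Unset Strict Implicit.
Context {R : realType}.
Local Notation mu := (@lebesgue_measure R).

Definition admissible (u : R -> R) := [/\ measurable_fun setT u,
  (exists M, forall x, `|u x| <= M) & exists r, forall x, r < `|x| -> u x = 0].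

Lemma admissible_integrable u : admissible u -> mu.-integrable setT (EFin \o u).
Proof.
move=> [mu' [M uM] [r ur]].
have M0 : 0 <= M by apply: le_trans (uM 0).
pose J := `[- `|r|, `|r|]%classic : set R.
have mJ : measurable J by exact: measurable_itv.
apply: (@le_integrable _ _ _ mu setT measurableT _ (fun x => (M * \1_J x)%:E)).
- exact/measurable_EFinP.
- move=> x _; rewrite /= lee_fin [leRHS]ger0_norm ?mulr_ge0//.
  have [Jx|nJ] := pselect (J x); first by rewrite indicE mem_set// mulr1.
  rewrite indicE memNset// mulr0 ur ?normr0//.
  rewrite ltNge; apply/negP => xr; apply: nJ; rewrite /J/= in_itv/= -ler_norml.
  exact: le_trans xr (ler_norm _).
- under eq_fun do rewrite EFinM; apply: integrableZl => //.
  apply/integrableP; split; first by apply/measurable_EFinP; exact: measurable_indic.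
  under eq_integral do rewrite abse_EFin ger0_norm//.
  rewrite integral_indic// setIT [ltLHS]lebesgue_measure_itv/=.
  by case: ifP => _; rewrite ?ltry// -EFinD ltry.
Qed.

Lemma admissibleM u (f : R -> R) : admissible u -> measurable_fun setT f ->
  (exists M, forall x, `|f x| <= M) -> admissible (fun x => u x * f x).
Proof.
move=> [mu' [M uM] [r ur]] mf [M' fM]; split.
- exact: measurable_funM.
- exists (M * M') => x; rewrite normrM; exact: ler_pM.
- by exists r => x /ur ->; rewrite mul0r.
Qed.

Lemma admissibleD u v : admissible u -> admissible v -> admissible (fun x => u x + v x).
Proof.
move=> [mu' [M uM] [r ur]] [mv [M' vM] [r' vr]]; split.
- exact: measurable_funD.
- exists (M + M') => x; apply: le_trans (ler_normD _ _) _; exact: lerD.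
- by exists (Num.max r r') => x; rewrite gt_max => /andP[/ur -> /vr ->]; rewrite addr0.
Qed.

Lemma admissible_indic u (A : set R) : admissible u -> measurable A ->
  admissible (fun x => u x * \1_A x).
Proof.
move=> au mA; apply: admissibleM => //; exists 1 => x.
by rewrite ger0_norm// indicE; case: (_ \in _).
Qed.

Lemma admissible_cst_ival (k x l : R) : admissible (fun y => k * \1_(ival x l) y).
Proof.
split.
- by apply: measurable_funM => //; apply: measurable_indic; exact: measurable_ival.
- exists `|k| => y; rewrite normrM ler_piMr// indicE; case: (_ \in _) => /=; by rewrite ?normr1 ?normr0.
- exists (`|x| + `|l|) => y hy; rewrite indicE memNset ?mulr0//.
  rewrite /ival/= in_itv/= => /andP[h1 h2].
  have := ler_norm x; have := ler_norm (- x); have := ler_norm l; rewrite normrN.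
  by move: hy; have [y0|y0] := leP 0 y; [rewrite (ger0_norm y0)|rewrite (ltr0_norm y0)]; have := normr_ge0 l; lra.
Qed.

Lemma admissible_measurable_abs u : admissible u ->
  measurable_fun setT (fun y => (`|u y|)%:E : \bar R).
Proof. by case=> mu' _ _; apply/measurable_EFinP; exact: measurableT_comp. Qed.

End admissible.

(** * Finite square functions and their coefficients *)

Section square_function.
Set Implicit Arguments.
Unset Strict Implicit.
Context {R : realType} {T : Type}.
Local Notation mu := (@lebesgue_measure R).
Variables (s : seq T) (phi theta : T -> R -> R) (L : T -> R).

Definition coef (u : R -> R) i : R := \int[mu]_x (u x * phi i x).

(** With [phi] the real and imaginary parts of the wavelets and [theta] their moduli, this is the
    square function of a real [u]. The bounds [L i] may depend on the index, as they only influence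
    the choice of the finest scale. *)
Definition sqfun u x := l2 s (fun i => coef u i * theta i x).

Hypothesis L0 : forall i, 0 <= L i.
Hypothesis phib : forall i x, `|phi i x| <= L i.
Hypothesis phiL : forall i x y, `|phi i x - phi i y| <= L i * `|x - y|.
Hypothesis theta0 : forall i x, 0 <= theta i x.
Hypothesis thetaL : forall i x y, `|theta i x - theta i y| <= L i * `|x - y|.

Lemma measurable_phi i : measurable_fun setT (phi i).
Proof. exact: lipschitz_measurable (phiL i). Qed.

Lemma measurable_theta i : measurable_fun setT (theta i).
Proof. exact: lipschitz_measurable (thetaL i). Qed.

Lemma admissible_phi u i : admissible u -> admissible (fun x => u x * phi i x).
Proof. by move=> au; apply: admissibleM => //; [exact: measurable_phi|exists (L i)]. Qed.

Lemma wcoefD u v i : admissible u -> admissible v ->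
  coef (fun x => u x + v x) i = coef u i + coef v i.
Proof.
move=> au av; rewrite /coef -RintegralD//; try exact/admissible_integrable/admissible_phi.
by apply: eq_Rintegral => x _; rewrite mulrDl.
Qed.

Lemma sqfunD u v x : admissible u -> admissible v ->
  sqfun (fun x => u x + v x) x <= sqfun u x + sqfun v x.
Proof.
move=> au av; apply: le_trans (l2D _ _ _); rewrite le_eqVlt; apply/orP; left.
by apply/eqP; congr l2; apply/funext => i; rewrite wcoefD// mulrDl.
Qed.

Lemma sqfun_ge0 u x : 0 <= sqfun u x. Proof. exact: l2_ge0. Qed.

Lemma sqfun_le_l1 u x : sqfun u x <= \sum_(i <- s) `|coef u i| * theta i x.
Proof.
apply: le_trans (l2_le_l1 _ _) _; apply: ler_sum => i _.
by rewrite normrM (ger0_norm (theta0 i x)).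
Qed.

Lemma sqfun_dist u x y :
  `|sqfun u x - sqfun u y| <= \sum_(i <- s) `|coef u i| * `|theta i x - theta i y|.
Proof.
apply: le_trans (l2_dist _ _ _) _; apply: ler_sum => i _.
by rewrite -mulrBr normrM.
Qed.

Lemma sqfun_lipschitz u x y :
  `|sqfun u x - sqfun u y| <= (\sum_(i <- s) `|coef u i| * L i) * `|x - y|.
Proof.
apply: le_trans (sqfun_dist _ _ _) _; rewrite mulr_suml; apply: ler_sum => i _.
by rewrite -mulrA ler_wpM2l.
Qed.

Lemma measurable_sqfun u : measurable_fun setT (sqfun u).
Proof. exact: lipschitz_measurable (sqfun_lipschitz u). Qed.

Lemma sqfun0 u x : (forall i, coef u i = 0) -> sqfun u x = 0.
Proof.
move=> u0; apply/eqP; rewrite eq_le sqfun_ge0 andbT; apply: le_trans (sqfun_le_l1 _ _) _.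
by rewrite big1// => i _; rewrite u0 normr0 mul0r.
Qed.

(* Subtracting the constants [c i] from the kernel is free when [b] has mean
   zero; with [c = 0] no cancellation is needed. *)
Lemma coef_l1_le b (a c : T -> R) : admissible b -> (forall i, 0 <= a i) ->
  (forall i, c i * \int[mu]_x b x = 0) ->
  ((\sum_(i <- s) `|coef b i| * a i)%:E <=
   \int[mu]_y (`|b y| * \sum_(i <- s) `|phi i y - c i| * a i)%:E)%E.
Proof.
move=> ab a0 c0.
have mb : measurable_fun setT b by case: ab.
have mi i : measurable_fun setT (fun y => `|b y| * (`|phi i y - c i| * a i)).
  apply: measurable_funM; first exact: measurableT_comp.
  apply: measurable_funM => //; apply: measurableT_comp => //.
  by apply: measurable_funB => //; exact: measurable_phi.
rewrite [leRHS](_ : _ = \int[mu]_y (\sum_(i <- s) (`|b y| * (`|phi i y - c i| * a i))%:E))%E; last first.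
  by apply: eq_integral => y _; rewrite mulr_sumr -sumEFin.
rewrite ge0_integral_sum//; last 2 first.
- by move=> i; apply/measurable_EFinP; exact: mi.
- move=> i y _; rewrite lee_fin; apply: mulr_ge0 => //; exact: mulr_ge0.
rewrite -sumEFin; apply: lee_sum => i _.
have abc : admissible (fun y => b y * (phi i y - c i)).
  apply: admissibleM => //.
    by apply: measurable_funB => //; exact: measurable_phi.
  exists (L i + `|c i|) => y; apply: le_trans (ler_normB _ _) _.
  by rewrite lerD2r.
have -> : coef b i = \int[mu]_y (b y * (phi i y - c i)).
  under eq_Rintegral do rewrite mulrBr.
  rewrite RintegralB//; last 2 first.
  - exact/admissible_integrable/admissible_phi.
  - apply: admissible_integrable; apply: admissibleM => //; by exists `|c i|.
  rewrite RintegralZr//; last exact: admissible_integrable.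
  by rewrite mulrC c0 subr0.
under [leRHS]eq_integral do rewrite mulrA mulrC EFinM.
have mbp : measurable_fun setT (fun y => (`|b y| * `|phi i y - c i|)%:E : \bar R).
  apply/measurable_EFinP; apply: measurable_funM; first exact: measurableT_comp.
  apply: measurableT_comp => //; by apply: measurable_funB => //; exact: measurable_phi.
have bp0 y : (0 <= (`|b y| * `|phi i y - c i|)%:E :> \bar R)%E by rewrite lee_fin mulr_ge0.
rewrite (nnintegral_scale measurableT mbp bp0 (a0 i)).
rewrite EFinM muleC; apply: lee_wpmul2l; first by rewrite lee_fin.
rewrite EFin_normr_Rintegral//; last exact: admissible_integrable.
apply: le_trans (le_abse_integral _ _ _) _ => //.
  by apply/measurable_EFinP; case: abc.
by under eq_integral do rewrite abse_EFin normrM.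
Qed.

End square_function.

(** * Integrals against inverse square decay *)

Section annuli.
Set Implicit Arguments.
Unset Strict Implicit.
Context {R : realType}.
Local Notation mu := (@lebesgue_measure R).

Lemma dyadic_scale (t : R) : 1 <= t -> exists k : nat, 2 ^+ k <= t <= 2 ^+ k.+1.
Proof.
move=> t1; have t0 : 0 <= t by lra.
have n0 : (0 < Num.truncn t)%N by rewrite truncn_gt0.
have /andP[h1 h2] := trunc_log_bounds (isT : (1 < 2)%N) n0.
exists (trunc_log 2 (Num.truncn t)); apply/andP; split.
  by apply: (@le_trans _ _ (Num.truncn t)%:R); [rewrite -natrX ler_nat|by rewrite truncn_le].
apply: ltW; apply: lt_le_trans (truncnS_gt t) _.
by rewrite -natrX ler_nat.
Qed.

Lemma measurable_outer (c l : R) : measurable [set y | l <= `|y - c|].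
Proof.
rewrite (_ : [set y | _] = `]-oo, c - l] `|` `[c + l, +oo[)%classic.
  by apply: measurableU; exact: measurable_itv.
apply/seteqP; split => y /=; rewrite !in_itv/= andbT.
  by rewrite ler_normr => /orP[h|h]; [right|left]; lra.
by move=> [h|h]; rewrite ler_normr; apply/orP; [right|left]; lra.
Qed.

(** On the annulus where |y - c| lies between 2^k l and 2^(k+1) l the weight is at most K / (4^k l)
    and the mass of [u] at most 4 2^k l m. The product is 8 K m / 2^(k+1), and the series sums to 8
    K m. *)
Lemma integral_annuli_le (u w : R -> R) (c l m K : R) : 0 < l -> 0 <= m -> 0 <= K ->
  measurable_fun setT u -> (forall y, 0 <= u y) ->
  measurable_fun setT w -> (forall y, 0 <= w y) ->
  (forall y, l <= `|y - c| -> w y <= K * (l / (y - c) ^+ 2)) ->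
  (forall r, l <= r -> (\int[mu]_(y in `[(c - r)%R, (c + r)%R]) (u y)%:E <= (2 * r * m)%:E)%E) ->
  (\int[mu]_(y in [set y | (l <= `|y - c|)%R]) (u y * w y)%:E <= (K * (8 * m))%:E)%E.
Proof.
move=> l0 m0 K0 mu' u0 mw w0 wK um.
pose J (k : nat) : set R := `[c - 2 ^+ k.+1 * l, c + 2 ^+ k.+1 * l]%classic.
have mJ k : measurable (J k) by exact: measurable_itv.
have p2 k : 0 < 2 ^+ k :> R by rewrite exprn_gt0.
pose q k := K * (4 ^+ k * l)^-1.
have q0 k : 0 <= q k by rewrite mulr_ge0// invr_ge0 mulr_ge0// ?exprn_ge0// ltW.
pose f k y := ((q k)%:E * (u y * \1_(J k) y)%:E)%E.
have mf k : measurable_fun setT (f k).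
  by apply: measurable_funeM; apply/measurable_EFinP; exact: measurable_funM.
have f0 k y : (0 <= f k y)%E by rewrite mule_ge0 ?lee_fin// mulr_ge0.
have mD := measurable_outer c l.
apply: (@le_trans _ _ (\int[mu]_y (\sum_(k <oo) f k y))%E).
  rewrite [leLHS]integral_mkcond; apply: ge0_le_integral => //.
  - by move=> y _; rewrite patchE; case: ifP => // _; rewrite lee_fin mulr_ge0.
  - apply/(measurable_restrictT _ _).1 => //; apply/measurable_EFinP.
    by apply: measurable_funTS; exact: measurable_funM.
  - by apply: ge0_emeasurable_sum => [k y _ _|k _]; [exact: f0|exact: mf].
  - move=> y _; rewrite patchE; case: ifPn => [|_]; last exact: nneseries_ge0.
    rewrite inE/= => ly.
    have [|k /andP[h1 h2]] := @dyadic_scale (`|y - c| / l); first by rewrite ler_pdivlMr// mul1r.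
    rewrite ler_pdivlMr// in h1; rewrite ler_pdivrMr// in h2.
    rewrite (nneseries_split 0 k.+1) ?add0n//.
    rewrite big_nat_recr//= -[leLHS]adde0; apply: leeD; last exact: nneseries_ge0.
    rewrite -[leLHS]add0e; apply: leeD; first exact: sume_ge0.
    rewrite /f indicE mem_set; last first.
      by rewrite /J/= in_itv/=; move: h2; rewrite ler_norml => /andP[? ?]; apply/andP; split; lra.
    rewrite mulr1 -EFinM lee_fin mulrC ler_wpM2r//.
    apply: le_trans (wK _ ly) _; rewrite ler_wpM2l//.
    have y0 : 0 < `|y - c| by apply: lt_le_trans ly.
    rewrite -[X in l / X]real_normK ?num_real// ler_pdivrMr ?exprn_gt0//.
    rewrite mulrC ler_pdivlMr ?mulr_gt0 ?exprn_gt0//.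
    rewrite mulrCA -expr2.
    have -> : 4 ^+ k * l ^+ 2 = (2 ^+ k * l) ^+ 2.
      by rewrite exprMn -exprM mulnC exprM (_ : 2 ^+ 2 = 4 :> R)// -natrX.
    by rewrite lerXn2r ?nnegrE// mulr_ge0// ltW.
rewrite integral_nneseries//.
apply: (@le_trans _ _ (\sum_(k <oo) (K * (8 * m) / (2 ^ k.+1)%:R)%:E)%E); last first.
  by apply: epsilon_trick0; rewrite mulr_ge0// mulr_ge0.
apply: lee_nneseries => [k _ _|k _]; first exact: integral_ge0.
rewrite nnintegral_scale//; last 2 first.
- by apply/measurable_EFinP; exact: measurable_funM.
- by move=> y; rewrite lee_fin mulr_ge0.
have -> : (\int[mu]_y (u y * \1_(J k) y)%:E = \int[mu]_(y in J k) (u y)%:E)%E.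
  rewrite [RHS]integral_mkcond epatch_indic; apply: eq_integral => y _.
  by rewrite EFinM.
have lr : l <= 2 ^+ k.+1 * l by apply: ler_peMl; [exact: ltW|apply: exprn_ege1; rewrite ler1n].
apply: le_trans (lee_wpmul2l _ (um _ lr)) _; first by rewrite lee_fin.
rewrite -EFinM lee_fin /q natrX le_eqVlt; apply/orP; left; apply/eqP.
have -> : (4 : R) ^+ k = 2 ^+ k * 2 ^+ k by rewrite -exprMn -natrM.
by rewrite exprS; field; rewrite !gt_eqF.
Qed.

End annuli.

(** * Calderon-Zygmund decomposition, weak type and local oscillation *)

Section calderon_zygmund.
Set Implicit Arguments.
Unset Strict Implicit.
Context {R : realType} {T : Type}.
Local Notation mu := (@lebesgue_measure R).
Variables (s : seq T) (phi theta : T -> R -> R) (L : T -> R) (kap : R).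
Hypothesis L0 : forall i, 0 <= L i.
Hypothesis phib : forall i x, `|phi i x| <= L i.
Hypothesis phiL : forall i x y, `|phi i x - phi i y| <= L i * `|x - y|.
Hypothesis theta0 : forall i x, 0 <= theta i x.
Hypothesis thetaL : forall i x y, `|theta i x - theta i y| <= L i * `|x - y|.
Hypothesis thetaI : forall i, (\int[mu]_x (theta i x)%:E <= (L i)%:E)%E.
Hypothesis kap0 : 0 <= kap.
Hypothesis K1 : forall x x' y, x != y -> `|x - x'| <= `|x - y| / 2 ->
  \sum_(i <- s) `|theta i x - theta i x'| * `|phi i y| <= kap * (`|x - x'| / (x - y) ^+ 2).
Hypothesis K2 : forall x x' y, x != y -> `|x - x'| <= `|x - y| / 2 ->
  \sum_(i <- s) `|phi i x - phi i x'| * theta i y <= kap * (`|x - x'| / (x - y) ^+ 2).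
Hypothesis bessel : forall u, admissible u ->
  (\int[mu]_x (sqfun s phi theta u x ^+ 2)%:E <= \int[mu]_x (u x ^+ 2)%:E)%E.
Local Notation V := (sqfun s phi theta).

Let mVE u : measurable_fun setT (fun z => (V u z)%:E).
Proof. by apply/measurable_EFinP; exact: (measurable_sqfun s phi thetaL). Qed.

Let V0E u z : (0 <= (V u z)%:E)%E.
Proof. by rewrite lee_fin sqfun_ge0. Qed.

Let abs0 (u : R -> R) y : (0 <= (`|u y|)%:E)%E.
Proof. by rewrite lee_fin. Qed.

(** Mean zero lets [phi i] be replaced by its increment from the centre c of the interval. By [K2]
    the value of the square function at z is then at most kap N (l/2) / (z - c)^2, which is
    integrated over annuli with the density 1. *)
Lemma sqfun_cancel_le b x l N : 0 < l -> 0 <= N -> admissible b ->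
  (forall y, ~ ival x l y -> b y = 0) -> \int[mu]_y b y = 0 ->
  (\int[mu]_y (`|b y|)%:E <= N%:E)%E ->
  (\int[mu]_(z in ~` ival (x - l) (3 * l)) (V b z)%:E <= (4 * kap * N)%:E)%E.
Proof.
move=> l0 N0 ab bQ ib nb; pose c := x + l / 2.
have mD := measurable_outer c l.
apply: (@le_trans _ _ (\int[mu]_(y in [set y | l <= `|y - c|]%R) (1 * V b y)%:E)%E).
  under [leRHS]eq_integral do rewrite mul1r.
  apply: nnintegral_subset => //.
    by apply: measurableC; exact: measurable_ival.
  move=> z /= zQ; rewrite ler_normr; apply: contrapT => /negP; rewrite negb_or -!ltNge => /andP[h1 h2].
  by apply: zQ; rewrite /ival/= in_itv/= /c; move: h1 h2; rewrite /c => *; apply/andP; split; lra.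
have -> : 4 * kap * N = kap * N / 2 * (8 * 1) by field.
apply: (@integral_annuli_le _ (cst 1)) => //.
- by rewrite !mulr_ge0.
- exact: (measurable_sqfun s phi thetaL).
- by move=> y; exact: sqfun_ge0.
- move=> z lz.
  apply: le_trans (sqfun_le_l1 s phi theta0 b z) _; rewrite -lee_fin.
  have zc : c != z by apply: contraTneq lz => ->; rewrite subrr normr0 -ltNge.
  apply: le_trans (coef_l1_le s phib phiL (c := fun i => phi i c) ab _ _) _.
  - by move=> i; exact: theta0.
  - by move=> i; rewrite ib mulr0.
  pose k := kap * (l / 2 / (z - c) ^+ 2).
  have k0 : 0 <= k by rewrite mulr_ge0// divr_ge0 ?sqr_ge0// divr_ge0// ltW.
  apply: (@le_trans _ _ (\int[mu]_y (k%:E * (`|b y|)%:E))%E).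
    apply: nnintegral_le => //.
    + apply/measurable_EFinP; apply: measurable_funM.
        by apply: measurableT_comp => //; case: ab.
      apply: measurable_sum => i; apply: measurable_funM => //.
      apply: measurableT_comp => //; apply: measurable_funB => //; exact: measurable_phi phiL _.
    + by apply: measurable_funeM; exact: admissible_measurable_abs.
    + by move=> y; rewrite lee_fin mulr_ge0// sumr_ge0// => i _; rewrite mulr_ge0.
    move=> y _; rewrite -EFinM lee_fin.
    have [Qy|Qy] := pselect (ival x l y); last by rewrite bQ// normr0 mul0r mulr0.
    rewrite mulrC ler_wpM2r//.
    have yc : `|c - y| <= l / 2.
      by move: Qy; rewrite /ival/= in_itv/= /c ler_norml => /andP[? ?]; apply/andP; split; lra.
    under eq_bigr do rewrite distrC.
    apply: le_trans (K2 zc _) _.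
      by apply: le_trans yc _; rewrite ler_wpM2r// distrC.
    rewrite /k ler_wpM2l// -[in leRHS](sqrrN (z - c)) opprB.
    apply: ler_wpM2r => //; rewrite invr_ge0; exact: sqr_ge0.
  rewrite nnintegral_scale//; last exact: admissible_measurable_abs.
  apply: le_trans (lee_wpmul2l _ nb) _; first by rewrite lee_fin.
  rewrite -EFinM lee_fin /k le_eqVlt; apply/orP; left; apply/eqP; field.
  by rewrite subr_eq0 eq_sym.
- move=> r lr; rewrite [leLHS](_ : _ = \int[mu]_(y in `[(c - r)%R, (c + r)%R]) (cst 1%E) y)%E//.
  rewrite integral_cst//= mul1e lebesgue_measure_itv/= lte_fin.
  have r0 : 0 < r by lra.
  by case: ifP => [_|/negP[]]; rewrite ?ltrBlDr -?EFinD ?lee_fin; lra.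
Qed.

Lemma admissible_fin u A : admissible u -> measurable A ->
  (\int[mu]_(y in A) (`|u y|)%:E \is a fin_num)%E.
Proof.
move=> au mA; rewrite ge0_fin_numE; last exact: integral_ge0.
apply: (@le_lt_trans _ _ (\int[mu]_y (`|u y|)%:E)%E).
  by apply: nnintegral_subset => //; exact: admissible_measurable_abs.
by have /integrableP[_] := admissible_integrable au.
Qed.

Let mI (x l : R) : measurable (ival x l).
Proof. exact: measurable_ival. Qed.

(** [g] is the average of [u] on the interval and [b] the remainder, whose L^1 norm is at most twice
    that of [u] there. The last clause serves the finest scale: each [phi i] varies by at most L i l
    on the interval and [theta i] has integral at most L i, so the square function of [b] is
    controlled on the whole line and no exceptional set has to be removed. *)
Lemma average_piece u x l M : admissible u -> 0 < l -> 0 <= M ->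
  (\int[mu]_(y in ival x l) (`|u y|)%:E <= (M * l)%:E)%E ->
  exists g b, [/\ admissible g, admissible b &
     forall y, u y * \1_(ival x l) y = g y + b y] /\
   [/\ forall y, `|g y| <= M, forall y, ~ ival x l y -> g y = 0,
    (\int[mu]_y (`|g y|)%:E <= \int[mu]_(y in ival x l) (`|u y|)%:E)%E,
    (\int[mu]_(z in ~` ival (x - l) (3 * l)) (V b z)%:E <=
       (8 * kap)%:E * \int[mu]_(y in ival x l) (`|u y|)%:E)%E &
    l * \sum_(i <- s) L i ^+ 2 <= 1 ->
     (\int[mu]_z (V b z)%:E <= 2%:E * \int[mu]_(y in ival x l) (`|u y|)%:E)%E].
Proof.
move=> au l0 M0 uM.
set Q := ival x l.
have mQ : measurable Q by exact: mI.
pose N := fine (\int[mu]_(y in Q) (`|u y|)%:E).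
have NE : (\int[mu]_(y in Q) (`|u y|)%:E = N%:E)%E by rewrite fineK// admissible_fin.
have N0 : 0 <= N by rewrite -lee_fin -NE integral_ge0.
rewrite NE lee_fin in uM *.
have auQ : admissible (fun y => u y * \1_Q y) by exact: admissible_indic.
pose A := (\int[mu]_y (u y * \1_Q y)) / l.
have absuQ : (\int[mu]_y (`|u y * \1_Q y|)%:E = N%:E)%E.
  rewrite -NE [RHS]integral_mkcond epatch_indic; apply: eq_integral => y _.
  by rewrite normrM EFinM [X in (_ * X%:E)%E]ger0_norm.
have Al : `|A| * l <= N.
  rewrite /A normrM normfV (gtr0_norm l0) divfK ?gt_eqF// -lee_fin.
  rewrite EFin_normr_Rintegral//; last exact: admissible_integrable.
  rewrite -absuQ; apply: le_trans (le_abse_integral _ _ _) _ => //.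
  by apply/measurable_EFinP; case: auQ.
pose g y := A * \1_Q y.
have ag : admissible g by exact: admissible_cst_ival.
pose b y := u y * \1_Q y + - A * \1_Q y.
have ab : admissible b by apply: admissibleD => //; exact: admissible_cst_ival.
have indicI : (\int[mu]_y (\1_Q y) = l)%R.
  rewrite /Rintegral integral_indic// setIT.
  by have := mu_ival x l0 => E; rewrite [X in fine X]E.
have absg : (\int[mu]_y (`|g y|)%:E = (`|A| * l)%:E)%E.
  under eq_integral do rewrite normrM EFinM [X in (_ * X%:E)%E]ger0_norm//.
  rewrite nnintegral_scale//; last by apply/measurable_EFinP; exact: measurable_indic.
  rewrite integral_indic// setIT EFinM; congr (_ * _)%E; exact: mu_ival.
have absb : (\int[mu]_y (`|b y|)%:E <= (2 * N)%:E)%E.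
  apply: (@le_trans _ _ (\int[mu]_y ((`|u y * \1_Q y|)%:E + (`|g y|)%:E))%E).
    apply: nnintegral_le => //.
    - exact: admissible_measurable_abs.
    - by apply: emeasurable_funD; exact: admissible_measurable_abs.
    - move=> y _; rewrite -EFinD lee_fin; apply: le_trans (ler_normD _ _) _.
      by rewrite mulNr normrN.
  rewrite nnintegral_add//; try exact: admissible_measurable_abs.
  by rewrite absuQ absg -EFinD lee_fin; lra.
have ib : \int[mu]_y b y = 0.
  rewrite /b RintegralD//; try exact: admissible_integrable.
  - have i1 : mu.-integrable setT (EFin \o \1_Q).
      have := admissible_integrable (admissible_cst_ival 1 x l).
      by congr (_.-integrable); apply/funext => y /=; rewrite mul1r.
    rewrite RintegralZl// indicI mulNr /A divfK ?subrr// gt_eqF//.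
  - exact/admissible_integrable/admissible_cst_ival.
have bQ y : ~ Q y -> b y = 0.
  by move=> Qy; rewrite /b indicE memNset// !mulr0 addr0.
exists g, b; split.
  split => // y; rewrite /g /b; ring.
split => //.
- move=> y; rewrite /g normrM; apply: (@le_trans _ _ `|A|).
    by rewrite ler_piMr// ger0_norm// indicE; case: (_ \in _).
  by rewrite -(ler_pM2r l0); exact: le_trans uM.
- by move=> y Qy; rewrite /g indicE memNset// mulr0.
- by rewrite absg lee_fin.
- have := @sqfun_cancel_le b x l (2 * N) l0 _ ab bQ ib absb.
  rewrite -EFinM (_ : 4 * kap * (2 * N) = 8 * kap * N); last by ring.
  by apply; lra.
move=> hl.
have cb : \sum_(i <- s) `|coef phi b i| * L i <= 2 * N.
  rewrite -lee_fin.
  apply: le_trans (coef_l1_le s phib phiL (c := fun i => phi i x) ab L0 _) _.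
    by move=> i; rewrite ib mulr0.
  apply: le_trans absb; apply: nnintegral_le => //.
  - apply/measurable_EFinP; apply: measurable_funM.
      by apply: measurableT_comp => //; case: ab.
    apply: measurable_sum => i; apply: measurable_funM => //.
    apply: measurableT_comp => //; apply: measurable_funB => //; exact: measurable_phi phiL _.
  - exact: admissible_measurable_abs.
  - by move=> y; rewrite lee_fin mulr_ge0// sumr_ge0// => i _; rewrite mulr_ge0.
  move=> y _; rewrite lee_fin.
  have [Qy|Qy] := pselect (Q y); last by rewrite bQ// normr0 mul0r.
  rewrite ler_piMr//; apply: le_trans hl; rewrite mulr_sumr; apply: ler_sum => i _.
  rewrite expr2 mulrA ler_wpM2r//; apply: le_trans (phiL _ _ _) _.
  rewrite mulrC ler_wpM2r//.
  by move: Qy; rewrite /Q /ival/= in_itv/= ler_norml => /andP[? ?]; apply/andP; split; lra.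
apply: (@le_trans _ _ (\int[mu]_z (\sum_(i <- s) (`|coef phi b i|)%:E * (theta i z)%:E))%E).
  apply: nnintegral_le => //.
  - by apply: emeasurable_sum => i; apply: measurable_funeM; apply/measurable_EFinP; exact: (measurable_theta thetaL).
  - move=> z _; apply: le_trans (_ : ((\sum_(i <- s) `|coef phi b i| * theta i z)%:E <= _)%E).
      by rewrite lee_fin; exact: sqfun_le_l1.
    by rewrite -sumEFin; apply: lee_sum => i _; rewrite EFinM.
rewrite ge0_integral_sum//; last 2 first.
- by move=> i; apply: measurable_funeM; apply/measurable_EFinP; exact: (measurable_theta thetaL).
- by move=> i z _; rewrite -EFinM lee_fin mulr_ge0.
rewrite -EFinM; apply: (@le_trans _ _ (\sum_(i <- s) `|coef phi b i| * L i)%:E); last by rewrite lee_fin.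
rewrite -sumEFin; apply: lee_sum => i _.
have mt : measurable_fun setT (fun z => (theta i z)%:E).
  by apply/measurable_EFinP; exact: (measurable_theta thetaL).
have t0 z : (0 <= (theta i z)%:E)%E by rewrite lee_fin.
rewrite (nnintegral_scale measurableT mt t0 (normr_ge0 _)) EFinM.
by apply: lee_wpmul2l => //; rewrite lee_fin.
Qed.

Section scale.
Variable h : R.
Hypothesis h0 : 0 < h.
Hypothesis hL : h * \sum_(i <- s) L i ^+ 2 <= 1.

Lemma cz_decomposition u lam : admissible u -> 0 < lam ->
  forall n x, let l := 2 ^+ n * h in
  (\int[mu]_(y in ival x l) (`|u y|)%:E <= (lam * l)%:E)%E ->
  exists g b (Ex : set R), [/\ admissible g, admissible b, measurable Ex &
     forall y, u y * \1_(ival x l) y = g y + b y] /\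
   [/\ forall y, `|g y| <= 2 * lam, forall y, ~ ival x l y -> g y = 0,
    (\int[mu]_y (`|g y|)%:E <= \int[mu]_(y in ival x l) (`|u y|)%:E)%E,
    (mu Ex <= (3 / lam)%:E * \int[mu]_(y in ival x l) (`|u y|)%:E)%E &
    (\int[mu]_(z in ~` Ex) (V b z)%:E <=
       (8 * kap + 2)%:E * \int[mu]_(y in ival x l) (`|u y|)%:E)%E].
Proof.
have kap_ge0 : 0 <= kap := kap0.
move=> au lam0; have iu0 (A : set R) : (0 <= \int[mu]_(y in A) (`|u y|)%:E)%E by exact: integral_ge0.
elim=> [|n IH] x l ul.
  rewrite {}/l expr0 mul1r in ul *.
  have [g [b [[ag ab gb] [gM gQ ig _ ib]]]] := average_piece au h0 (ltW lam0) ul.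
  exists g, b, set0; split; split => //.
  - by move=> y; apply: le_trans (gM y) _; lra.
  - by rewrite measure0 mule_ge0// lee_fin divr_ge0// ltW.
  - rewrite setC0; apply: le_trans (ib hL) _; apply: lee_wpmul2r => //.
    by rewrite lee_fin; lra.
pose l' := 2 ^+ n * h.
have ll' : l / 2 = l' by rewrite /l /l' exprS; field.
have l'0 : 0 < l' by rewrite mulr_gt0// exprn_gt0.
have l0 : 0 < l by lra.
have child y : ival y l' `<=` ival x l ->
  exists g b (Ex : set R), [/\ admissible g, admissible b, measurable Ex &
     forall z, u z * \1_(ival y l') z = g z + b z] /\
   [/\ forall z, `|g z| <= 2 * lam, forall z, ~ ival y l' z -> g z = 0,
    (\int[mu]_z (`|g z|)%:E <= \int[mu]_(z in ival y l') (`|u z|)%:E)%E,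
    (mu Ex <= (3 / lam)%:E * \int[mu]_(z in ival y l') (`|u z|)%:E)%E &
    (\int[mu]_(z in ~` Ex) (V b z)%:E <=
       (8 * kap + 2)%:E * \int[mu]_(z in ival y l') (`|u z|)%:E)%E].
  (* A selected half has average above [lam], and at most [2 * lam] because that of its parent is at
     most [lam]. *)
  move=> sub; have [st|st] := leP (\int[mu]_(z in ival y l') (`|u z|)%:E)%E (lam * l')%:E.
    exact: IH.
  have ul' : (\int[mu]_(z in ival y l') (`|u z|)%:E <= (2 * lam * l')%:E)%E.
    apply: le_trans (_ : (_ <= \int[mu]_(z in ival x l) (`|u z|)%:E)%E) _.
      by apply: nnintegral_subset => //; exact: admissible_measurable_abs.
    by apply: le_trans ul _; rewrite lee_fin -ll'; lra.
  have lam20 : 0 <= 2 * lam by lra.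
  have [g [b [[ag ab gb] [gM gQ ig ib _]]]] := average_piece au l'0 lam20 ul'.
  exists g, b, (ival (y - l') (3 * l')); split; split => //.
  - rewrite mu_ival; last by rewrite mulr_gt0.
    rewrite (_ : 3 * l' = 3 / lam * (lam * l')); last by field; rewrite gt_eqF.
    by rewrite EFinM; apply: lee_wpmul2l; [rewrite lee_fin divr_ge0// ltW|exact: ltW].
  - apply: le_trans ib _; apply: lee_wpmul2r => //; rewrite lee_fin; lra.
have sub1 : ival x l' `<=` ival x l by apply: ivalS => //; lra.
have sub2 : ival (x + l') l' `<=` ival x l by apply: ivalS => //; lra.
have dis : [disjoint ival x l' & ival (x + l') l'] by rewrite -ll'; exact: ival_half_disj.
have disP z : ival x l' z -> ival (x + l') l' z -> False.
  by move=> z1 z2; move/disj_setPS : dis; apply; split; [exact: z1|exact: z2].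
have [g1 [b1 [E1 [[ag1 ab1 mO1 gb1] [gM1 gQ1 ig1 muO1 ib1]]]]] := child x sub1.
have [g2 [b2 [E2 [[ag2 ab2 mO2 gb2] [gM2 gQ2 ig2 muO2 ib2]]]]] := child (x + l') sub2.
exists (fun y => g1 y + g2 y), (fun y => b1 y + b2 y), (E1 `|` E2).
have iuE : (\int[mu]_(z in ival x l) (`|u z|)%:E =
    \int[mu]_(z in ival x l') (`|u z|)%:E + \int[mu]_(z in ival (x + l') l') (`|u z|)%:E)%E.
  by rewrite integral_ival_half// ?ll'//; exact: admissible_measurable_abs.
split; split.
- exact: admissibleD.
- exact: admissibleD.
- exact: measurableU.
- move=> y; rewrite addrACA -gb1 -gb2 -mulrDr; congr (_ * _).
  have -> : ival x l = ival x l' `|` ival (x + l') l' by rewrite (ival_half x l0) ll'.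
  rewrite !indicE; have [y1|y1] := pselect (ival x l' y).
    rewrite (mem_set y1) [y \in ival (x + l') l']memNset; last exact: disP.
    by rewrite mem_set ?addr0//; left.
  rewrite [y \in ival x l']memNset// add0r; congr (nat_of_bool _)%:R.
  by apply/idP/idP; rewrite !inE => //; [case|right].
- move=> y; have [y1|y1] := pselect (ival x l' y).
    by rewrite gQ2 ?addr0//; exact: disP.
  by rewrite gQ1 ?add0r.
- move=> y yQ; rewrite gQ1 ?gQ2 ?addr0//; [by move=> /sub2|by move=> /sub1].
- apply: (@le_trans _ _ (\int[mu]_y ((`|g1 y|)%:E + (`|g2 y|)%:E))%E).
    apply: nnintegral_le => //.
    + by apply: admissible_measurable_abs; exact: admissibleD.
    + by apply: emeasurable_funD; exact: admissible_measurable_abs.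
    + by move=> y _; rewrite -EFinD lee_fin ler_normD.
  rewrite nnintegral_add//; try exact: admissible_measurable_abs.
  by rewrite iuE; exact: leeD.
- apply: (@le_trans _ _ (mu E1 + mu E2)%E); first exact: measureU2.
  by rewrite iuE ge0_muleDr//; exact: leeD.
- rewrite setCU; apply: (@le_trans _ _ (\int[mu]_(y in ~` E1 `&` ~` E2) ((V b1 y)%:E + (V b2 y)%:E))%E).
    apply: nnintegral_le => //.
    + by apply: measurableI; exact: measurableC.
    + exact: emeasurable_funD.
    + by move=> y _; rewrite -EFinD lee_fin; exact: (sqfunD s theta phib phiL).
  rewrite nnintegral_add//; last by apply: measurableI; exact: measurableC.
  rewrite iuE ge0_muleDr//; apply: leeD.
    apply: le_trans ib1; apply: nnintegral_subset => //; first exact: measurableC.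
    by apply: measurableI; exact: measurableC.
  apply: le_trans ib2; apply: nnintegral_subset => //; first exact: measurableC.
  by apply: measurableI; exact: measurableC.
Qed.

Let mlevel u (t : R) : measurable [set z | t < V u z].
Proof. by apply: measurable_superlevel; exact: (measurable_sqfun s phi thetaL). Qed.

(** The constant is 2 + 3 + (8 kap + 2). The good part gives 2 by Chebyshev in L^2 with |g| <= 2
    lam, the exceptional set 3, and the bad part off that set the remainder by Chebyshev in L^1. *)
Lemma sqfun_weak_type u lam n x : let l := 2 ^+ n * h in
  admissible u -> 0 < lam ->
  (\int[mu]_(y in ival x l) (`|u y|)%:E <= (lam * l)%:E)%E ->
  (mu [set z | (2 * lam < V (fun y => u y * \1_(ival x l) y) z)%R] <=
    ((8 * kap + 7) / lam)%:E * \int[mu]_(y in ival x l) (`|u y|)%:E)%E.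
Proof.
have kap_ge0 : 0 <= kap := kap0.
move=> l au lam0 ul.
have [g [b [Ex [[ag ab mO gb] [gM gQ ig muO ib]]]]] := cz_decomposition au lam0 ul.
set I := (\int[mu]_(y in ival x l) (`|u y|)%:E)%E in ig muO ib *.
have I0 : (0 <= I)%E by exact: integral_ge0.
pose Eg := [set z | lam < V g z].
pose Eb := ~` Ex `&` [set z | lam < V b z].
have mEg : measurable Eg by exact: mlevel.
have mOC : measurable (~` Ex) by exact: measurableC.
have mEb : measurable Eb by apply: measurableI => //; exact: mlevel.
have -> : (fun y => u y * \1_(ival x l) y) = (fun y => g y + b y) by apply/funext.
apply: (@le_trans _ _ (mu (Eg `|` (Ex `|` Eb)))).
  apply: le_measure; rewrite ?inE.
  - exact: mlevel.
  - by apply: measurableU => //; exact: measurableU.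
  move=> z /= hz; have := sqfunD s theta phib phiL z ag ab => hs.
  have [gz|gz] := ltP lam (V g z); first by left.
  right; have [Oz|Oz] := pselect (Ex z); [by left|right; split => //=].
  lra.
apply: (@le_trans _ _ (mu Eg + (mu Ex + mu Eb))%E).
  apply: (@le_trans _ _ (mu Eg + mu (Ex `|` Eb))%E).
    by apply: measureU2 => //; exact: measurableU.
  by apply: leeD => //; exact: measureU2.
have muEg : (mu Eg <= (2 / lam)%:E * I)%E.
  have : ((lam ^+ 2)%:E * mu Eg <= (2 * lam)%:E * I)%E.
    apply: (@le_trans _ _ (\int[mu]_z (V g z ^+ 2)%:E)%E).
      rewrite -integral_cst//; apply: (@le_trans _ _ (\int[mu]_(z in Eg) (V g z ^+ 2)%:E)%E).
        apply: ge0_le_integral => //.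
        - by move=> z _; rewrite lee_fin sqr_ge0.
        - apply/measurable_EFinP/measurable_funTS/measurable_funX.
          exact: (measurable_sqfun s phi thetaL).
        - move=> z /= /ltW lz; rewrite lee_fin lerXn2r ?nnegrE ?sqfun_ge0//.
          exact: ltW.
      apply: nnintegral_subset => //.
      - by apply/measurable_EFinP/measurable_funX; exact: (measurable_sqfun s phi thetaL).
      - by move=> z; rewrite lee_fin sqr_ge0.
    apply: le_trans (bessel ag) _.
    apply: (@le_trans _ _ (\int[mu]_z ((2 * lam)%:E * (`|g z|)%:E))%E).
      apply: nnintegral_le => //.
      - by apply/measurable_EFinP/measurable_funX; case: ag.
      - by apply: measurable_funeM; exact: admissible_measurable_abs.
      - by move=> z; rewrite lee_fin sqr_ge0.
      - move=> z _; rewrite -EFinM lee_fin -real_normK ?num_real// expr2.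
        by rewrite ler_wpM2r.
    rewrite nnintegral_scale//; [|exact: admissible_measurable_abs|lra].
    by apply: lee_wpmul2l => //; rewrite lee_fin; lra.
  have c0 : (0 <= (lam ^- 2)%:E :> \bar R)%E by rewrite lee_fin invr_ge0 sqr_ge0.
  move=> /(lee_wpmul2l c0); rewrite !muleA -!EFinM mulVf ?mul1e; last by rewrite gt_eqF// exprn_gt0.
  by move/le_trans; apply; rewrite (_ : _ * _ = 2 / lam)//; field; rewrite gt_eqF.
have muEb : (mu Eb <= ((8 * kap + 2) / lam)%:E * I)%E.
  have : (lam%:E * mu Eb <= (8 * kap + 2)%:E * I)%E.
    apply: le_trans ib; rewrite -integral_cst//.
    apply: (@le_trans _ _ (\int[mu]_(z in Eb) (V b z)%:E)%E).
      apply: ge0_le_integral => //.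
      - by move=> z _; rewrite lee_fin ltW.
      - by apply: measurable_funTS; exact: mVE.
      - by move=> z [_ /= /ltW lz]; rewrite lee_fin.
    by apply: nnintegral_subset => // z [].
  have c0 : (0 <= (lam^-1)%:E :> \bar R)%E by rewrite lee_fin invr_ge0 ltW.
  move=> /(lee_wpmul2l c0); rewrite !muleA -!EFinM mulVf ?mul1e; last by rewrite gt_eqF.
  by move/le_trans; apply; rewrite mulrC.
have a0 : 0 <= 2 / lam by rewrite divr_ge0// ltW.
have b0 : 0 <= 3 / lam by rewrite divr_ge0// ltW.
have c0 : 0 <= (8 * kap + 2) / lam by apply: divr_ge0; [lra|exact: ltW].
rewrite (_ : (8 * kap + 7) / lam = 2 / lam + (3 / lam + (8 * kap + 2) / lam)); last by ring.
rewrite !EFinD !ge0_muleDl ?adde_ge0 ?lee_fin//; apply: leeD => //; exact: leeD.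
Qed.

End scale.

Lemma sqfun_diff u v x : admissible u -> admissible v ->
  `|V (fun y => u y + v y) x - V u x| <= V v x.
Proof.
move=> au av; have h1 := sqfunD s theta phib phiL x au av.
have h2 : V u x <= V (fun y => u y + v y) x + V v x.
  have -> : V v x = l2 s (fun i => - (coef phi v i * theta i x)).
    by rewrite /sqfun /l2; congr Num.sqrt; apply: eq_bigr => i _; rewrite sqrrN.
  apply: le_trans (l2D _ _ _); rewrite /sqfun le_eqVlt; apply/orP; left; apply/eqP; congr l2.
  by apply/funext => i; rewrite (wcoefD phib phiL)// mulrDl addrK.
by rewrite ler_norml; apply/andP; split; lra.
Qed.

Definition far u x l : R -> R := fun y => u y * \1_(~` ival (x - l) (3 * l)) y.

Lemma admissible_far u x l : admissible u -> admissible (far u x l).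
Proof.
by move=> au; apply: admissible_indic => //; apply: measurableC; exact: measurable_ival.
Qed.

Definition averages_le (u : R -> R) x l m := forall a b, a <= x -> x + l <= b ->
  (\int[mu]_(y in `[a, b]) (`|u y|)%:E <= (m * (b - a))%:E)%E.

(** Here the smoothness [K1] in the output variable is used, between z and the centre. The mass of
    [u] on each interval around the centre is governed by [m], so the annuli give 8 m times kap /
    2. *)
Lemma sqfun_far_le u x l m z : admissible u -> 0 < l -> 0 <= m ->
  averages_le u x l m -> ival x l z ->
  `|V (far u x l) z - V (far u x l) (x + l / 2)| <= 4 * kap * m.
Proof.
have kap_ge0 : 0 <= kap := kap0.
move=> au l0 m0 um Qz; set c := x + l / 2.
have mu' : measurable_fun setT u by case: au.
have zc : `|c - z| <= l / 2.
  by move: Qz; rewrite /ival/= in_itv/= /c ler_norml => /andP[? ?]; apply/andP; split; lra.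
apply: le_trans (sqfun_dist _ _ _ _ _ _) _.
rewrite -lee_fin.
apply: le_trans (coef_l1_le s phib phiL (c := fun=> 0) (admissible_far x l au) _ _) _ => //.
  by move=> i; rewrite mul0r.
pose w y := \sum_(i <- s) `|theta i c - theta i z| * `|phi i y|.
have w0 y : 0 <= w y by rewrite sumr_ge0// => i _; rewrite mulr_ge0.
have mw : measurable_fun setT w.
  apply: measurable_sum => i; apply: measurable_funM => //.
  by apply: measurableT_comp => //; exact: (measurable_phi phiL).
apply: (@le_trans _ _ (\int[mu]_(y in [set y | l <= `|y - c|]%R) (`|u y| * w y)%:E)%E).
  rewrite [leRHS]integral_mkcond; apply: ge0_le_integral => //.
  - by move=> y _; rewrite lee_fin mulr_ge0// sumr_ge0// => i _; rewrite mulr_ge0.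
  - apply/measurable_EFinP; apply: measurable_funM.
      by apply: measurableT_comp => //; case: (admissible_far x l au).
    apply: measurable_sum => i; apply: measurable_funM => //.
    by apply: measurableT_comp => //; apply: measurable_funB => //; exact: (measurable_phi phiL).
  - apply/(measurable_restrictT _ _).1; first exact: measurable_outer.
    apply: measurable_funTS; apply/measurable_EFinP; apply: measurable_funM => //.
    exact: measurableT_comp.
  move=> y _; rewrite patchE; case: ifPn => [_|]; last first.
    rewrite notin_setE /= => /negP; rewrite -ltNge => yc.
    rewrite /far indicE memNset ?mulr0 ?normr0 ?mul0r//= => /=; apply.
    move: yc; rewrite /ival/= in_itv/= /c ltr_norml => /andP[? ?]; apply/andP; split; lra.
  rewrite lee_fin ler_pM//.
  - by rewrite sumr_ge0// => i _; rewrite mulr_ge0.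
  - rewrite /far normrM ler_piMr// ger0_norm// indicE; by case: (_ \in _).
  - rewrite /w le_eqVlt; apply/orP; left; apply/eqP; apply: eq_bigr => i _.
    by rewrite subr0 mulrC distrC.
have k20 : 0 <= kap / 2 by lra.
rewrite (_ : 4 * kap * m = kap / 2 * (8 * m)); last by field.
apply: integral_annuli_le => //.
- exact: measurableT_comp.
- move=> y ly.
  have yc : c != y by apply: contraTneq ly => ->; rewrite subrr normr0 -ltNge.
  apply: le_trans (K1 yc _) _; first by rewrite [`|c - y|]distrC; lra.
  rewrite -(sqrrN (c - y)) opprB.
  have d0 : 0 <= (y - c) ^- 2 by rewrite invr_ge0 sqr_ge0.
  rewrite (_ : kap / 2 * _ = kap * (l / 2 * (y - c) ^- 2)); last by move: d0; set d := _ ^- 2 => _; field.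
  by apply: ler_wpM2l => //; apply: ler_wpM2r.
- move=> r lr; apply: le_trans (um _ _ _ _) _; rewrite /c ?lee_fin; lra.
Qed.

(** 4 kap comes from the far part. With lam = 72 (8 kap + 7) m, the near part is cut into three
    pieces, each giving 2 lam. The 72 is 3 times 24: the mass on the triple is at most 3 m l, and
    three exceptional sets of measure l/24 make up l/8. *)
Definition cz_const := 4 * kap + 6 * (72 * (8 * kap + 7)).

Lemma local_good h u m n x : let l := 2 ^+ n * h in
  0 < h -> h * \sum_(i <- s) L i ^+ 2 <= 1 -> admissible u -> 0 < m ->
  averages_le u x l m ->
  (mu (ival x l `&` [set z | cz_const * m < `|V u z - V (far u x l) (x + l / 2)|]%R)
     <= (l / 8)%:E)%E.
Proof.
have kap_ge0 : 0 <= kap := kap0.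
move=> l h0 hL au m0 um.
have l0 : 0 < l by rewrite mulr_gt0// exprn_gt0.
pose lam := 72 * (8 * kap + 7) * m.
have lam0 : 0 < lam by rewrite mulr_gt0//; lra.
pose p y := fun z => u z * \1_(ival y l) z.
have ap y : admissible (p y) by apply: admissible_indic => //; exact: measurable_ival.
pose E y := [set z | 2 * lam < V (p y) z].
have mE y : measurable (E y).
  by apply: measurable_superlevel; exact: (measurable_sqfun s phi thetaL).
have muE y : x - l <= y -> y + l <= x + 2 * l -> (mu (E y) <= (l / 24)%:E)%E.
  move=> xy yl.
  have uy : (\int[mu]_(t in ival y l) (`|u t|)%:E <= (3 * m * l)%:E)%E.
    apply: (@le_trans _ _ (\int[mu]_(t in `[(x - l)%R, (x + 2 * l)%R]) (`|u t|)%:E)%E).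
      apply: nnintegral_subset => //; first exact: admissible_measurable_abs.
      move=> t; rewrite /ival/= !in_itv/= => /andP[? ?]; apply/andP; split; lra.
    apply: le_trans (um _ _ _ _) _; rewrite ?lee_fin; lra.
  apply: le_trans (sqfun_weak_type h0 hL au lam0 _) _.
    apply: le_trans uy _; rewrite lee_fin -/l /lam; apply: ler_wpM2r; first exact: ltW.
    apply: ler_wpM2r; [exact: ltW|lra].
  apply: le_trans (lee_wpmul2l _ uy) _.
    by rewrite lee_fin; apply: divr_ge0; [lra|exact: ltW].
  rewrite -EFinM lee_fin /lam le_eqVlt; apply/orP; left; apply/eqP; field.
  by apply/andP; split; rewrite gt_eqF//; lra.
have uE : u = (fun y => far u x l y + (p (x - l) y + (p x y + p (x + l) y))).
  apply/funext => z; rewrite /far /p -!mulrDr -[LHS]mulr1; congr (_ * _).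
  rewrite !indicE.
  have -> : (z \in ~` ival (x - l) (3 * l)) = ~~ ((x - l <= z) && (z < x + 2 * l)).
    rewrite in_setC; congr (~~ _).
    by apply/idP/idP; rewrite inE /ival/= in_itv/= (_ : x - l + 3 * l = x + 2 * l)//; ring.
  have e y : (z \in ival y l) = (y <= z) && (z < y + l).
    by apply/idP/idP; rewrite inE /ival/= in_itv/=.
  rewrite !e subrK.
  case: (leP (x - l) z); case: (ltP z (x + 2 * l)); case: (ltP z x); case: (ltP z (x + l + l)); case: (ltP z (x + l)) => /= *; rewrite ?addr0 ?add0r//; exfalso; lra.
apply: (@le_trans _ _ (mu (E (x - l) `|` (E x `|` E (x + l))))).
  apply: le_measure; rewrite ?inE.
  - apply: measurableI; first exact: measurable_ival.
    apply: measurable_superlevel; apply: measurableT_comp => //.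
    by apply: measurable_funB => //; exact: (measurable_sqfun s phi thetaL).
  - by apply: measurableU; [exact: mE|apply: measurableU; exact: mE].
  move=> z [Qz /= big].
  have [e1|e1] := ltP (2 * lam) (V (p (x - l)) z); first by left.
  have [e2|e2] := ltP (2 * lam) (V (p x) z); first by right; left.
  have [e3|e3] := ltP (2 * lam) (V (p (x + l)) z); first by right; right.
  exfalso; move: big; apply/negP; rewrite -leNgt.
  have a23 := admissibleD (ap x) (ap (x + l)).
  have a123 := admissibleD (ap (x - l)) a23.
  have h1 := sqfunD s theta phib phiL z (ap (x - l)) a23.
  have h2 := sqfunD s theta phib phiL z (ap x) (ap (x + l)).
  have h3 := sqfun_diff z (admissible_far x l au) a123.
  rewrite -uE in h3.
  have h4 := sqfun_far_le au l0 (ltW m0) um Qz.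
  have -> : V u z - V (far u x l) (x + l / 2) = (V u z - V (far u x l) z) +
     (V (far u x l) z - V (far u x l) (x + l / 2)) by ring.
  apply: le_trans (ler_normD _ _) _.
  have -> : cz_const * m = 6 * lam + 4 * kap * m by rewrite /cz_const /lam; ring.
  lra.
apply: (@le_trans _ _ (mu (E (x - l)%R) + (mu (E x) + mu (E (x + l)%R)))%E).
  apply: (@le_trans _ _ (mu (E (x - l)%R) + mu (E x `|` E (x + l)%R))%E).
    by apply: measureU2; [exact: mE|apply: measurableU; exact: mE].
  by apply: leeD => //; apply: measureU2; exact: mE.
apply: (@le_trans _ _ ((l / 24)%:E + ((l / 24)%:E + (l / 24)%:E))%E).
  by apply: leeD; [|apply: leeD]; apply: muE; lra.
by rewrite -!EFinD lee_fin; lra.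
Qed.

Let A := cz_const.

Let A1 : 1 <= A.
Proof. by have k0 : 0 <= kap := kap0; rewrite /A /cz_const; lra. Qed.

Let A0 : 0 < A.
Proof. exact: lt_le_trans A1. Qed.

Definition averages (u : R -> R) x l : set R :=
  [set r | exists a b, [/\ a <= x, x + l <= b & r = (b - a)^-1 * fine (\int[mu]_(y in `[a, b]) (`|u y|)%:E)]].

(** A real number that bounds the averages over all intervals around [x, x + l], grows when the
    interval shrinks, and stays below the maximal function at each of its points: exactly the
    requirements on [a] in the sparse argument. *)
Definition maxavg u x l := sup (averages u x l).

Lemma averages_ub u x l : admissible u -> 0 < l -> exists M, forall r, averages u x l r -> 0 <= r <= M.
Proof.
move=> au l0; have [mu' [M uM] _] := au.
have M0 : 0 <= M by exact: le_trans (uM 0).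
exists M => _ [a [b [ax xb ->]]].
have ab : a < b by lra.
have ba : 0 < b - a by lra.
have Iab : (\int[mu]_(y in `[a, b]) (`|u y|)%:E <= (M * (b - a))%:E)%E.
  apply: (@le_trans _ _ (\int[mu]_(y in `[a, b]) (cst M%:E) y)%E).
    by apply: nnintegral_le => //; [exact: admissible_measurable_abs|move=> y _; rewrite lee_fin].
  by rewrite integral_cst//= lebesgue_measure_itv/= lte_fin ab -EFinD EFinM.
rewrite mulr_ge0 ?invr_ge0 ?(ltW ba) ?fine_ge0//=; last exact: integral_ge0.
rewrite ler_pdivrMl// mulrC -lee_fin fineK//; exact: admissible_fin.
Qed.

Lemma averages_nonempty u x l : averages u x l !=set0.
Proof. by exists ((x + l - x)^-1 * fine (\int[mu]_(y in `[x, (x + l)%R]) (`|u y|)%:E)); exists x, (x + l). Qed.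

Lemma averages_has_sup u x l : admissible u -> 0 < l -> has_sup (averages u x l).
Proof.
move=> au l0; split; first exact: averages_nonempty.
by have [M hM] := averages_ub x au l0; exists M => r /hM /andP[].
Qed.

Lemma maxavg_ge u x l a b : admissible u -> 0 < l -> a <= x -> x + l <= b ->
  (b - a)^-1 * fine (\int[mu]_(y in `[a, b]) (`|u y|)%:E) <= maxavg u x l.
Proof.
move=> au l0 ax xb; apply: ub_le_sup; first exact: (averages_has_sup x au l0).2.
by exists a, b.
Qed.

Lemma maxavg_averages_le u x l : admissible u -> 0 < l -> averages_le u x l (maxavg u x l).
Proof.
move=> au l0 a b ax xb; have ba : 0 < b - a by lra.
have := maxavg_ge au l0 ax xb; rewrite ler_pdivrMl// => h.
by rewrite -(fineK (admissible_fin au (measurable_itv `[a, b]))) lee_fin mulrC.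
Qed.

Lemma maxavg_mono u x l x' l' : admissible u -> x <= x' -> x' + l' <= x + l -> 0 < l' ->
  maxavg u x l <= maxavg u x' l'.
Proof.
move=> au xx xl l'0; have l0 : 0 < l by lra.
apply: ge_sup; first exact: averages_nonempty.
by move=> _ [a [b [ax xb ->]]]; apply: maxavg_ge => //; lra.
Qed.

Lemma maxavg_le (N : R -> \bar R) u x l z : admissible u -> 0 < l ->
  (forall a b y, a < b -> a <= y <= b ->
     ((b - a)^-1%:E * \int[mu]_(t in `[a, b]) (`|u t|)%:E <= N y)%E) ->
  ival x l z -> ((maxavg u x l)%:E <= N z)%E.
Proof.
move=> au l0 uN Qz.
have key r : averages u x l r -> (r%:E <= N z)%E.
  move=> [a [b [ax xb ->]]]; have ab : a < b by lra.
  rewrite EFinM fineK; last exact: admissible_fin.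
  apply: uN => //; move: Qz; rewrite /ival/= in_itv/= => /andP[h1 h2]; apply/andP; split; lra.
have [r0 hr0] := averages_nonempty u x l.
move: key; case: (N z) => [r| |] key.
- rewrite lee_fin; apply: ge_sup; first by exists r0.
  by move=> t /key; rewrite lee_fin.
- by rewrite leey.
- by have := key _ hr0.
Qed.

Lemma exp2_unbounded (X : R) : exists n : nat, X <= 2 ^+ n.
Proof.
exists (Num.truncn X).+1; apply: ltW; apply: lt_le_trans (truncnS_gt X) _.
by rewrite -natrX ler_nat ltnW// ltn_expl.
Qed.

Lemma far_eq0 (u : R -> R) x l : (forall y, u y != 0 -> x - l <= y < x + 2 * l) -> far u x l = cst 0.
Proof.
move=> hu; apply/funext => y; rewrite /far indicE.
have [->|/hu/andP[h1 h2]] := eqVneq (u y) 0; first by rewrite mul0r.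
rewrite memNset ?mulr0// => /=; apply; rewrite /ival/= in_itv/=; apply/andP; split; lra.
Qed.

Lemma coef_cst0 i : coef phi (cst 0) i = 0.
Proof.
rewrite /coef (_ : (fun x => _) = cst 0); last by apply/funext => x; rewrite mul0r.
by rewrite /Rintegral integral0.
Qed.

Section fixed.
Variables (u : R -> R) (g N G : R -> \bar R).
Hypothesis au : admissible u.
Hypothesis mg : measurable_fun setT g.
Hypothesis mN : measurable_fun setT N.
Hypothesis mG : measurable_fun setT G.
Hypothesis g0 : forall z, (0 <= g z)%E.
Hypothesis N0 : forall z, (0 <= N z)%E.
Hypothesis G0 : forall z, (0 <= G z)%E.
Hypothesis uN : forall a b y, a < b -> a <= y <= b ->
  ((b - a)^-1%:E * \int[mu]_(t in `[a, b]) (`|u t|)%:E <= N y)%E.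
Hypothesis gG : forall a b y, a < b -> a <= y <= b ->
  ((b - a)^-1%:E * \int[mu]_(t in `[a, b]) g t <= G y)%E.

Let mV : measurable_fun setT (fun z => (V u z)%:E).
Proof. by apply/measurable_EFinP; exact: (measurable_sqfun s phi thetaL). Qed.

(** An instance of [sparse_claim] in which [a] is [maxavg] times [cz_const] and [c] is the value at
    the centre of the square function of the far part. *)
Lemma sqfun_dual_le_ival x0 l0 : 0 < l0 ->
  (forall y, u y != 0 -> x0 - l0 <= y < x0 + 2 * l0) ->
  (0 < \int[mu]_y (`|u y|)%:E)%E ->
  (\int[mu]_(z in ival x0 l0) ((V u z)%:E * g z) <=
    (8 * A)%:E * \int[mu]_(z in ival x0 l0) (N z * G z))%E.
Proof.
have Ap : 0 < A := A0; have A1' : 1 <= A := A1.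
move=> l00 usupp Ipos.
pose P := fine (\int[mu]_(y in `[x0 - l0, x0 + 2 * l0]) (`|u y|)%:E).
have P0 : 0 < P.
  rewrite fine_gt0//; apply/andP; split; last first.
    by rewrite -ge0_fin_numE ?integral_ge0//; exact: admissible_fin.
  apply: lt_le_trans Ipos _; rewrite [leRHS]integral_mkcond.
  rewrite le_eqVlt; apply/orP; left; apply/eqP; apply: eq_integral => y _.
  rewrite patchE; case: ifPn => //; rewrite notin_setE /= in_itv/= => yQ.
  have [->|/usupp/andP[h1 h2]] := eqVneq (u y) 0; first by rewrite normr0.
  by exfalso; apply: yQ; apply/andP; split; lra.
pose LF := \sum_(i <- s) `|coef phi u i| * L i.
have LF0 : 0 <= LF by apply: sumr_ge0 => i _; exact: mulr_ge0.
have SL0 : 0 <= \sum_(i <- s) L i ^+ 2 by exact: sum_sqr_ge0.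
pose m0 := (3 * l0)^-1 * P.
have m00 : 0 < m0 by rewrite mulr_gt0// invr_gt0; lra.
(* The finest scale has two duties: to satisfy the smallness condition of the weak type estimate,
   and to keep the oscillation [LF * h] below [A * m0]. The average [m0] over the triple of the top
   interval is a lower bound for [maxavg] on all its subintervals. *)
have [n hn] := exp2_unbounded (Num.max (l0 * \sum_(i <- s) L i ^+ 2) (LF * l0 / (A * m0))).
have p2 : 0 < 2 ^+ n :> R by rewrite exprn_gt0.
pose h := l0 / 2 ^+ n.
have h0 : 0 < h by rewrite divr_gt0.
have l0E : 2 ^+ n * h = l0 by rewrite mulrC divfK// gt_eqF.
have hL : h * \sum_(i <- s) L i ^+ 2 <= 1.
  by rewrite /h mulrAC ler_pdivrMr// mul1r; apply: le_trans hn; rewrite le_max lexx.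
have Am0 : 0 < A * m0 by exact: mulr_gt0.
have hF : LF * h <= A * m0.
  rewrite /h mulrA ler_pdivrMr// [leRHS]mulrC -ler_pdivrMr//.
  by apply: le_trans hn; rewrite le_max lexx orbT.
pose a x l := A * maxavg u x l.
pose c x l := V (far u x l) (x + l / 2).
have e0 : 0 <= LF * h by rewrite mulr_ge0// ltW.
have mpos x l : 0 < l -> 0 < maxavg u x l.
  move=> l_0; pose a' := Num.min x (x0 - l0); pose b' := Num.max (x + l) (x0 + 2 * l0).
  have ax : a' <= x by rewrite ge_min lexx.
  have ax' : a' <= x0 - l0 by rewrite ge_min lexx orbT.
  have xb : x + l <= b' by rewrite le_max lexx.
  have xb' : x0 + 2 * l0 <= b' by rewrite le_max lexx orbT.
  apply: lt_le_trans (maxavg_ge au l_0 ax xb).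
  rewrite mulr_gt0 ?invr_gt0//; first lra.
  apply: lt_le_trans P0 _; rewrite fine_le ?admissible_fin//.
  apply: nnintegral_subset => //; first exact: admissible_measurable_abs.
  by apply: subset_itv; rewrite bnd_simp.
have ea x l : x0 <= x -> x + l <= x0 + l0 -> 0 < l -> LF * h <= a x l.
  move=> xx xl l_0; apply: le_trans hF _; rewrite /a ler_pM2l//.
  have := @maxavg_ge u x l (x0 - l0) (x0 + 2 * l0) au l_0.
  rewrite (_ : x0 + 2 * l0 - (x0 - l0) = 3 * l0); last by ring.
  by apply; lra.
have amono x l x' l' : x <= x' -> x' + l' <= x + l -> 0 < l' -> a x l <= a x' l'.
  by move=> *; rewrite /a ler_pM2l//; exact: maxavg_mono.
have mAN : measurable_fun setT (fun z => A%:E * N z)%E by exact: measurable_funeM.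
have AN0 z : (0 <= A%:E * N z)%E by rewrite mule_ge0// lee_fin ltW.
have aN x l z : 0 < l -> ival x l z -> ((a x l)%:E <= A%:E * N z)%E.
  move=> l_0 Qz; rewrite /a EFinM lee_pmul2l//.
  exact: maxavg_le uN Qz.
have gG' x l z : 0 < l -> ival x l z -> (\int[mu]_(t in ival x l) g t <= l%:E * G z)%E.
  move=> l_0; rewrite /ival/= in_itv/= => /andP[xz zl].
  have xl : x < x + l by rewrite ltrDl.
  have xzl : x <= z <= x + l by rewrite xz ltW.
  have := gG xl xzl; rewrite addrAC subrr add0r.
  rewrite lee_pdivrMl// => h1; apply: le_trans h1.
  by apply: nnintegral_subset => //; apply: subset_itvl; rewrite bnd_simp.
have Fosc x z z' : ival x h z -> ival x h z' -> V u z <= V u z' + LF * h.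
  rewrite /ival/= !in_itv/= => /andP[z1 z2] /andP[z3 z4].
  have := sqfun_lipschitz s phi thetaL u z z'; rewrite -/LF => H.
  have : LF * `|z - z'| <= LF * h by rewrite ler_wpM2l// ler_norml; apply/andP; split; lra.
  by have := le_trans (ler_norm _) H; lra.
have Fbad k x : let l := 2 ^+ k * h in
  (mu (ival x l `&` [set z | a x l < `|V u z - c x l|]%R) <= (l / 8)%:E)%E.
  move=> l; have l_0 : 0 < l by rewrite mulr_gt0// exprn_gt0.
  apply: (local_good h0 hL au (mpos x l l_0)).
  exact: maxavg_averages_le.
have xl0 : x0 + 2 ^+ n * h <= x0 + l0 by rewrite l0E.
have := sparse_claim h0 (measurable_sqfun s phi thetaL u) mg mAN mG g0 AN0 G0 e0 ea amono aN gG' Fosc Fbad (lexx x0) xl0.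
rewrite /= l0E => H.
(* The support of [u] lies in the triple of the top interval, so its far part vanishes and the
   constant to subtract is 0. *)
have c0 z : Num.max (V u z - c x0 l0) 0 = V u z.
  by rewrite /c far_eq0// (sqfun0 s theta0 _ coef_cst0) subr0 max_l// sqfun_ge0.
move: H; under eq_integral do rewrite c0.
have mNG : measurable_fun setT (fun z => N z * G z)%E by exact: emeasurable_funM.
have NG0 z : (0 <= N z * G z)%E by rewrite mule_ge0.
under [X in (_ <= _ * X)%E -> _]eq_integral do rewrite -muleA.
rewrite (nnintegral_scale (measurable_ival x0 l0) mNG NG0 (ltW Ap)) muleA -EFinM.
apply: le_trans; rewrite leeDl// mule_ge0 ?integral_ge0// lee_fin mulr_ge0// mulr_ge0// ?(ltW Ap)//.
by apply/ltW/mpos.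
Qed.

Lemma sqfun_dual_le :
  (\int[mu]_z ((V u z)%:E * g z) <= (8 * A)%:E * \int[mu]_z (N z * G z))%E.
Proof.
have Ap : 0 < A := A0.
have mVg : measurable_fun setT (fun z => (V u z)%:E * g z)%E by exact: emeasurable_funM.
have Vg0 z : (0 <= (V u z)%:E * g z)%E by rewrite mule_ge0// lee_fin sqfun_ge0.
have mNG : measurable_fun setT (fun z => N z * G z)%E by exact: emeasurable_funM.
have NG0 z : (0 <= N z * G z)%E by rewrite mule_ge0.
have A80 : 0 <= 8 * A by lra.
(* The case of a null [u] is separated because the levels of the weak type estimate must be
   positive. *)
have [I0|I0] := leP (\int[mu]_y (`|u y|)%:E)%E 0%E.
  have c0 i : coef phi u i = 0.
    apply/normr0_eq0/eqP; rewrite eq_le normr_ge0 andbT -lee_fin /coef.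
    rewrite EFin_normr_Rintegral//; last exact/admissible_integrable/(admissible_phi phib phiL).
    have aup := admissible_phi phib phiL i au.
    apply: le_trans (le_abse_integral _ _ _) _ => //.
      by apply/measurable_EFinP; case: aup.
    apply: (@le_trans _ _ (\int[mu]_y ((L i)%:E * (`|u y|)%:E))%E).
      apply: nnintegral_le => //.
      - by apply: measurableT_comp => //; apply/measurable_EFinP; case: aup.
      - by apply: measurable_funeM; exact: admissible_measurable_abs.
      by move=> y _; rewrite abse_EFin normrM -EFinM lee_fin mulrC ler_wpM2r.
    rewrite nnintegral_scale//; last exact: admissible_measurable_abs.
    by apply: mule_ge0_le0; rewrite ?lee_fin.
  rewrite integral0_eq; last by move=> z _; rewrite (sqfun0 s theta0 _ c0) mul0e.
  by rewrite mule_ge0 ?integral_ge0// lee_fin.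
have [_ _ [r hr]] := au.
pose J k : set R := ival (- k%:R) (2 * k%:R).
have mJ k : measurable (J k) by exact: measurable_ival.
have JT : \bigcup_k J k = setT.
  apply/seteqP; split => // z _; exists (Num.truncn `|z|).+1 => //.
  have := truncnS_gt `|z|; set q : R := _%:R; rewrite ltr_norml /J /ival/= in_itv/= -/q => /andP[? ?]; apply/andP; split; lra.
have ndJ : {homo J : n m / (n <= m)%N >-> (n <= m)%O}.
  move=> n m nm; apply/subsetPset; apply: ivalS.
    by rewrite lerN2 ler_nat.
  have : n%:R <= m%:R :> R by rewrite ler_nat.
  lra.
have cv := ge0_nondecreasing_set_cvg_integral (mu := mu) ndJ mJ
  (fun i => measurable_funTS mVg) (fun i x _ => Vg0 x).
rewrite JT in cv.
rewrite -(cvg_lim _ cv)//; apply: lime_le; first by apply/cvg_ex; eexists; exact: cv.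
exists (Num.truncn `|r|).+1 => // k /= rk.
have kr : r < k%:R.
  apply: le_lt_trans (ler_norm r) _; apply: lt_le_trans (truncnS_gt _) _.
  by rewrite ler_nat.
have k0 : 0 < k%:R :> R by rewrite ltr0n; exact: leq_trans rk.
have usupp y : u y != 0 -> - k%:R <= y < k%:R.
  move=> uy; have : `|y| <= r by rewrite leNgt; apply/negP => /hr u0; rewrite u0 eqxx in uy.
  by rewrite ler_norml => /andP[? ?]; apply/andP; split; lra.
have half (q : R) : 2 * q / 2 = q by field.
have k20 : 0 < 2 * k%:R :> R by lra.
(* The triple of each half of [J k] contains [-k, k), hence the support of [u]. *)
rewrite /J integral_ival_half// half addNr.
apply: (@le_trans _ _ ((8 * A)%:E * \int[mu]_(z in ival (- k%:R)%R (2 * k%:R)%R) (N z * G z))%E); last first.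
  by apply: lee_wpmul2l; [rewrite lee_fin|apply: nnintegral_subset => //; exact: measurable_ival].
rewrite [X in (_ <= _ * X)%E]integral_ival_half// half addNr ge0_muleDr ?integral_ge0//.
by apply: leeD; apply: sqfun_dual_le_ival => // y /usupp /andP[? ?]; apply/andP; split; lra.
Qed.

End fixed.

End calderon_zygmund.

(** * The wavelet system *)

Section wavelet_slope.
Set Implicit Arguments.
Unset Strict Implicit.
Context {R : realType}.
Local Notation mu := (@lebesgue_measure R).

Lemma ae_impl (P Q : R -> Prop) : (forall x, P x -> Q x) ->
  {ae mu, forall x, P x} -> {ae mu, forall x, Q x}.
Proof.
move=> PQ [M [mM M0 PM]]; exists M; split => // x nQ; apply: PM => Px.
by apply: nQ; exact: PQ.
Qed.

Lemma ae_exists_itv (P : R -> Prop) (a b : R) : {ae mu, forall x, P x} -> a < b ->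
  exists2 x, a < x < b & P x.
Proof.
move=> [M [mM M0 PM]] ab; apply: contrapT => nP.
have sub : `]a, b[%classic `<=` M.
  by move=> x /=; rewrite in_itv/= => xab; apply: PM => Px; apply: nP; exists x.
have : (mu `]a, b[%classic <= 0)%E.
  by rewrite -M0; apply: le_measure => //; rewrite inE//; exact: measurable_itv.
by rewrite lebesgue_measure_itv/= lte_fin ab -EFinD lee_fin subr_le0 leNgt ab.
Qed.

(** [W] need not be continuous, so the approximating points are taken farther from the origin than
    x, where monotonicity gives W(|y|) <= W(|x|). *)
Lemma majorant_everywhere (W p : R -> R) :
  (forall s t, 0 <= s -> s <= t -> W t <= W s) -> continuous p ->
  {ae mu, forall x, `|p x| <= W `|x|} -> forall x, `|p x| <= W `|x|.
Proof.
move=> Wdec cp aeW x; apply/ler_addgt0Pr => e e0.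
have /cvgrPdist_le/(_ e e0)[d /= d0 hd] := cp x.
have [y xy Py] : exists2 y, `|x - y| < d /\ `|x| <= `|y| & `|p y| <= W `|y|.
  have [x0|x0] := leP 0 x.
    have xd : x < x + d by rewrite ltrDl.
    have [y /andP[xy yd] Py] := ae_exists_itv aeW xd.
    exists y => //; split.
      by rewrite ltr_norml; apply/andP; split; lra.
    by rewrite !ger0_norm//; lra.
  have xd : x - d < x by rewrite ltrBlDr ltrDl.
  have [y /andP[xy yd] Py] := ae_exists_itv aeW xd.
  exists y => //; split.
    by rewrite ltr_norml; apply/andP; split; lra.
  by rewrite !ltr0_norm//; lra.
have := hd y xy.1 => h1.
have h2 : W `|y| <= W `|x| by apply: Wdec => //; exact: xy.2.
have h3 : `|p x| <= `|p x - p y| + `|p y| by rewrite -[in leLHS](subrK (p y) (p x)) ler_normD.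
lra.
Qed.

Lemma derive1_opp (f : R -> R) x : derivable f x 1 -> derive1 (fun y => - f y) x = - derive1 f x.
Proof. by move=> df; rewrite !derive1E deriveN. Qed.

(** The mean value inequality applied to [f] and to [- f]: on the segment from u to v the modulus is
    at least |u| - |u - v|, so the decreasing [W] bounds the derivative there. *)
Lemma derivable_slope_le (W f : R -> R) :
  (forall s, 0 <= s -> 0 < W s) -> (forall s t, 0 <= s -> s <= t -> W t <= W s) ->
  (forall x, derivable f x 1) -> {ae mu, forall x, `|derive1 f x| <= W `|x|} ->
  forall u v, `|f u - f v| <= `|u - v| * W (Num.max (`|u| - `|u - v|) 0).
Proof.
move=> W0 Wdec df aeW u v.
set m := Num.max _ _; have m0 : 0 <= m by rewrite le_max lexx orbT.
have Wm : 0 <= W m by exact/ltW/W0.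
have seg s a b : a <= s <= b -> (a = u /\ b = v \/ a = v /\ b = u) -> m <= `|s|.
  move=> /andP[as_ sb] ab; rewrite ge_max normr_ge0 andbT lerBlDr.
  have : `|s - u| <= `|u - v|.
    case: ab => -[ea eb]; move: as_ sb; rewrite ea eb => ? ?.
      by rewrite [`|u - v|]distrC !ger0_norm; lra.
    by rewrite [`|s - u|]distrC !ger0_norm; lra.
  have : `|u| <= `|s| + `|s - u| by rewrite -[in leLHS](subKr s u) ler_normB.
  lra.
have key (g : R -> R) a b : a <= b -> (a = u /\ b = v \/ a = v /\ b = u) ->
    (forall x, derivable g x 1) -> (forall x, `|derive1 g x| = `|derive1 f x|) ->
    g b - g a <= W m * (b - a).
  move=> ab abuv dg gf; apply: le_diff_of_ae_derive => //.
  apply: ae_impl aeW => x fx xab.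
  apply: le_trans (ler_norm _) _; rewrite gf; apply: le_trans fx _.
  by apply: Wdec => //; exact: seg xab abuv.
have dN x : derivable (fun y => - f y) x 1 by exact: derivableN.
have Nf x : `|derive1 (fun y => - f y) x| = `|derive1 f x| by rewrite derive1_opp// normrN.
rewrite ler_norml; have [uv|vu] := leP u v.
  have h := key f u v uv (or_introl (conj erefl erefl)) df (fun=> erefl).
  have h' := key _ u v uv (or_introl (conj erefl erefl)) dN Nf.
  by rewrite distrC ger0_norm ?subr_ge0// [_ * W m]mulrC; apply/andP; split; lra.
have h := key f v u (ltW vu) (or_intror (conj erefl erefl)) df (fun=> erefl).
have h' := key _ v u (ltW vu) (or_intror (conj erefl erefl)) dN Nf.
by rewrite ger0_norm ?subr_ge0 ?(ltW vu)// [_ * W m]mulrC; apply/andP; split; lra.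
Qed.

Lemma cabs_Re (z : complex R) : `|complex.Re z| <= cabs z.
Proof. by rewrite /cabs -sqrtr_sqr ler_wsqrtr// lerDl sqr_ge0. Qed.

Lemma cabs_Im (z : complex R) : `|complex.Im z| <= cabs z.
Proof. by rewrite /cabs -sqrtr_sqr ler_wsqrtr// lerDr sqr_ge0. Qed.

Lemma cabsD (z w : complex R) : cabs (z + w) <= cabs z + cabs w.
Proof. case: z w => [a b] [c d]; exact: sqrt_triangle. Qed.

Lemma cabs_sub_le (z w : complex R) :
  `|cabs z - cabs w| <= `|complex.Re z - complex.Re w| + `|complex.Im z - complex.Im w|.
Proof.
have le1 (v : complex R) : cabs v <= `|complex.Re v| + `|complex.Im v|.
  have := sqrt_triangle (complex.Re v) 0 0 (complex.Im v).
  by rewrite addr0 add0r !expr0n/= addr0 add0r !sqrtr_sqr.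
have H (z1 w1 : complex R) : cabs z1 - cabs w1 <=
    `|complex.Re z1 - complex.Re w1| + `|complex.Im z1 - complex.Im w1|.
  rewrite lerBlDr; apply: (@le_trans _ _ (cabs (z1 - w1) + cabs w1)).
    by rewrite -[in leLHS](subrK w1 z1) cabsD.
  by rewrite lerD2r; apply: le_trans (le1 _) _; case: z1 w1 => [a b] [c d].
rewrite ler_norml H andbT lerNl opprB; apply: le_trans (H w z) _.
by rewrite distrC (distrC (complex.Im w)).
Qed.

Variables (psi : R -> complex R) (W : R -> R).
Hypothesis dpsi : cdifferentiable psi.
Hypothesis Wpsi : radial_majorant W psi.
Hypothesis Wdpsi : radial_majorant W (cderiv psi).

Let W0 s : 0 <= s -> 0 < W s. Proof. by case: Wpsi => + _ _ _; apply. Qed.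
Let Wdec s t : 0 <= s -> s <= t -> W t <= W s. Proof. by case: Wpsi => _ _ + _; apply. Qed.

Let cont1 (f : R -> R) : (forall x, derivable f x 1) -> continuous f.
Proof. by move=> df x; apply/differentiable_continuous/derivable1_diffP. Qed.

Lemma psi_majorant x : cabs (psi x) <= W `|x|.
Proof.
have aeP : {ae mu, forall x, `|cabs (psi x)| <= W `|x|}.
  by case: Wpsi => _ _ _; apply: ae_impl => y; rewrite (ger0_norm (cabs_ge0 _)).
have cP : continuous (fun x => cabs (psi x)).
  move=> y; apply: continuous_comp; last exact: sqrt_continuous.
  have c1 : continuous (fun x => complex.Re (psi x)) by apply: cont1 => z; have [] := dpsi z.
  have c2 : continuous (fun x => complex.Im (psi x)) by apply: cont1 => z; have [] := dpsi z.
  apply: cvgD.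
    exact: (continuous_comp (c1 y) (@exprn_continuous R 2 _)).
  exact: (continuous_comp (c2 y) (@exprn_continuous R 2 _)).
by have := majorant_everywhere Wdec cP aeP x; rewrite (ger0_norm (cabs_ge0 _)).
Qed.

Lemma Re_slope u v : `|complex.Re (psi u) - complex.Re (psi v)| <=
  `|u - v| * W (Num.max (`|u| - `|u - v|) 0).
Proof.
apply: (derivable_slope_le W0 Wdec (f := fun x => complex.Re (psi x))).
  by move=> x; have [] := dpsi x.
case: Wdpsi => _ _ _; apply: ae_impl => x; apply: le_trans.
exact: (cabs_Re (cderiv psi x)).
Qed.

Lemma Im_slope u v : `|complex.Im (psi u) - complex.Im (psi v)| <=
  `|u - v| * W (Num.max (`|u| - `|u - v|) 0).
Proof.
apply: (derivable_slope_le W0 Wdec (f := fun x => complex.Im (psi x))).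
  by move=> x; have [] := dpsi x.
case: Wdpsi => _ _ _; apply: ae_impl => x; apply: le_trans.
exact: (cabs_Im (cderiv psi x)).
Qed.

Let Wm0 (u v : R) : 0 <= `|u - v| * W (Num.max (`|u| - `|u - v|) 0).
Proof. by apply: mulr_ge0 => //; apply/ltW/W0; rewrite le_max lexx orbT. Qed.

Lemma dominated_Re : dominated_with_slope W (fun x => complex.Re (psi x)).
Proof.
split=> [u|u v]; first by apply: le_trans (psi_majorant u); exact: cabs_Re.
have := Re_slope u v; have := Wm0 u v; rewrite -mulrA; lra.
Qed.

Lemma dominated_Im : dominated_with_slope W (fun x => complex.Im (psi x)).
Proof.
split=> [u|u v]; first by apply: le_trans (psi_majorant u); exact: cabs_Im.
have := Im_slope u v; have := Wm0 u v; rewrite -mulrA; lra.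
Qed.

Lemma dominated_cabs : dominated_with_slope W (fun x => cabs (psi x)).
Proof.
split=> [u|u v]; first by rewrite ger0_norm ?cabs_ge0//; exact: psi_majorant.
have := cabs_sub_le (psi u) (psi v).
have := Re_slope u v; have := Im_slope u v; rewrite -mulrA; lra.
Qed.

End wavelet_slope.

(** * Bessel's inequality for a real function *)

Section bessel.
Set Implicit Arguments.
Unset Strict Implicit.
Context {R : realType} {J : eqType}.
Local Notation mu := (@lebesgue_measure R).
Local Notation integ f := (mu.-integrable setT (fun z => (f z)%:E)).

Lemma integrable_Rsum (I : Type) (r : seq I) (f : I -> R -> R) : (forall i, integ (f i)) ->
  integ (fun z => \sum_(i <- r) f i z).
Proof.
move=> fi; elim: r => [|i r IH].
  by under eq_fun do rewrite big_nil; exact: integrable0.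
under eq_fun do rewrite big_cons EFinD; exact: integrableD.
Qed.

Lemma RintD (f g : R -> R) : integ f -> integ g ->
  \int[mu]_z (f z + g z) = \int[mu]_z f z + \int[mu]_z g z.
Proof. by move=> fi gi; apply: RintegralD. Qed.

Lemma RintB (f g : R -> R) : integ f -> integ g ->
  \int[mu]_z (f z - g z) = \int[mu]_z f z - \int[mu]_z g z.
Proof. by move=> fi gi; apply: RintegralB. Qed.

Lemma RintZ k (f : R -> R) : integ f -> \int[mu]_z (k * f z) = k * \int[mu]_z f z.
Proof. by move=> fi; apply: RintegralZl. Qed.

Lemma Rintegral_sum (I : Type) (r : seq I) (f : I -> R -> R) : (forall i, integ (f i)) ->
  \int[mu]_z (\sum_(i <- r) f i z) = \sum_(i <- r) \int[mu]_z f i z.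
Proof.
move=> fi; elim: r => [|i r IH].
  under eq_Rintegral do rewrite big_nil.
  by rewrite big_nil /Rintegral integral0.
under eq_Rintegral do rewrite big_cons.
by rewrite big_cons -IH RintD//; exact: integrable_Rsum.
Qed.

Lemma integrableZ k (f : R -> R) : integ f -> integ (fun z => k * f z).
Proof. by move=> fi; under eq_fun do rewrite EFinM; exact: integrableZl. Qed.

Variables (S : seq J) (x y : J -> R -> R) (u : R -> R).
Hypothesis uS : uniq S.
Hypothesis ixx : forall t t', integ (fun z => x t z * x t' z).
Hypothesis iyy : forall t t', integ (fun z => y t z * y t' z).
Hypothesis iyx : forall t t', integ (fun z => y t z * x t' z).
Hypothesis iux : forall t, integ (fun z => u z * x t z).
Hypothesis iuy : forall t, integ (fun z => u z * y t z).
Hypothesis iuu : integ (fun z => u z * u z).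
Hypothesis ortho_re : forall t t',
  \int[mu]_z (x t z * x t' z + y t z * y t' z) = (t == t')%:R.
Hypothesis ortho_im : forall t t',
  \int[mu]_z (y t z * x t' z - x t z * y t' z) = 0.

(* With [w t = x t + i y t] this is Bessel's inequality for the real function
   [u] and the orthonormal family [w]: expand the integral of
   |u - sum_t (a t - i b t) w t|^2. *)
Lemma bessel_real :
  \sum_(t <- S) ((\int[mu]_z (u z * x t z)) ^+ 2 + (\int[mu]_z (u z * y t z)) ^+ 2)
    <= \int[mu]_z (u z * u z).
Proof.
pose a t := \int[mu]_z (u z * x t z); pose b t := \int[mu]_z (u z * y t z).
pose P z := \sum_(t <- S) (a t * x t z + b t * y t z).
pose Q z := \sum_(t <- S) (a t * y t z - b t * x t z).
pose X t t' z := x t z * x t' z + y t z * y t' z.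
pose Y t t' z := y t z * x t' z - x t z * y t' z.
have iX t t' : integ (X t t') by under eq_fun do rewrite EFinD; exact: integrableD.
have iY t t' : integ (Y t t').
  under eq_fun do rewrite EFinB; apply: integrableB => //.
  by under eq_fun do rewrite mulrC; exact: iyx.
pose f1 z := u z * u z.
pose f2 z := \sum_(t <- S) (a t * (u z * x t z) + b t * (u z * y t z)).
pose f3 z := \sum_(t <- S) \sum_(t' <- S)
  ((a t * a t' + b t * b t') * X t t' z + (b t * a t' - a t * b t') * Y t t' z).
have i2t t : integ (fun z => a t * (u z * x t z) + b t * (u z * y t z)).
  by under eq_fun do rewrite EFinD; apply: integrableD => //; exact: integrableZ.
have i2 : integ f2 by exact: integrable_Rsum.
have i3tt t t' : integ (fun z => (a t * a t' + b t * b t') * X t t' z + (b t * a t' - a t * b t') * Y t t' z).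
  by under eq_fun do rewrite EFinD; apply: integrableD => //; exact: integrableZ.
have i3t t : integ (fun z => \sum_(t' <- S)
  ((a t * a t' + b t * b t') * X t t' z + (b t * a t' - a t * b t') * Y t t' z)).
  exact: integrable_Rsum.
have i3 : integ f3 by exact: integrable_Rsum.
have e2 : \int[mu]_z f2 z = \sum_(t <- S) (a t ^+ 2 + b t ^+ 2).
  rewrite Rintegral_sum//; apply: eq_bigr => t _.
  by rewrite RintD//; try exact: integrableZ; rewrite !RintZ// -/(a t) -/(b t) !expr2.
have e3 : \int[mu]_z f3 z = \sum_(t <- S) (a t ^+ 2 + b t ^+ 2).
  rewrite Rintegral_sum//; apply: eq_big_seq => t tS.
  rewrite Rintegral_sum// (eq_bigr (fun t' => if t' == t then (a t ^+ 2 + b t ^+ 2) else 0)).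
    by rewrite (bigD1_seq t)//= eqxx big1 ?addr0// => i /negPf ->.
  move=> t' _; rewrite RintD//; try exact: integrableZ.
  rewrite !RintZ// ortho_re ortho_im mulr0 addr0 eq_sym.
  by case: eqVneq => [->|_]; rewrite ?mulr1 ?mulr0 ?expr2.
have E z : f1 z - 2 * f2 z + f3 z = (u z - P z) ^+ 2 + Q z ^+ 2.
  have -> : f2 z = u z * P z.
    by rewrite mulr_sumr; apply: eq_bigr => t _; ring.
  have -> : f3 z = P z ^+ 2 + Q z ^+ 2.
    rewrite !expr2 !mulr_suml -big_split/=; apply: eq_bigr => t _.
    rewrite !mulr_sumr -big_split/=; apply: eq_bigr => t' _.
    rewrite /X /Y; ring.
  rewrite /f1; ring.
have : 0 <= \int[mu]_z (f1 z - 2 * f2 z + f3 z).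
  by apply: Rintegral_ge0 => z _; rewrite E addr_ge0// sqr_ge0.
have i12 : integ (fun z => f1 z - 2 * f2 z).
  by under eq_fun do rewrite EFinB; apply: integrableB => //; exact: integrableZ.
rewrite RintD// RintB//; last exact: integrableZ.
rewrite RintZ// e2 e3 /f1 => h.
lra.
Qed.

End bessel.

(** * Size, regularity and kernel bounds of the wavelets *)

Section wavelet_system.
Set Implicit Arguments.
Unset Strict Implicit.
Context {R : realType}.
Local Notation mu := (@lebesgue_measure R).
Variables (psi : R -> complex R) (W P : R -> R) (I : R).
Hypothesis W0 : forall s, 0 <= s -> 0 < W s.
Hypothesis Wdec : forall s t, 0 <= s -> s <= t -> W t <= W s.
Hypothesis PI : forall t, 0 <= P t <= I.
Hypothesis PW : forall t, 0 < t -> t ^+ 2 * W t <= 4 * (P t - P (t / 2)).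
Hypothesis dRe : dominated_with_slope W (fun x => complex.Re (psi x)).
Hypothesis dIm : dominated_with_slope W (fun x => complex.Im (psi x)).
Hypothesis dabs : dominated_with_slope W (fun x => cabs (psi x)).

Let B := 16 * I + 4 * W 0.

Let W00 : 0 <= W 0. Proof. exact/ltW/W0. Qed.

Let I0 : 0 <= I. Proof. by have /andP[p0 pI] := PI 0; exact: le_trans pI. Qed.

Let B0 : 0 <= B. Proof. by have w := W00; have i := I0; rewrite /B; lra. Qed.

(** The boolean selects the real or imaginary part. [wtheta] ignores it, so the two indices of one
    wavelet together produce the squared modulus of the complex coefficient times that of the
    wavelet. *)
Definition wphi (i : int * int * bool) x : R :=
  if i.2 then complex.Re (wav psi i.1.1 i.1.2 x) else complex.Im (wav psi i.1.1 i.1.2 x).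

Definition wtheta (i : int * int * bool) x : R := cabs (wav psi i.1.1 i.1.2 x).

Definition widx n : seq (int * int * bool) :=
  [seq (jk, b) | jk <- [seq (j, k) | j <- zrange n, k <- zrange n], b <- [:: true; false]].

Let c (j : int) : R := Num.sqrt 2 ^ j.

Let c0 j : 0 < c j. Proof. by rewrite exprz_gt0// sqrtr_gt0. Qed.

Let d0 (j : int) : 0 < 2 ^ j :> R. Proof. by rewrite exprz_gt0. Qed.

Let c2 j : c j * c j = 2 ^ j.
Proof. by rewrite /c -expfzMl -expr2 sqr_sqrtr. Qed.

Let q (b : bool) x := if b then complex.Re (psi x) else complex.Im (psi x).

Let dq b : dominated_with_slope W (q b).
Proof. by case: b. Qed.

Lemma Re_scale (a : R) (z : complex R) : complex.Re (a%:C%C * z) = a * complex.Re z.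
Proof. by case: z => x y /=; rewrite mul0r subr0. Qed.

Lemma Im_scale (a : R) (z : complex R) : complex.Im (a%:C%C * z) = a * complex.Im z.
Proof. by case: z => x y /=; rewrite mul0r addr0. Qed.

Lemma cabs_scale (a : R) (z : complex R) : 0 <= a -> cabs (a%:C%C * z) = a * cabs z.
Proof.
move=> a0; rewrite /cabs Re_scale Im_scale !exprMn -mulrDr sqrtrM ?sqr_ge0//.
by rewrite sqrtr_sqr ger0_norm.
Qed.

Lemma wphiE j k b x : wphi (j, k, b) x = c j * q b (2 ^ j * x - k%:~R).
Proof. by rewrite /wphi /wav /q; case: b; rewrite ?Re_scale ?Im_scale. Qed.

Lemma wthetaE j k b x : wtheta (j, k, b) x = c j * cabs (psi (2 ^ j * x - k%:~R)).
Proof. by rewrite /wtheta /wav cabs_scale// ltW. Qed.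

(** One number serving as supremum, Lipschitz constant and bound for the integral: c_j W(0), 2 c_j
    2^j W(0), and 2 c_j W(0) + 8 c_j B / 4^j respectively. Its growth in j is harmless. *)
Definition wL (i : int * int * bool) : R := let j := i.1.1 in
  c j * (3 * W 0 + 2 * (2 ^ j) * W 0 + 8 * B / (2 ^ j) ^+ 2).

Let wLj (j : int) : 0 <= 2 * (2 ^ j) * W 0 /\ 0 <= 8 * B / (2 ^ j) ^+ 2.
Proof.
split; first by apply: mulr_ge0 => //; apply: mulr_ge0 => //; exact: ltW.
by apply: divr_ge0; [exact: mulr_ge0|exact: sqr_ge0].
Qed.

Lemma wL_ge0 i : 0 <= wL i.
Proof.
have w := W00; have [h1 h2] := wLj i.1.1.
by apply: mulr_ge0; [exact: ltW|lra].
Qed.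

Let dom_le_W0 p u : dominated_with_slope W p -> `|p u| <= W 0.
Proof. by move=> [+ _] => /(_ u)/le_trans; apply; apply: Wdec. Qed.

Let dom_lip p u v : dominated_with_slope W p -> `|p u - p v| <= 2 * W 0 * `|u - v|.
Proof.
move=> [_ +] => /(_ u v)/le_trans; apply; rewrite mulrAC ler_wpM2r// ler_wpM2l//.
by apply: Wdec => //; rewrite le_max lexx orbT.
Qed.

Let scaled_le p (j : int) (k : int) x : dominated_with_slope W p ->
  `|c j * p (2 ^ j * x - k%:~R)| <= wL (j, k, true).
Proof.
move=> dp; rewrite normrM gtr0_norm// /wL/= ler_wpM2l ?(ltW (c0 j))//.
have := dom_le_W0 (2 ^ j * x - k%:~R) dp; have w := W00; have [h1 h2] := wLj j; lra.
Qed.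

Let scaled_lip p (j : int) (k : int) x y : dominated_with_slope W p ->
  `|c j * p (2 ^ j * x - k%:~R) - c j * p (2 ^ j * y - k%:~R)| <= wL (j, k, true) * `|x - y|.
Proof.
move=> dp; rewrite -mulrBr normrM gtr0_norm// /wL/= -mulrA ler_wpM2l ?(ltW (c0 j))//.
apply: le_trans (dom_lip _ _ dp) _.
rewrite (_ : 2 ^ j * x - k%:~R - _ = 2 ^ j * (x - y)); last by ring.
rewrite normrM gtr0_norm// mulrA ler_wpM2r//.
have w := W00; have [h1 h2] := wLj j; lra.
Qed.

Lemma wphi_le i x : `|wphi i x| <= wL i.
Proof. by case: i => -[j k] b; rewrite wphiE; exact: scaled_le (dq b). Qed.

Lemma wphi_lip i x y : `|wphi i x - wphi i y| <= wL i * `|x - y|.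
Proof. by case: i => -[j k] b; rewrite !wphiE; exact: scaled_lip (dq b). Qed.

Lemma wtheta_ge0 i x : 0 <= wtheta i x.
Proof. exact: cabs_ge0. Qed.

Lemma wtheta_lip i x y : `|wtheta i x - wtheta i y| <= wL i * `|x - y|.
Proof. by case: i => -[j k] b; rewrite !wthetaE; exact: (scaled_lip j k x y dabs). Qed.

Lemma measurable_wphi i : measurable_fun setT (wphi i).
Proof. exact: lipschitz_measurable (wphi_lip i). Qed.

Lemma measurable_wtheta i : measurable_fun setT (wtheta i).
Proof. exact: lipschitz_measurable (wtheta_lip i). Qed.

(** The line is split at distance 1 from the centre k / 2^j: outside, quadratic decay is integrated
    over annuli; inside, the supremum c_j W(0) is used. *)
Lemma wtheta_integral_le i : (\int[mu]_x (wtheta i x)%:E <= (wL i)%:E)%E.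
Proof.
case: i => -[j k] b; set th := wtheta _.
have mth : measurable_fun setT (fun x => (th x)%:E) by apply/measurable_EFinP; exact: measurable_wtheta.
have th0 x : (0 <= (th x)%:E)%E by rewrite lee_fin; exact: wtheta_ge0.
pose x0 := k%:~R / 2 ^ j : R.
pose D : set R := [set y | 1 <= `|y - x0|].
have mD : measurable D by exact: measurable_outer.
pose J : set R := `[x0 - 1, x0 + 1]%classic.
have mJ : measurable J by exact: measurable_itv.
have e0 : 0 <= (2 ^ j) ^- 2 :> R by rewrite invr_ge0 sqr_ge0.
pose K := c j * B / (2 ^ j) ^+ 2.
have K0 : 0 <= K by apply: mulr_ge0 => //; apply: mulr_ge0 => //; exact: ltW.
have hK y : 1 <= `|y - x0| -> th y <= K * (1 / (y - x0) ^+ 2).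
  move=> y1; rewrite /th wthetaE /K -!mulrA ler_wpM2l ?(ltW (c0 j))//.
  have [+ _] := dabs => /(_ (2 ^ j * y - k%:~R)).
  rewrite ger0_norm ?cabs_ge0// => /le_trans; apply.
  apply: le_trans (quadratic_decay W0 Wdec PI PW _) _ => //.
  rewrite -/B; apply: ler_wpM2l => //.
  have -> : 2 ^ j * y - k%:~R = 2 ^ j * (y - x0).
    by rewrite /x0 mulrBr mulrCA divff ?mulr1// gt_eqF.
  rewrite normrM gtr0_norm//.
  have y0 : 0 < `|y - x0| by lra.
  rewrite mul1r -invfM -[(y - x0) ^+ 2]real_normK ?num_real// -exprMn.
  have m0 : 0 < 2 ^ j * `|y - x0| by rewrite mulr_gt0.
  rewrite lef_pV2 ?posrE ?exprn_gt0//; last lra.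
  by rewrite lerXn2r ?nnegrE//; lra.
have hint r : 1 <= r -> (\int[mu]_(y in `[(x0 - r)%R, (x0 + r)%R]) (cst 1 y)%:E <= (2 * r * 1)%:E)%E.
  move=> r1; rewrite [leLHS](_ : _ = \int[mu]_(y in `[(x0 - r)%R, (x0 + r)%R]) (cst 1%E) y)%E//.
  rewrite integral_cst//= mul1e lebesgue_measure_itv/= lte_fin.
  by case: ifP => _; rewrite -?EFinD lee_fin; lra.
have thD : (\int[mu]_(y in D) (th y)%:E <= (K * (8 * 1))%:E)%E.
  have := integral_annuli_le ltr01 ler01 K0 (measurable_cst _) (fun=> ler01)
    (measurable_wtheta (j, k, b)) (fun y => wtheta_ge0 _ y) hK hint.
  by under eq_integral do rewrite mul1r.
have thJ : (\int[mu]_(y in J) (th y)%:E <= (2 * (c j * W 0))%:E)%E.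
  apply: (@le_trans _ _ (\int[mu]_(y in J) (cst (c j * W 0)%:E) y)%E).
    apply: nnintegral_le => // y _; rewrite lee_fin /th wthetaE ler_wpM2l ?(ltW (c0 j))//.
    by have := dom_le_W0 (2 ^ j * y - k%:~R) dabs; rewrite ger0_norm ?cabs_ge0.
  rewrite integral_cst//= lebesgue_measure_itv/= lte_fin.
  rewrite ifT; last lra.
  by rewrite -EFinD -EFinM lee_fin le_eqVlt; apply/orP; left; apply/eqP; ring.
have DC : setT = D `|` ~` D by rewrite setUv.
rewrite DC nnintegral_disjU//; last 2 first.
- exact: measurableC.
- by apply/disj_setPS => z [].
apply: (@le_trans _ _ ((K * (8 * 1))%:E + (2 * (c j * W 0))%:E)%E).
  apply: leeD => //; apply: le_trans thJ; apply: nnintegral_subset => //; first exact: measurableC.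
  move=> y /= /negP; rewrite -ltNge ltr_norml /J/= in_itv/= => /andP[h1 h2].
  by apply/andP; split; lra.
rewrite -EFinD lee_fin /wL /K /=.
rewrite (_ : _ + 2 * _ = c j * (2 * W 0 + 8 * B / (2 ^ j) ^+ 2)); last first.
  by move: (_ ^- 2) => z; ring.
rewrite ler_wpM2l ?(ltW (c0 j))//.
have w := W00; have [h1 h2] := wLj j; lra.
Qed.

(** Twice the constant of [kernel_le], once for each part of the wavelet; it is the same for every
    finite box of indices. *)
Definition wkap := 8192 * B * I.

Lemma wkap_ge0 : 0 <= wkap.
Proof. exact: mulr_ge0 (mulr_ge0 (ler0n _ _) B0) I0. Qed.

Lemma sum_widx n (F : int * int * bool -> R) :
  \sum_(i <- widx n) F i = \sum_(j <- zrange n) \sum_(k <- zrange n) F (j, k, true) +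
    \sum_(j <- zrange n) \sum_(k <- zrange n) F (j, k, false).
Proof.
rewrite /widx big_allpairs big_allpairs -big_split/=; apply: eq_bigr => j _.
rewrite -big_split/=; apply: eq_bigr => k _.
by rewrite big_cons big_seq1.
Qed.

Lemma wkernel_theta n x x' y : x != y -> `|x - x'| <= `|x - y| / 2 ->
  \sum_(i <- widx n) `|wtheta i x - wtheta i x'| * `|wphi i y| <= wkap * (`|x - x'| / (x - y) ^+ 2).
Proof.
move=> xy xx; rewrite sum_widx.
have half b : \sum_(j <- zrange n) \sum_(k <- zrange n)
    `|wtheta (j, k, b) x - wtheta (j, k, b) x'| * `|wphi (j, k, b) y| <=
    4096 * B * I * (`|x - x'| / (x - y) ^+ 2).
  apply: le_trans (kernel_le W0 Wdec PI PW n dabs (dq b) xy xx).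
  apply: ler_sum => j _; apply: ler_sum => k _.
  rewrite !wthetaE wphiE -mulrBr !normrM gtr0_norm// mulrACA c2.
  by [].
have := half true; have := half false; rewrite /wkap; lra.
Qed.

Lemma wkernel_phi n x x' y : x != y -> `|x - x'| <= `|x - y| / 2 ->
  \sum_(i <- widx n) `|wphi i x - wphi i x'| * wtheta i y <= wkap * (`|x - x'| / (x - y) ^+ 2).
Proof.
move=> xy xx; rewrite sum_widx.
have half b : \sum_(j <- zrange n) \sum_(k <- zrange n)
    `|wphi (j, k, b) x - wphi (j, k, b) x'| * wtheta (j, k, b) y <=
    4096 * B * I * (`|x - x'| / (x - y) ^+ 2).
  apply: le_trans (kernel_le W0 Wdec PI PW n (dq b) dabs xy xx).
  apply: ler_sum => j _; apply: ler_sum => k _.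
  rewrite !wphiE wthetaE -mulrBr !normrM gtr0_norm// mulrACA c2.
  by rewrite [`|cabs _|]ger0_norm ?cabs_ge0.
have := half true; have := half false; rewrite /wkap; lra.
Qed.

End wavelet_system.

(** * The square function on L^2 *)

Section wavelet_bessel.
Set Implicit Arguments.
Unset Strict Implicit.
Context {R : realType}.
Local Notation mu := (@lebesgue_measure R).
Local Notation integ f := (mu.-integrable setT (fun z => (f z)%:E)).

Lemma Re_mul_conj (z w : complex R) :
  complex.Re (z * conjc w) = complex.Re z * complex.Re w + complex.Im z * complex.Im w.
Proof. by case: z w => a b [c d] /=; ring. Qed.

Lemma Im_mul_conj (z w : complex R) :
  complex.Im (z * conjc w) = complex.Im z * complex.Re w - complex.Re z * complex.Im w.
Proof. by case: z w => a b [c d] /=; ring. Qed.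

Lemma cabs_sqr (z : complex R) : cabs z ^+ 2 = complex.Re z * complex.Re z + complex.Im z * complex.Im z.
Proof. by rewrite /cabs sqr_sqrtr ?addr_ge0 ?sqr_ge0// !expr2. Qed.

Lemma zrange_uniq n : uniq (zrange n).
Proof.
rewrite /zrange map_inj_uniq ?iota_uniq// => i i'.
by move=> /(congr1 (fun z => z + n%:Z)); rewrite !subrK => -[].
Qed.

Variables (psi : R -> complex R) (L : int * int * bool -> R).
Local Notation phi := (wphi psi).
Local Notation theta := (wtheta psi).
Hypothesis ortho : forall j k j' k' : int,
  inner (wav psi j k) (wav psi j' k') = if (j == j') && (k == k') then 1%R else 0%R.
Hypothesis mphi : forall i, measurable_fun setT (phi i).
Hypothesis mtheta : forall i, measurable_fun setT (theta i).
Hypothesis phi_le : forall i x, `|phi i x| <= L i.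
Hypothesis theta_int : forall i, (\int[mu]_x (theta i x)%:E <= (L i)%:E)%E.

Let theta0 i x : 0 <= theta i x. Proof. exact: cabs_ge0. Qed.

Let phi_theta t b x : `|phi (t, b) x| <= theta (t, true) x.
Proof. by rewrite /wphi /wtheta/=; case: b => /=; [exact: cabs_Re|exact: cabs_Im]. Qed.

Let iphiphi t b t' b' : integ (fun z => phi (t, b) z * phi (t', b') z).
Proof.
apply: (@le_integrable _ _ _ mu setT measurableT _ (fun z => (L (t', b') * theta (t, true) z)%:E)).
- by apply/measurable_EFinP; apply: measurable_funM; exact: mphi.
- have L0 : 0 <= L (t', b') by apply: le_trans (phi_le (t', b') 0).
  move=> x _; rewrite !abse_EFin lee_fin [leRHS]ger0_norm ?mulr_ge0// normrM mulrC.
  exact: ler_pM.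
- apply: integrableZ; apply/integrableP; split; first by apply/measurable_EFinP; exact: mtheta.
  under eq_integral do rewrite abse_EFin ger0_norm//.
  exact: le_lt_trans (theta_int _) (ltry _).
Qed.

Lemma wortho_re t t' : \int[mu]_z (phi (t, true) z * phi (t', true) z +
    phi (t, false) z * phi (t', false) z) = (t == t')%:R.
Proof.
case: t t' => [j k] [j' k'].
have := congr1 (@complex.Re R) (ortho j k j' k'); rewrite /inner/=.
under eq_Rintegral do rewrite Re_mul_conj.
move=> E; rewrite /wphi/= E xpair_eqE.
by case: (_ && _).
Qed.

Lemma wortho_im t t' : \int[mu]_z (phi (t, false) z * phi (t', true) z -
    phi (t, true) z * phi (t', false) z) = 0.
Proof.
case: t t' => [j k] [j' k'].
have := congr1 (@complex.Im R) (ortho j k j' k'); rewrite /inner/=.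
under eq_Rintegral do rewrite Im_mul_conj.
by move=> E; rewrite /wphi/= E; case: (_ && _).
Qed.

Lemma integral_wtheta_sqr i : (\int[mu]_z (theta i z ^+ 2)%:E = 1)%E.
Proof.
case: i => t b.
have -> : (\int[mu]_z (theta (t, b) z ^+ 2)%:E = \int[mu]_z (phi (t, true) z * phi (t, true) z +
    phi (t, false) z * phi (t, false) z)%:E)%E.
  by apply: eq_integral => z _; rewrite /wtheta cabs_sqr /wphi.
have := wortho_re t t; rewrite eqxx /Rintegral.
(* [fine] sends an infinite integral to 0, so the value 1 also proves finiteness. *)
by case: (integral _ _ _) => [r| |] /= => [->| |] //; move=> /eqP; rewrite eq_sym oner_eq0.
Qed.

(** Each [theta i] has L^2 norm 1, so integrating the squared square function leaves the sum of the
    squared coefficients, and Bessel's inequality finishes. *)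
Lemma wbessel n u : admissible u ->
  (\int[mu]_x (sqfun (widx n) phi theta u x ^+ 2)%:E <= \int[mu]_x (u x ^+ 2)%:E)%E.
Proof.
move=> au.
have auu : admissible (fun x => u x * u x).
  by have [mu' uM _] := au; exact: admissibleM.
have aup i : admissible (fun x => u x * phi i x).
  by apply: admissibleM => //; exists (L i) => x; exact: phi_le.
pose cf i := coef phi u i.
rewrite [leLHS](_ : _ = \int[mu]_x (\sum_(i <- widx n) (cf i ^+ 2)%:E * (theta i x ^+ 2)%:E))%E; last first.
  apply: eq_integral => x _; rewrite l2_sqr -sumEFin; apply: eq_bigr => i _.
  by rewrite exprMn EFinM.
have mt2 i : measurable_fun setT (fun x => (theta i x ^+ 2)%:E : \bar R).
  by apply/measurable_EFinP; exact: measurable_funX.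
rewrite ge0_integral_sum//; last 2 first.
- by move=> i; apply: measurable_funeM; exact: mt2.
- by move=> i x _; rewrite -EFinM lee_fin mulr_ge0// sqr_ge0.
rewrite (eq_bigr (fun i => (cf i ^+ 2)%:E)); last first.
  move=> i _; have t20 x : (0 <= (theta i x ^+ 2)%:E :> \bar R)%E by rewrite lee_fin sqr_ge0.
  by rewrite (nnintegral_scale measurableT (mt2 i) t20 (sqr_ge0 _)) integral_wtheta_sqr mule1.
rewrite sumEFin.
have -> : (\int[mu]_x (u x ^+ 2)%:E = (\int[mu]_x (u x * u x))%:E)%E.
  rewrite /Rintegral fineK; last by apply: integrable_fin_num => //; exact: admissible_integrable auu.
  by apply: eq_integral => x _; rewrite expr2.
rewrite lee_fin.
pose S := [seq (j, k) | j <- zrange n, k <- zrange n].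
have uS : uniq S by apply: allpairs_uniq; [exact: zrange_uniq|exact: zrange_uniq|move=> [a b] [a' b']].
have := @bessel_real R _ S (fun t => phi (t, true)) (fun t => phi (t, false)) u uS.
move=> /(_ (fun t t' => iphiphi _ _ _ _) (fun t t' => iphiphi _ _ _ _) (fun t t' => iphiphi _ _ _ _)
  (fun t => admissible_integrable (aup _)) (fun t => admissible_integrable (aup _))
  (admissible_integrable auu) wortho_re wortho_im).
apply: le_trans; rewrite sum_widx /S big_allpairs -big_split/= le_eqVlt; apply/orP; left; apply/eqP.
by apply: eq_bigr => j _; rewrite -big_split.
Qed.

End wavelet_bessel.

(** * Boundedness of the square function *)

Section truncation.
Set Implicit Arguments.
Unset Strict Implicit.
Context {R : realType} {T : Type}.
Local Notation mu := (@lebesgue_measure R).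

Lemma fatou_le (f_ : nat -> R -> \bar R) (f : R -> \bar R) (B : \bar R) :
  (forall n, measurable_fun setT (f_ n)) -> (forall n x, (0 <= f_ n x)%E) ->
  (forall x, f_ n x @[n --> \oo] --> f x) ->
  (forall n, (\int[mu]_x f_ n x <= B)%E) -> (\int[mu]_x f x <= B)%E.
Proof.
move=> mf f0 cf fB.
have := @fatou _ _ R mu setT measurableT f_ mf (fun n x _ => f0 n x).
under eq_integral do rewrite (cvg_limn_einf_sup (cf _)).1.
move=> /le_trans; apply; rewrite limn_einf_lim; apply: lime_le.
  exact: is_cvg_einfs.
apply: nearW => n; apply: le_trans (fB n).
by apply: ereal_inf_lbound; exists n => //=.
Qed.

Definition cutoff (m : nat) (f : R -> R) : R -> R :=
  fun x => f x * \1_[set y | (`|f y| <= m%:R) && (`|y| <= m%:R)] x.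

Lemma measurable_cutset m (f : R -> R) : measurable_fun setT f ->
  measurable [set y | (`|f y| <= m%:R) && (`|y| <= m%:R)].
Proof.
move=> mf; rewrite (_ : [set y | _] = ~` ([set y | m%:R < `|f y|] `|` [set y | m%:R < `|y|])).
  apply: measurableC; apply: measurableU; apply: measurable_superlevel; first exact: measurableT_comp.
  exact: normr_measurable.
apply/seteqP; split => y /=.
  by move=> /andP[h1 h2] [h|h]; lra.
by move=> h; apply/andP; split; rewrite leNgt; apply/negP => h'; apply: h; [left|right].
Qed.

Lemma cutoffE m f x : cutoff m f x = if (`|f x| <= m%:R) && (`|x| <= m%:R) then f x else 0.
Proof.
rewrite /cutoff indicE; case: ifPn => h; first by rewrite mem_set// mulr1.
by rewrite memNset ?mulr0//; exact/negP.
Qed.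

Lemma cutoff_norm_le m f x : `|cutoff m f x| <= `|f x|.
Proof. by rewrite cutoffE; case: ifP => // _; rewrite normr0. Qed.

Lemma admissible_cutoff m (f : R -> R) : measurable_fun setT f -> admissible (cutoff m f).
Proof.
move=> mf; split.
- by apply: measurable_funM => //; apply: measurable_indic; exact: measurable_cutset.
- by exists m%:R => x; rewrite cutoffE; case: ifP => [/andP[]//|_]; rewrite normr0.
- exists m%:R => x xm; rewrite cutoffE; case: ifP => // /andP[_ xm'].
  by move: xm'; rewrite leNgt xm.
Qed.

Lemma cvg_cutoff f x : cutoff m f x @[m --> \oo] --> f x.
Proof.
apply: cvg_near_cst; exists (Num.truncn (`|f x| + `|x|)).+1 => // m /= hm.
rewrite cutoffE ifT//.
have : `|f x| + `|x| <= m%:R.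
  by apply/ltW; apply: lt_le_trans (truncnS_gt _) _; rewrite ler_nat.
by have := normr_ge0 x; have := normr_ge0 (f x) => *; apply/andP; split; lra.
Qed.

Variables (s : seq T) (phi theta : T -> R -> R).

(** Dominated convergence, with the integrable product f phi_i as majorant. *)
Lemma cvg_coef_cutoff (f : R -> R) i : measurable_fun setT f -> measurable_fun setT (phi i) ->
  mu.-integrable setT (fun x => (f x * phi i x)%:E) ->
  coef phi (cutoff m f) i @[m --> \oo] --> coef phi f i.
Proof.
move=> mf mp fi.
have [|||||_ _ h] := @dominated_convergence _ _ R mu setT measurableT
   (fun m x => (cutoff m f x * phi i x)%:E) (fun x => (f x * phi i x)%:E) (fun x => `|(f x * phi i x)%:E|%E).
- move=> m; apply/measurable_EFinP; apply: measurable_funM => //.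
  by case: (admissible_cutoff m mf).
- by apply/measurable_EFinP; exact: measurable_funM.
- apply: aeW => x _; apply/fine_cvgP; split; first by apply: nearW.
  by apply: cvgM; [exact: cvg_cutoff|exact: cvg_cst].
- exact: integrable_abse.
- apply: aeW => x m _; rewrite !abse_EFin lee_fin normrM [leRHS]normrM ler_wpM2r//; exact: cutoff_norm_le.
apply: fine_cvg; rewrite /coef /Rintegral fineK; last exact: integrable_fin_num.
exact: h.
Qed.

Lemma cvg_sqfun_cutoff (f : R -> R) x : (forall i, coef phi (cutoff m f) i @[m --> \oo] --> coef phi f i) ->
  sqfun s phi theta (cutoff m f) x @[m --> \oo] --> sqfun s phi theta f x.
Proof.
move=> cf; rewrite /sqfun /l2.
apply: (@continuous_cvg _ _ _ _ _ _ (@Num.sqrt R)); first exact: sqrt_continuous.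
elim: s => [|i r IH].
  under eq_fun do rewrite big_nil; rewrite big_nil; exact: cvg_cst.
under eq_fun do rewrite big_cons; rewrite big_cons; apply: cvgD => //.
under eq_fun do rewrite expr2; rewrite expr2.
by apply: cvgM; apply: cvgM => //; exact: cvg_cst.
Qed.

End truncation.

(** * Hoelder's inequality between X and X' *)

Section holder.
Set Implicit Arguments.
Unset Strict Implicit.
Context {R : realType} {rho : (R -> \bar R) -> \bar R}.
Hypothesis Hrho : banach_function_norm rho.
Local Notation mu := (@lebesgue_measure R).

Lemma assoc_ge0 (g : R -> \bar R) : (0 <= assoc rho g)%E.
Proof.
apply: ereal_sup_ubound; exists (fun=> 0%E).
  by split; [split|rewrite (rho0 Hrho)].
by under eq_integral do rewrite mul0e; rewrite integral0.
Qed.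

Lemma holder_assoc (f g : R -> \bar R) : nnmeas f -> nnmeas g -> (rho f < +oo)%E ->
  (\int[mu]_x (f x * g x) <= rho f * assoc rho g)%E.
Proof.
move=> ff gg rf.
have rf0 : (0 <= rho f)%E by exact: (bfn_ge0 Hrho).
have : rho f \is a fin_num by rewrite ge0_fin_numE.
move=> /fineK re; rewrite -re in rf0 *; move: rf0; rewrite lee_fin le_eqVlt => /predU1P[r0|r0].
  (* A function of norm 0 cannot be normalized; it vanishes almost everywhere, and so does the
     product. *)
  rewrite -r0 mul0e.
  have f0 : {ae mu, forall x, f x = 0%E}.
    by apply/(bfn_eq0 Hrho) => //; rewrite -re -r0.
  suff -> : (\int[mu]_x (f x * g x) = \int[mu]_x (cst 0 x))%E by rewrite integral0.
  apply: ge0_ae_eq_integral => //.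
  - by apply: emeasurable_funM; [exact: ff.1|exact: gg.1].
  - by move=> x _; rewrite mule_ge0// ?ff.2 ?gg.2.
  - case: f0 => M [mM M0 fM]; exists M; split => // x nx; apply: fM => fx.
    by apply: nx => _ /=; rewrite fx mul0e.
set r := fine (rho f) in re r0 *.
have rV : 0 <= r^-1 by rewrite invr_ge0 ltW.
pose h x := ((r^-1)%:E * f x)%E.
have hh : nnmeas h.
  by split; [apply: measurable_funeM; exact: ff.1|move=> x; rewrite mule_ge0 ?ff.2// lee_fin].
have rh : (rho h <= 1)%E.
  by rewrite (bfn_homog Hrho)// -re -EFinM mulVf ?gt_eqF.
have -> : (\int[mu]_x (f x * g x) = r%:E * \int[mu]_x (h x * g x))%E.
  rewrite -nnintegral_scale//; last 3 first.
  - by apply: emeasurable_funM; [exact: hh.1|exact: gg.1].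
  - by move=> x; rewrite mule_ge0// ?hh.2 ?gg.2.
  - exact: ltW.
  by apply: eq_integral => x _; rewrite /h !muleA -EFinM mulfV ?gt_eqF// mul1e.
apply: lee_wpmul2l; first by rewrite lee_fin ltW.
by apply: ereal_sup_ubound; exists h.
Qed.

End holder.

From mathcomp Require Import zify.

(** * Exhausting the index set by boxes *)

Section boxes.
Set Implicit Arguments.
Unset Strict Implicit.
Context {R : realType}.

Definition wbox n : seq (int * int) := [seq (j, k) | j <- zrange n, k <- zrange n].

Lemma sum_widx_box n (F : int * int * bool -> R) :
  \sum_(i <- widx n) F i = \sum_(t <- wbox n) (F (t, true) + F (t, false)).
Proof.
by rewrite /widx big_allpairs; apply: eq_bigr => t _; rewrite big_cons big_seq1.
Qed.

Lemma mem_zrange (j : int) n : (j \in zrange n) = (`|j| <= n)%N.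
Proof.
apply/mapP/idP => [[i + ->]|jn].
  by rewrite mem_iota => /andP[_ h]; lia.
exists (absz (j + n%:Z)); first by rewrite mem_iota; lia.
lia.
Qed.

Lemma wbox_uniq n : uniq (wbox n).
Proof. by apply: allpairs_uniq; [exact: zrange_uniq|exact: zrange_uniq|move=> [a b] [a' b']]. Qed.

Lemma wboxS m n : (m <= n)%N -> {subset wbox m <= wbox n}.
Proof.
move=> mn t /allpairsP[[j k] /= [jm km ->]]; apply/allpairsP; exists (j, k).
by split => //=; rewrite mem_zrange; move: jm km; rewrite !mem_zrange /=; lia.
Qed.

Lemma wbox_cover (r : seq (int * int)) : exists n, {subset r <= wbox n}.
Proof.
elim: r => [|[j k] r [n IH]]; first by exists 0%N.
exists (maxn n (maxn `|j| `|k|)) => t; rewrite inE => /predU1P[->|/IH].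
  by apply/allpairsP; exists (j, k); split => //=; rewrite mem_zrange; lia.
by apply: wboxS; exact: leq_maxl.
Qed.

Variable a : int * int -> R.
Hypothesis a0 : forall t, 0 <= a t.

Lemma sum_wbox_mono m n : (m <= n)%N -> \sum_(t <- wbox m) a t <= \sum_(t <- wbox n) a t.
Proof.
move=> mn; rewrite -lee_fin -!sumEFin !(fsbig_seq _ _ (wbox_uniq _)).
by apply: lee_fsum_nneg_subset => // [t|t _]; [rewrite !inE; exact: wboxS|rewrite lee_fin].
Qed.

(** Every finite set of indices lies in a box, so the increasing sums over boxes have the unordered
    sum as supremum. *)
Lemma cvg_sqrt_wbox :
  (Num.sqrt (\sum_(t <- wbox n) a t))%:E @[n --> \oo] --> sqrte (esum setT (fun t => (a t)%:E)).
Proof.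
set u := fun n => (Num.sqrt (\sum_(t <- wbox n) a t))%:E.
have s0 n : 0 <= \sum_(t <- wbox n) a t by exact: sumr_ge0.
have nd : {homo u : n m / (n <= m)%N >-> (n <= m)%E}.
  by move=> n m nm; rewrite lee_fin ler_wsqrtr// sum_wbox_mono.
suff <- : ereal_sup (range u) = sqrte (esum setT (fun t => (a t)%:E)).
  exact: ereal_nondecreasing_cvgn.
have e0 : (0 <= esum setT (fun t => (a t)%:E))%E by apply: esum_ge0 => t _; rewrite lee_fin.
apply/eqP; rewrite eq_le; apply/andP; split.
  apply: ge_ereal_sup => _ [n _ <-]; rewrite [u n](_ : _ = sqrte (\sum_(t <- wbox n) a t)%:E)//.
  rewrite lee_sqrt//; apply: esum_ge; exists [set` wbox n] => //.
    by split => //; exact: finite_seq.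
  by rewrite -fsbig_seq ?wbox_uniq// sumEFin.
set M := ereal_sup _.
have uM n : (u n <= M)%E by apply: ereal_sup_ubound; exists n.
have M0 : (0 <= M)%E by apply: le_trans (uM 0%N); rewrite lee_fin sqrtr_ge0.
rewrite -[leRHS]gee0_abs// -sqrte_sqr lee_sqrt; last by rewrite expe2 mule_ge0.
apply: ge_ereal_sup => _ [A [/finite_seqP[r ->] _] <-].
have [n rn] := wbox_cover r.
apply: (@le_trans _ _ (u n ^+ 2)%E).
  rewrite [(u n ^+ 2)%E](_ : _ = (\sum_(t <- wbox n) a t)%:E); last first.
    by rewrite /u -EFin_expe sqr_sqrtr.
  rewrite -sumEFin (fsbig_seq _ _ (wbox_uniq n)).
  by apply: lee_fsum_nneg_subset => // [t|t _]; [rewrite !inE; exact: rn|rewrite lee_fin].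
rewrite !expe2; apply: lee_pmul => //; by rewrite lee_fin sqrtr_ge0.
Qed.

End boxes.

(** * Bounds uniform in the box, and passage to all indices *)

Section square_function_bound.
Set Implicit Arguments.
Unset Strict Implicit.
Context {R : realType} {rho : (R -> \bar R) -> \bar R}.
Local Notation mu := (@lebesgue_measure R).
Variables (psi : R -> complex R) (W P : R -> R) (I k1 k2 : R).
Hypothesis Hrho : banach_function_norm rho.
Hypothesis k10 : 0 < k1.
Hypothesis M1 : forall f, inX rho f -> measurable_fun [set: R] (maximal f) /\
     (rho (maximal f) <= k1%:E * rho (cabsf f))%E.
Hypothesis k20 : 0 < k2.
Hypothesis M2 : forall f, inX (assoc rho) f -> measurable_fun [set: R] (maximal f) /\
     (assoc rho (maximal f) <= k2%:E * assoc rho (cabsf f))%E.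
Hypothesis ortho : forall j k j' k' : int,
  inner (wav psi j k) (wav psi j' k') = if (j == j') && (k == k') then 1%R else 0%R.
Hypothesis W0 : forall s, 0 <= s -> 0 < W s.
Hypothesis Wdec : forall s t, 0 <= s -> s <= t -> W t <= W s.
Hypothesis PI : forall t, 0 <= P t <= I.
Hypothesis PW : forall t, 0 < t -> t ^+ 2 * W t <= 4 * (P t - P (t / 2)).
Hypothesis dRe : dominated_with_slope W (fun x => complex.Re (psi x)).
Hypothesis dIm : dominated_with_slope W (fun x => complex.Im (psi x)).
Hypothesis dabs : dominated_with_slope W (fun x => cabs (psi x)).
Hypothesis wX' : forall j k : int, inX (assoc rho) (wav psi j k).

Local Notation phi := (wphi psi).
Local Notation theta := (wtheta psi).
Local Notation L := (wL W I).
Local Notation kap := (wkap W I).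

Let L0 := wL_ge0 W0 PI.
Let phib := wphi_le W0 Wdec PI dRe dIm.
Let phiL := wphi_lip W0 Wdec PI dRe dIm.
Let thetaL := wtheta_lip W0 Wdec PI dabs.
Let mphi := measurable_wphi W0 Wdec PI dRe dIm.
Let mtheta := measurable_wtheta W0 Wdec PI dabs.
Let thetaI := wtheta_integral_le W0 Wdec PI PW dabs.
Let kap0 : 0 <= kap := wkap_ge0 W0 PI.

(** The first [k1] bounds the maximal function of f in X and [k2] that of g in X'; the last [k1] is
    the bound on the associate norm of the dual step functions g themselves. *)
Let C0 := 8 * cz_const kap * k1 * k2 * k1.

Let cz0 : 0 <= 8 * cz_const kap.
Proof. by have k0 : 0 <= kap := kap0; rewrite /cz_const; lra. Qed.

(** Membership of the wavelets in X' enters here, through Hoelder's inequality; it makes the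
    coefficients genuine integrals. *)
Lemma pairing_integrable (f : R -> complex R) (f1 : R -> R) i : inX rho f ->
  measurable_fun setT f1 -> (forall x, `|f1 x| <= cabs (f x)) ->
  mu.-integrable setT (fun x => (f1 x * phi i x)%:E).
Proof.
move=> [mf rf] m1 f1f; case: i => -[j k] b.
have [mw rw] := wX' j k.
have nf := nnmeas_cabsf mf; have nw := nnmeas_cabsf mw.
apply/integrableP; split.
  by apply/measurable_EFinP; apply: measurable_funM => //; exact: mphi.
have fin : (rho (cabsf f) * assoc rho (cabsf (wav psi j k)) < +oo)%E.
  have f1' : rho (cabsf f) \is a fin_num by rewrite ge0_fin_numE// (bfn_ge0 Hrho).
  have f2' : assoc rho (cabsf (wav psi j k)) \is a fin_num by rewrite ge0_fin_numE// (assoc_ge0 Hrho).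
  by rewrite -(fineK f1') -(fineK f2') -EFinM ltry.
apply: le_lt_trans fin; apply: le_trans (holder_assoc Hrho nf nw rf).
apply: nnintegral_le => //.
- apply: measurableT_comp => //; apply/measurable_EFinP; apply: measurable_funM => //; exact: mphi.
- by apply: emeasurable_funM; [exact: nf.1|exact: nw.1].
move=> x _; rewrite abse_EFin normrM -EFinM lee_fin; apply: ler_pM => //.
by rewrite /wphi/=; case: b; [exact: cabs_Re|exact: cabs_Im].
Qed.

(** [f1] stands for the real or imaginary part of f. The bilinear estimate needs an admissible
    function, so it is applied to the cutoffs of [f1]: all of them lie below |f|, hence their
    averages lie below one and the same maximal function, and Fatou's lemma removes the cutoff. *)
Lemma rho_sqfun_le (f : R -> complex R) (f1 : R -> R) n : inX rho f ->
  measurable_fun setT f1 -> (forall x, `|f1 x| <= cabs (f x)) ->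
  (rho (fun x => (sqfun (widx n) phi theta f1 x)%:E) <= C0%:E * rho (cabsf f))%E.
Proof.
move=> fX m1 f1f.
have [mf rf] := fX; have nf := nnmeas_cabsf mf.
have rff : rho (cabsf f) \is a fin_num by rewrite ge0_fin_numE// (bfn_ge0 Hrho).
set r := fine (rho (cabsf f)).
have rE : rho (cabsf f) = r%:E by rewrite /r fineK.
have r0 : 0 <= r by rewrite -lee_fin -rE (bfn_ge0 Hrho).
rewrite rE -EFinM.
pose LF := \sum_(i <- widx n) `|coef phi f1 i| * L i.
have LF0 : 0 <= LF by apply: sumr_ge0 => i _; apply: mulr_ge0 => //; exact: L0.
apply: (rho_lipschitz_le_of_dual Hrho k10 M1 LF0).
- by move=> x; exact: sqfun_ge0.
- by move=> x y; exact: (sqfun_lipschitz _ _ thetaL).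
move=> g mg g0 ag.
have gc x : cabsf (fun t => ((g t)%:C)%C) x = (g x)%:E by rewrite /cabsf cabs_real ger0_norm.
have gX : inX (assoc rho) (fun t => ((g t)%:C)%C).
  split; first by split => //=; exact: measurable_cst.
  by rewrite (_ : cabsf _ = (fun t => (g t)%:E)); [exact: le_lt_trans ag (ltry _)|exact/funext].
have [mMf rMf] := M1 fX; have [mMg rMg] := M2 gX.
have nMf : nnmeas (maximal f) by split => // x; exact: maximal_ge0.
have nMg : nnmeas (maximal (fun t => ((g t)%:C)%C)) by split => // x; exact: maximal_ge0.
have MfMg : (\int[mu]_x (maximal f x * maximal (fun t => ((g t)%:C)%C) x) <= (k1 * r * (k2 * k1))%:E)%E.
  have rMf' : (rho (maximal f) < +oo)%E.
    by apply: le_lt_trans rMf _; rewrite rE -EFinM ltry.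
  apply: le_trans (holder_assoc Hrho nMf nMg rMf') _.
  rewrite [leRHS]EFinM; apply: lee_pmul.
  - exact: (bfn_ge0 Hrho).
  - exact: (assoc_ge0 Hrho).
  - by rewrite EFinM -rE.
  apply: le_trans rMg _; rewrite EFinM; apply: lee_wpmul2l; first by rewrite lee_fin ltW.
  by rewrite (_ : cabsf _ = (fun t => (g t)%:E))//; exact/funext.
apply: (@fatou_le R (fun m x => (sqfun (widx n) phi theta (cutoff m f1) x)%:E * (g x)%:E)%E).
- move=> m; apply: emeasurable_funM; last exact/measurable_EFinP.
  by apply/measurable_EFinP; exact: (measurable_sqfun _ _ thetaL).
- by move=> m x; rewrite mule_ge0// lee_fin// sqfun_ge0.
- move=> x; apply/fine_cvgP; split; first by apply: nearW.
  apply: cvgM; last exact: cvg_cst.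
  apply: cvg_sqfun_cutoff => i; apply: cvg_coef_cutoff => //.
  exact: pairing_integrable fX m1 f1f.
move=> m.
have au := admissible_cutoff m m1.
apply: le_trans (sqfun_dual_le L0 phib phiL (fun i x => wtheta_ge0 psi i x) thetaL thetaI kap0
  (@wkernel_theta _ _ _ _ _ W0 Wdec PI PW dRe dIm dabs n) (@wkernel_phi _ _ _ _ _ W0 Wdec PI PW dRe dIm dabs n)
  (fun u au => wbessel ortho mphi mtheta phib thetaI n au) au _ mMf mMg _ nMf.2 nMg.2 _ _) _.
- exact/measurable_EFinP.
- by move=> z; rewrite lee_fin.
- move=> a b y ab ayb; apply: le_trans (average_le_maximal f ab ayb).
  apply: lee_wpmul2l; first by rewrite lee_fin invr_ge0 subr_ge0 ltW.
  apply: nnintegral_le => //.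
  + by apply/measurable_EFinP; apply: measurableT_comp => //; case: au.
  + exact: nf.1.
  by move=> t _; rewrite lee_fin; apply: le_trans (f1f t); exact: cutoff_norm_le.
- move=> a b y ab ayb; apply: le_trans (average_le_maximal _ ab ayb).
  by under [in leRHS]eq_integral do rewrite gc.
apply: le_trans (lee_wpmul2l _ MfMg) _; first by rewrite lee_fin.
by rewrite -EFinM lee_fin /C0 le_eqVlt; apply/orP; left; apply/eqP; ring.
Qed.

Let fRe (f : R -> complex R) x := complex.Re (f x).
Let fIm (f : R -> complex R) x := complex.Im (f x).

Definition Vbox (f : R -> complex R) n x : R :=
  Num.sqrt (\sum_(t <- wbox n) cabs (inner f (wav psi t.1 t.2) * wav psi t.1 t.2 x) ^+ 2).

Lemma cabsM_sqr (z w : complex R) : cabs (z * w) ^+ 2 = cabs z ^+ 2 * cabs w ^+ 2.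
Proof. by rewrite !cabs_sqr; case: z w => a b [c d] /=; ring. Qed.

(** Both parts of the complex pairing are sums or differences of two of the four real pairings
    between parts of f and parts of the wavelet; the factor 2 separates them. *)
Lemma inner_sqr_le (f : R -> complex R) t : inX rho f ->
  cabs (inner f (wav psi t.1 t.2)) ^+ 2 <=
   2 * (coef phi (fRe f) (t, true) ^+ 2 + coef phi (fRe f) (t, false) ^+ 2 +
        coef phi (fIm f) (t, true) ^+ 2 + coef phi (fIm f) (t, false) ^+ 2).
Proof.
move=> fX; have [[mr mi] _] := fX; case: t => j k.
have ir b : mu.-integrable setT (fun x => (fRe f x * phi (j, k, b) x)%:E).
  by apply: pairing_integrable fX mr _ => x; exact: cabs_Re.
have ii b : mu.-integrable setT (fun x => (fIm f x * phi (j, k, b) x)%:E).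
  by apply: pairing_integrable fX mi _ => x; exact: cabs_Im.
rewrite cabs_sqr /inner/=.
under eq_Rintegral do rewrite Re_mul_conj.
under [X in _ + X * X <= _]eq_Rintegral do rewrite Im_mul_conj.
rewrite -[X in X * X + _ <= _]/(\int[mu]_x (fRe f x * phi (j, k, true) x + fIm f x * phi (j, k, false) x)).
rewrite -[X in _ + X * X <= _]/(\int[mu]_x (fIm f x * phi (j, k, true) x - fRe f x * phi (j, k, false) x)).
rewrite RintD// RintB// -![\int[mu]_x _]/(coef phi _ _).
set a := coef _ _ _; set b := coef _ _ _; set a' := coef _ _ _; set b' := coef _ _ _.
have := sqr_ge0 (a - b); have := sqr_ge0 (a' + b'); rewrite !expr2; lra.
Qed.

Lemma Vbox_le (f : R -> complex R) n x : inX rho f ->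
  Vbox f n x <= 2 * (sqfun (widx n) phi theta (fRe f) x + sqfun (widx n) phi theta (fIm f) x).
Proof.
move=> fX.
have s1 := sqfun_ge0 (widx n) phi theta (fRe f) x.
have s2 := sqfun_ge0 (widx n) phi theta (fIm f) x.
rewrite -(ler_pXn2r (n := 2))// ?nnegrE ?sqrtr_ge0 ?mulr_ge0 ?addr_ge0//.
rewrite sqr_sqrtr; last by apply: sumr_ge0 => t _; exact: sqr_ge0.
apply: (@le_trans _ _ (2 * (sqfun (widx n) phi theta (fRe f) x ^+ 2 + sqfun (widx n) phi theta (fIm f) x ^+ 2))).
  rewrite !l2_sqr !sum_widx_box -big_split/= mulr_sumr; apply: ler_sum => t _.
  rewrite cabsM_sqr.
  apply: le_trans (ler_wpM2r (sqr_ge0 _) (inner_sqr_le t fX)) _.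
  rewrite le_eqVlt; apply/orP; left; apply/eqP.
  by rewrite /wtheta/=; ring.
rewrite !expr2; nra.
Qed.

Lemma measurable_Vbox (f : R -> complex R) n : measurable_fun setT (Vbox f n).
Proof.
apply: (measurableT_comp measurable_sqrt); apply: measurable_sum => t.
rewrite (_ : (fun x => _) = (fun x => cabs (inner f (wav psi t.1 t.2)) ^+ 2 * theta (t, true) x ^+ 2)).
  by apply: measurable_funM => //; apply: measurable_funX; exact: mtheta.
by apply/funext => x; rewrite cabsM_sqr.
Qed.

Lemma rho_Vbox_le (f : R -> complex R) n : inX rho f ->
  (rho (fun x => (Vbox f n x)%:E) <= (4 * C0)%:E * rho (cabsf f))%E.
Proof.
move=> fX; have [[mr mi] rf] := fX.
have n1 (u : R -> R) : nnmeas (fun x => (sqfun (widx n) phi theta u x)%:E).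
  by apply: nnmeas_EFin; [exact: (measurable_sqfun _ _ thetaL)|move=> x; exact: sqfun_ge0].
have nV : nnmeas (fun x => (Vbox f n x)%:E).
  by apply: nnmeas_EFin; [exact: measurable_Vbox|move=> x; exact: sqrtr_ge0].
pose F x := ((sqfun (widx n) phi theta (fRe f) x)%:E + (sqfun (widx n) phi theta (fIm f) x)%:E)%E.
have nF : nnmeas F.
  split; first by apply: emeasurable_funD; [exact: (n1 _).1|exact: (n1 _).1].
  by move=> x; rewrite adde_ge0 ?(n1 _).2.
have n2F : nnmeas (fun x => 2%:E * F x)%E.
  split; first exact: measurable_funeM nF.1.
  by move=> x; rewrite mule_ge0 ?nF.2.
apply: (@le_trans _ _ (rho (fun x => 2%:E * F x)%E)).
  apply: (rho_le Hrho) => // x.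
  by rewrite /F /= -EFinD -EFinM lee_fin; exact: Vbox_le.
rewrite (bfn_homog Hrho)//.
apply: (@le_trans _ _ (2%:E * (C0%:E * rho (cabsf f) + C0%:E * rho (cabsf f)))%E).
  apply: lee_wpmul2l => //; apply: le_trans (bfn_subadd Hrho (n1 _) (n1 _)) _.
  apply: leeD; apply: rho_sqfun_le => // x; [exact: cabs_Re|exact: cabs_Im].
have rff : rho (cabsf f) \is a fin_num.
  by rewrite ge0_fin_numE// (bfn_ge0 Hrho)//; apply: nnmeas_cabsf; case: fX.
move: (rho (cabsf f)) rff => [r| |]// _.
by rewrite -[(C0%:E * r%:E)%E]EFinM -EFinD -!EFinM lee_fin le_eqVlt; apply/orP; left; apply/eqP; ring.
Qed.

(** The bound for boxes is uniform, so the Fatou property carries it to the full sum. The 4 is the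
    factor 2 of [Vbox_le] times the two parts of f; adding 1 makes the constant positive. *)
Lemma Vop_bounded (f : R -> complex R) : inX rho f ->
  measurable_fun [set: R] (Vop psi f) /\ (rho (Vop psi f) <= (4 * C0 + 1)%:E * rho (cabsf f))%E.
Proof.
move=> fX; have [cf rf] := fX.
have cv x : (Vbox f n x)%:E @[n --> \oo] --> Vop psi f x.
  exact: (@cvg_sqrt_wbox R (fun t => cabs (inner f (wav psi t.1 t.2) * wav psi t.1 t.2 x) ^+ 2) (fun t => sqr_ge0 _)).
have nV n : nnmeas (fun x => (Vbox f n x)%:E).
  by apply: nnmeas_EFin; [exact: measurable_Vbox|move=> x; exact: sqrtr_ge0].
have mV : measurable_fun [set: R] (Vop psi f).
  by apply: (emeasurable_fun_cvg (fun n x => (Vbox f n x)%:E)) => [n|x _]; [exact: (nV n).1|exact: cv].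
split => //.
have nVop : nnmeas (Vop psi f) by split => // x; exact: sqrte_ge0.
have [||_ cr] := bfn_fatou Hrho (fs := fun n x => (Vbox f n x)%:E) _ nVop _ => //.
  apply: aeW => x; split; last exact: cv.
  move=> m n mn; rewrite lee_fin ler_wsqrtr// sum_wbox_mono// => t; exact: sqr_ge0.
rewrite -(cvg_lim _ cr)//; apply: lime_le; first by apply/cvg_ex; eexists; exact: cr.
apply: nearW => n; apply: le_trans (rho_Vbox_le n fX) _.
apply: lee_wpmul2r; last by rewrite lee_fin lerDl.
by apply: (bfn_ge0 Hrho); exact: nnmeas_cabsf.
Qed.

Let C00 : 0 < 4 * C0 + 1.
Proof.
suff : 0 <= C0 by lra.
apply: mulr_ge0; last exact: ltW.
by apply: mulr_ge0; [apply: mulr_ge0; [exact: cz0|exact: ltW]|exact: ltW].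
Qed.

Lemma Vop_bounded_on : bounded_on rho (Vop psi).
Proof. by exists (4 * C0 + 1); split; [exact: C00|exact: Vop_bounded]. Qed.

End square_function_bound.

Local Open Scope ereal_scope.

Theorem theorem2p9 (R : realType) (rho : (R -> \bar R) -> \bar R)
    (psi : R -> complex R) (W : R -> R) :
  banach_function_norm rho ->
  separable_X rho ->
  bounded_on rho (@maximal R) ->
  bounded_on (assoc rho) (@maximal R) ->
  orthonormal_wavelet psi ->
  cdifferentiable psi ->
  radial_majorant W psi ->
  radial_majorant W (cderiv psi) ->
  \int[@lebesgue_measure R]_(s in [set s : R | (0 <= s)%R]) (s * W s)%:E < +oo ->
  (forall j k : int, inX (assoc rho) (wav psi j k)) ->
  bounded_on rho (Vop psi).
Proof.
move=> Hrho _ [k1 [k10 M1]] [k2 [k20 M2]] [_ [ortho _]] dpsi Wpsi Wdpsi sW wX'.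
have [W0 iW Wdec _] := Wpsi.
have [P [I [PI PW]]] := majorant_potential W0 Wdec iW sW.
exact: (Vop_bounded_on Hrho k10 M1 k20 M2 ortho W0 Wdec PI PW
  (dominated_Re dpsi Wpsi Wdpsi) (dominated_Im dpsi Wpsi Wdpsi) (dominated_cabs dpsi Wpsi Wdpsi) wX').
Qed.
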